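(* Let $\Omega\subset\mathbb{R}^n$ be an open bounded domain with $C^1$ boundary and $0\in\Omega$, let $1<p<n$ and $-\infty<a<\frac{n-p}{p}$. If $1\le r<\frac{np}{n-p}$ and $\alpha\in\mathbb{R}$ satisfies $\alpha<(1+a)r+n\left(1-\frac{r}{p}\right)$, then the imbedding $\mathcal{D}_a^{1,p}(\Omega)\hookrightarrow L^r(\Omega,|x|^{-\alpha})$ is compact.
   Context: $\mathcal{D}_a^{1,p}(\Omega)$ is the completion of $C_0^\infty(\Omega)$ with respect to the norm $\|u\|=\left(\int_\Omega |x|^{-ap}|Du|^p\,dx\right)^{1/p}$. $L^r(\Omega,|x|^{-\alpha})$ is the weighted Lebesgue space with norm $\|u\|_{r,\alpha}=\left(\int_\Omega |x|^{-\alpha}|u|^r\,dx\right)^{1/r}$. *)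

(* Defs.v *)
From HB Require Import structures.
From mathcomp Require Import all_boot all_order all_algebra.
From mathcomp Require Import all_classical all_reals all_analysis.
Set Implicit Arguments.
Unset Strict Implicit.
Unset Printing Implicit Defensive.
Import Order.TTheory GRing.Theory Num.Theory.
Import numFieldNormedType.Exports.
Local Open Scope classical_set_scope.
Local Open Scope ring_scope.

(* The points of R^n are the row vectors 'rV[R]_n.  The library provides their
   topology and the sup norm (written `|x|); the Euclidean norm, the
   sigma-algebra and the Lebesgue measure are set up here. *)

Section lebesgue_rV.
Context {R : realType}.

Definition rV_display : measure_display.
Proof. exact: default_measure_display. Qed.

Section measurable_rV.
Variable n : nat.

Let coord (i : 'I_n) (x : 'rV[R]_n) : measurableTypeR R := x ord0 i.

Let rV_set0 : g_sigma_preimage coord set0.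
Proof. exact: sigma_algebra0. Qed.

Let rV_setC A : g_sigma_preimage coord A -> g_sigma_preimage coord (~` A).
Proof. exact: sigma_algebraC. Qed.

Let rV_bigcup (F : _^nat) : (forall i, g_sigma_preimage coord (F i)) ->
  g_sigma_preimage coord (\bigcup_i (F i)).
Proof. exact: sigma_algebra_bigcup. Qed.

(* The sigma-algebra generated by the coordinates, i.e., the Borel one. *)
HB.instance Definition _ := @isMeasurable.Build rV_display
  'rV[R]_n (g_sigma_preimage coord) rV_set0 rV_setC rV_bigcup.

Lemma measurable_coord (i : 'I_n) : measurable_fun [set: 'rV[R]_n] (coord i).
Proof.
move=> _ Y mY; rewrite setTI; apply: sub_sigma_algebra => /=.
rewrite -bigcup_seq/=; exists i => /=; first by rewrite mem_index_enum.
by exists Y => //; rewrite setTI.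
Qed.

Lemma measurable_fun_rV d (T : measurableType d) (f : T -> 'rV[R]_n) :
  (forall i, measurable_fun [set: T] (coord i \o f)) ->
  measurable_fun [set: T] f.
Proof.
move=> mf _ B; suff sub : g_sigma_preimage coord `<=`
    [set A | measurable ([set: T] `&` f @^-1` A)] by exact: sub.
apply: smallest_sub.
  split => /=; first by rewrite preimage_set0 setI0.
  - by move=> A mA; rewrite setTD preimage_setC setTI; apply: measurableC;
      rewrite -[X in measurable X]setTI.
  - move=> F mF; rewrite preimage_bigcup setI_bigcupr.
    exact: bigcupT_measurable.
rewrite -bigcup_seq => A [i _ [Y mY <-]] /=; rewrite !setTI.
by rewrite -[X in measurable X]setTI; exact: mf.
Qed.

End measurable_rV.

Definition rV_cons n (p : 'rV[R]_n * measurableTypeR R) : 'rV[R]_n.+1 :=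
  row_mx (p.2 : R)%:M p.1.

Lemma measurable_rV_cons n : measurable_fun [set: _] (@rV_cons n).
Proof.
apply: measurable_fun_rV => i /=.
have [j|j] := splitP (i : 'I_(1 + n)) => ij.
- rewrite (_ : _ \o _ = snd); first exact: measurable_snd.
  apply/funext => -[v x] /=; rewrite /rV_cons.
  have -> : i = lshift n j by apply/val_inj.
  by rewrite (row_mxEl (x%:M : 'M[R]_1)) mxE (ord1 j) eqxx mulr1n.
- rewrite (_ : _ \o _ = (fun v : 'rV[R]_n => v ord0 j) \o fst).
    apply: measurableT_comp; [exact: measurable_coord|exact: measurable_fst].
  apply/funext => -[v x] /=; rewrite /rV_cons.
  have -> : i = rshift 1 j by apply/val_inj.
  by rewrite (row_mxEr (x%:M : 'M[R]_1)).
Qed.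


HB.instance Definition _ n :=
  isMeasurableFun.Build _ _ _ _ (@rV_cons n) (@measurable_rV_cons n).

Section cons_measure.
Variables (n : nat) (mu : {measure set 'rV[R]_n -> \bar R}).

(* The product of [mu] with the Lebesgue measure of the line, carried over to
   R^(n+1) by [rV_cons]. *)
Definition cons_measure : set 'rV[R]_n.+1 -> \bar R :=
  pushforward (mu \x lebesgue_measure)%E (@rV_cons n).

Let cons_measure0 : cons_measure set0 = 0%E.
Proof. exact: measure0. Qed.

Let cons_measure_ge0 A : (0 <= cons_measure A)%E.
Proof. exact: measure_ge0. Qed.

Let cons_measure_sigma_additive : semi_sigma_additive cons_measure.
Proof.
apply: measure_semi_sigma_additive; exact: measurable_rV_cons.
Qed.

HB.instance Definition _ := isMeasure.Build _ _ _ cons_measure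
  cons_measure0 cons_measure_ge0 cons_measure_sigma_additive.

End cons_measure.

Fixpoint lebesgue_rV n : {measure set 'rV[R]_n -> \bar R} :=
  match n with
  | 0 => \d_(0 : 'rV[R]_0)
  | m.+1 => cons_measure (lebesgue_rV m)
  end.

End lebesgue_rV.

Section smooth_functions.
Context {R : realType}.

Definition enorm n (x : 'rV[R]_n) : R := Num.sqrt (\sum_i x ord0 i ^+ 2).

Definition partial n (i : 'I_n) (f : 'rV[R]_n -> R) (x : 'rV[R]_n) : R :=
  'D_(delta_mx ord0 i) f x.

Definition grad n (f : 'rV[R]_n -> R) (x : 'rV[R]_n) : 'rV[R]_n :=
  \row_i partial i f x.

Fixpoint Ck k n (f : 'rV[R]_n -> R) : Prop :=
  continuous f /\
  match k with
  | 0 => True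
  | k'.+1 => forall i : 'I_n,
      (forall x, derivable f x (delta_mx ord0 i)) /\ Ck k' (partial i f)
  end.

Definition C0infty n (Omega : set 'rV[R]_n) : set ('rV[R]_n -> R) :=
  [set f | [/\ forall k, Ck k f,
               compact (closure [set x | f x != 0]) &
               closure [set x | f x != 0] `<=` Omega]].

(* Around each boundary point, and after relabelling (choice of i) and
   reorienting (sign) the coordinate axes, Omega is the region above the graph
   of a C^1 function of the other n - 1 coordinates.  For an open set, the
   boundary is [closure Omega `\` Omega]. *)
Definition C1_boundary n (Omega : set 'rV[R]_n) : Prop :=
  forall x0, (closure Omega `\` Omega) x0 ->
  exists (e : R) (i : 'I_n) (s : bool) (gamma : 'rV[R]_n.-1 -> R),
    [/\ 0 < e, Ck 1 gamma &
        forall x, enorm (x - x0) < e ->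
          Omega x <-> 0 < (-1) ^+ s * (x ord0 i - gamma (col' i x))].

End smooth_functions.

Section weighted_spaces.
Context {R : realType} {n : nat}.
Implicit Types (Omega : set 'rV[R]_n) (f : 'rV[R]_n -> R).

(* At x = 0 the weight is the total power function's value at 0; this is
   immaterial, a point being Lebesgue negligible. *)
Definition wLnorm Omega (r alpha : R) f : \bar R :=
  ((\int[lebesgue_rV n]_(x in Omega)
      (enorm x `^ (- alpha) * `|f x| `^ r)%:E) `^ r^-1)%E.

(* Functions representing the elements of L^r(Omega, |x|^(- alpha)); two of
   them represent the same element iff they are equal a.e. in Omega. *)
Definition wLspace Omega (r alpha : R) : set ('rV[R]_n -> R) :=
  [set f | measurable_fun Omega f /\ (wLnorm Omega r alpha f < +oo)%E].

Definition Dnorm Omega (a p : R) f : \bar R :=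
  wLnorm Omega p (a * p) (fun x => enorm (grad f x)).

(* The Banach space D, with the map j, is a completion of C_0^oo(Omega) for the
   norm [Dnorm Omega a p]: j is a linear isometry with dense range.  Completions
   are unique up to a unique isometric isomorphism.  The values of j outside
   C_0^oo(Omega) are irrelevant. *)
Definition is_D1p_completion Omega (a p : R) (D : completeNormedModType R)
    (j : ('rV[R]_n -> R) -> D) : Prop :=
  [/\ forall (c : R) f g, C0infty Omega f -> C0infty Omega g ->
        j (fun x => c * f x + g x) = c *: j f + j g,
      forall f, C0infty Omega f -> `|j f|%:E = Dnorm Omega a p f &
      dense (j @` C0infty Omega)].

(* T represents a continuous linear injection of D into
   L^r(Omega, |x|^(- alpha)) that is the inclusion on C_0^oo(Omega). *)
Record is_imbedding Omega (r alpha : R) (D : completeNormedModType R)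
    (j : ('rV[R]_n -> R) -> D) (T : D -> 'rV[R]_n -> R) : Prop := {
  imbedding_wLspace : forall v, wLspace Omega r alpha (T v) ;
  imbedding_linear : forall (c : R) v w,
    ae_eq (lebesgue_rV n) Omega (T (c *: v + w)) (fun x => c * T v x + T w x) ;
  imbedding_C0infty : forall f, C0infty Omega f ->
    ae_eq (lebesgue_rV n) Omega (T (j f)) f ;
  imbedding_injective : forall v w,
    ae_eq (lebesgue_rV n) Omega (T v) (T w) -> v = w ;
  imbedding_continuous : exists C : R, forall v,
    (wLnorm Omega r alpha (T v) <= (C * `|v|)%:E)%E
}.

(* Every bounded sequence has a subsequence whose image converges in
   L^r(Omega, |x|^(- alpha)). *)
Definition is_compact_map Omega (r alpha : R) (D : completeNormedModType R)
    (T : D -> 'rV[R]_n -> R) : Prop :=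
  forall v_ : nat -> D, bounded_set (range v_) ->
  exists (sigma : nat -> nat) (w : 'rV[R]_n -> R),
    [/\ {homo sigma : k l / (k < l)%N},
        wLspace Omega r alpha w &
        wLnorm Omega r alpha (T (v_ (sigma k)) \- w) @[k --> \oo] --> 0%E].

End weighted_spaces.

(* Main.v *)
(* R^n minus the origin is cut into dyadic shells, each covered by 2n boxes on
   which the weights are comparable to constants.  On a box, u is compared with
   its averages over the dyadic sub-boxes of generation k: as r is below the
   Sobolev exponent, the jumps of these averages decay geometrically and
   |u - u_k|_r <= C theta^k |Du|_p.  The averages over the shells themselves are
   controlled by telescoping outwards to where u vanishes.  On the shell of size
   l this bounds the weighted norm of u by a positive power of l times the
   energy.  Summing over the shells gives the imbedding; moreover the weighted
   norm is, up to any eta > 0, controlled by finitely many averages of u, which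
   are bounded linear functionals, hence compactness.  The extension to the
   completion is injective because the gradient is closable away from the
   origin. *)
Require Import Defs.
From HB Require Import structures.
From mathcomp Require Import all_boot all_order all_algebra.
From mathcomp Require Import all_classical all_reals all_analysis measurable_realfun.
From mathcomp Require Import ring lra.
Set Implicit Arguments.
Unset Strict Implicit.
Unset Printing Implicit Defensive.
Import Order.TTheory GRing.Theory Num.Theory.
Import numFieldNormedType.Exports.
Local Open Scope classical_set_scope.
Local Open Scope ring_scope.

(** * Lebesgue measure on R^n *)

Section borel_rV.
Context {R : realType} {n : nat}.

(** Boxes are used because halving the sides of a box cuts it into translates of a single box. Every
    comparison of averages then amounts to moving a box parallel to the axes, that is, to the
    fundamental theorem of calculus on segments together with Tonelli's theorem. From one generation
    to the next the integral of the q-th power of the jumps gains the factor [2^-(q + n - n q / p)],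
    and for [p < n] this exponent is positive exactly when [q < n p / (n - p)]. Infinitely many
    shells accumulate at the origin, so all constants must be uniform in the size [l] of the shell;
    only the power of [l] may vary, and it makes the tail small uniformly in [u]. An element of the
    completion is not a function, so injectivity is a property of sequences: if test functions tend
    to 0 in the weighted L^r and their gradients are Cauchy in the weighted L^p, then these
    gradients tend to 0. As the weights may vanish or blow up at the origin, this is shown on
    annuli, with a bound that is the same for all of them, and then by exhaustion. *)

Definition box (c h : 'rV[R]_n) : set 'rV[R]_n :=
  [set x | forall i, c ord0 i <= x ord0 i < c ord0 i + h ord0 i].

Lemma measurable_box c h : measurable (box c h).
Proof.
have -> : box c h = \bigcap_(i in [set` enum 'I_n])
    ((fun x : 'rV[R]_n => x ord0 i : measurableTypeR R) @^-1`
     `[c ord0 i, (c ord0 i + h ord0 i)[).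
  apply/seteqP; split => [x xB i _|x xB i] /=.
    by rewrite in_itv/= xB.
  by have := xB i; rewrite /= mem_enum in_itv/=; apply.
apply: fin_bigcap_measurable => // i _.
rewrite -[X in measurable X]setTI.
by apply: measurable_coord => //; exact: measurable_itv.
Qed.

(** The boxes with rational corner and sides [1 / (k + 1)] that lie in [U] are countably many and
    cover it. This links the topology to a sigma-algebra that is generated by the coordinates. *)
Lemma open_measurable_rV (U : set 'rV[R]_n) : open U -> measurable U.
Proof.
move=> oU.
pose e (k : nat) : R := k.+1%:R^-1.
pose bx (q : 'rV[rat]_n * nat) : set 'rV[R]_n :=
  box (map_mx ratr q.1) (const_mx (e q.2)).
pose F q := if `[< bx q `<=` U >] then bx q else set0.
have -> : U = \bigcup_q F q.
  apply/seteqP; split => [x Ux|x [q _]]; last first.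
    by rewrite /F; case: asboolP => // + xq; exact.
  have /nbhs_ballP[d /= d0 dU] : nbhs x U by exact: open_nbhs_nbhs.
  have [k ke] : exists k, e k < d.
    exists (Num.truncn d^-1); rewrite /e invf_plt ?posrE//.
    exact: truncnS_gt.
  have e0 : 0 < e k by rewrite /e invr_gt0.
  have /choice[q qP] (i : 'I_n) :
      exists y : rat, ratr y \in `](x ord0 i - e k), (x ord0 i)[.
    by apply: rat_in_itvoo; rewrite ltrBlDr ltrDl.
  have xB y : bx (\row_i q i, k) y <->
      forall i, ratr (q i) <= y ord0 i < ratr (q i) + e k.
    by rewrite /bx /box/=; split => + i => /(_ i); rewrite !mxE.
  have xbx : bx (\row_i q i, k) x.
    by apply/xB => i; have := qP i; rewrite in_itv/=; lra.
  exists (\row_i q i, k) => //; rewrite /F; case: asboolP => // -[] y /xB yB.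
  apply: dU; split=> // i0 i; rewrite (ord1 i0) /ball/= ltr_norml.
  have := yB i; have /xB/(_ i) := xbx.
  lra.
apply: countable_bigcupT_measurable => [|q]; first exact: countableP.
by rewrite /F; case: ifP => _ //; exact: measurable_box.
Qed.

Lemma continuous_measurable_rV (f : 'rV[R]_n -> R) (D : set 'rV[R]_n) :
  measurable D -> continuous f -> measurable_fun D f.
Proof.
move=> mD cf; apply: (measurable_funS measurableT) => //.
apply: (measurability _ (RGenOpens.measurableE R)).
move=> _ [_ [a [b ->] <-]]; rewrite setTI.
by apply: open_measurable_rV; move/continuousP: cf; apply; exact: interval_open.
Qed.

End borel_rV.

(** * Volume of boxes, Tonelli's theorem and translation invariance *)

Section lebesgue_rV.
Context {R : realType}.
Local Notation mu := lebesgue_rV.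

Lemma rV_cons_ord0 n (p : 'rV[R]_n * measurableTypeR R) :
  rV_cons p ord0 ord0 = p.2.
Proof.
rewrite /rV_cons; have -> : ord0 = lshift n (@ord0 0) by apply/val_inj.
by rewrite (row_mxEl (p.2%:M : 'M[R]_1)) mxE eqxx mulr1n.
Qed.

Lemma rV_cons_lift n (p : 'rV[R]_n * measurableTypeR R) i :
  rV_cons p ord0 (lift ord0 i) = p.1 ord0 i.
Proof.
rewrite /rV_cons; have -> : lift ord0 i = rshift 1 i by apply/val_inj.
by rewrite (row_mxEr (p.2%:M : 'M[R]_1)).
Qed.

Lemma rV_consD n (x y : 'rV[R]_n) (s t : R) :
  rV_cons (x + y, s + t) = rV_cons (x, s) + rV_cons (y, t).
Proof.
apply/rowP => i; rewrite [RHS]mxE.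
by case: (unliftP ord0 i) => [j|] ->;
  rewrite ?rV_cons_lift ?rV_cons_ord0//= mxE.
Qed.

Lemma rV_consE n (x : 'rV[R]_n.+1) :
  x = rV_cons (\row_i x ord0 (lift ord0 i), x ord0 ord0).
Proof.
apply/rowP => i; case: (unliftP ord0 i) => [j|] ->;
  by rewrite ?rV_cons_lift ?rV_cons_ord0//= mxE.
Qed.

Lemma lebesgue_rV_box n (c h : 'rV[R]_n) : (forall i, 0 <= h ord0 i) ->
  mu n (box c h) = (\prod_i h ord0 i)%:E.
Proof.
elim: n c h => [|n IH] c h h0.
  rewrite big_ord0 /= diracE mem_set// => -[]//.
rewrite [LHS]/= /cons_measure/= /pushforward.
pose c' : 'rV[R]_n := \row_i c ord0 (lift ord0 i).
pose h' : 'rV[R]_n := \row_i h ord0 (lift ord0 i).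
have -> : @rV_cons R n @^-1` box c h = box c' h' `*`
    `[c ord0 ord0, (c ord0 ord0 + h ord0 ord0)[%classic.
  apply/seteqP; split => -[x t] /=.
    move=> xB; split => [i|].
      by have := xB (lift ord0 i); rewrite rV_cons_lift !mxE.
    by have := xB ord0; rewrite rV_cons_ord0 in_itv.
  move=> [xB tB] i; case: (unliftP ord0 i) => [j|] ->.
    by rewrite rV_cons_lift; have := xB j; rewrite !mxE.
  by rewrite rV_cons_ord0 /=; rewrite in_itv in tB.
rewrite product_measure1E//; last exact: measurable_box.
rewrite IH => [|i]; last by rewrite mxE.
rewrite big_ord_recl muleC EFinM; congr (_ * _)%E.
  rewrite -[LHS]/(lebesgue_measure _) lebesgue_measure_itv/= lte_fin ltrDl.
  case: ifPn => [_|]; first by rewrite -EFinD; congr (_%:E); ring.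
  by rewrite -leNgt => hle; congr (_%:E); apply/eqP; rewrite eq_le hle h0.
by congr (_%:E); apply: eq_bigr => i _; rewrite mxE.
Qed.

Lemma lebesgue_rV_sigma_finite n : sigma_finite [set: 'rV[R]_n] (mu n).
Proof.
exists (fun k : nat => box (const_mx (- k%:R)) (const_mx (2 * k%:R))).
  apply/esym; rewrite -subTset => x _.
  pose M := \sum_i `|x ord0 i|.
  exists (Num.truncn M).+1 => // i; rewrite !mxE.
  have : `|x ord0 i| < (Num.truncn M).+1%:R.
    apply: le_lt_trans (truncnS_gt M).
    by rewrite /M (bigD1 i)//= lerDl sumr_ge0.
  by rewrite ltr_norml; lra.
move=> k; split; first exact: measurable_box.
rewrite lebesgue_rV_box ?ltry// => i.
by rewrite mxE mulr_ge0.
Qed.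

(** Tonelli's theorem expects measures packed with their sigma-finiteness, whereas [lebesgue_rV] has
    the type of a plain measure; [m] is the same measure repacked. *)
Lemma lebesgue_rV_sf n :
  exists m : {sigma_finite_measure set 'rV[R]_n -> \bar R}, forall A, m A = mu n A.
Proof.
pose H := isSigmaFinite.Build _ _ _ (mu n) (@lebesgue_rV_sigma_finite n).
pose H' := isSFinite.Build _ _ _ (mu n)
  (sfinite_measure_sigma_finite (@lebesgue_rV_sigma_finite n)).
pose m := HB.pack_for {sigma_finite_measure set 'rV[R]_n -> \bar R}
  (Measure.sort (mu n)) H H'.
by exists m.
Qed.

Lemma cons_measure_integral n
    (m : {sigma_finite_measure set 'rV[R]_n -> \bar R})
    (f : 'rV[R]_n.+1 -> \bar R) :
  measurable_fun [set: 'rV[R]_n.+1] f -> (forall x, 0 <= f x)%E ->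
  (\int[cons_measure m]_x f x =
   \int[m]_x \int[lebesgue_measure]_t f (rV_cons (x, t)))%E.
Proof.
move=> mf f0.
rewrite [LHS](ge0_integral_pushforward (@measurable_rV_cons R n))//.
rewrite preimage_setT.
have mfc := measurableT_comp mf (@measurable_rV_cons R n).
by rewrite (fubini_tonelli1 _ mfc) => [|p]; last exact: f0.
Qed.

Lemma rV_cons_integral n (f : 'rV[R]_n.+1 -> \bar R) :
  measurable_fun [set: 'rV[R]_n.+1] f -> (forall x, 0 <= f x)%E ->
  (\int[mu n.+1]_x f x =
   \int[mu n]_x \int[lebesgue_measure]_t f (rV_cons (x, t)))%E.
Proof.
move=> mf f0.
have [m mE] := lebesgue_rV_sf n.
have mE1 A : measurable A -> cons_measure m A = mu n.+1 A.
  move=> mA; rewrite /= /cons_measure/= /pushforward /product_measure1.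
  by apply: eq_measure_integral => B _ _; exact: mE.
transitivity (\int[cons_measure m]_x f x)%E.
  by apply: eq_measure_integral => A mA _; exact/esym/mE1.
rewrite cons_measure_integral//.
by apply: eq_measure_integral => B _ _; exact: mE.
Qed.

Definition shiftR (v : R) (t : measurableTypeR R) : measurableTypeR R := t + v.

Lemma measurable_shiftR v : measurable_fun [set: _] (shiftR v).
Proof. exact: measurable_funD. Qed.

HB.instance Definition _ v :=
  isMeasurableFun.Build _ _ _ _ (shiftR v) (@measurable_shiftR v).

Lemma lebesgue_measure_shift (v : R) (A : set (measurableTypeR R)) :
  measurable A ->
  pushforward lebesgue_measure (shiftR v) A = lebesgue_measure A.
Proof.
move=> mA; apply/esym/lebesgue_measure_unique => // _ [[a b] _ <-].
rewrite /= /pushforward.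
have -> : shiftR v @^-1` `]a, b] = `](a - v), (b - v)]%classic.
  by apply/seteqP; split => t; rewrite /shiftR/= !in_itv/=; lra.
rewrite !lebesgue_measure_itv/= !lte_fin ltrD2r.
by case: ifP => // _; rewrite -!EFinD; congr (_%:E); ring.
Qed.

Lemma integral_shift1 (v : R) (f : R -> \bar R) :
  measurable_fun [set: measurableTypeR R] f -> (forall x, 0 <= f x)%E ->
  (\int[lebesgue_measure]_x f (x + v)%R = \int[lebesgue_measure]_x f x)%E.
Proof.
move=> mf f0.
have := @ge0_integral_pushforward _ _ _ _ _ _ (@measurable_shiftR v)
  lebesgue_measure setT f measurableT mf (fun y _ => f0 y).
rewrite preimage_setT => <-.
apply: eq_measure_integral => A mA _.
exact: lebesgue_measure_shift.
Qed.

Lemma measurable_shift n (v : 'rV[R]_n) :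
  measurable_fun [set: 'rV[R]_n] (fun x => x + v).
Proof.
apply: measurable_fun_rV => i; rewrite (_ : _ \o _ = fun x : 'rV[R]_n => x ord0 i + v ord0 i).
  by apply: measurable_funD => //; exact: measurable_coord.
by apply/funext => x /=; rewrite mxE.
Qed.

Lemma integral_shift n (v : 'rV[R]_n) (f : 'rV[R]_n -> \bar R) :
  measurable_fun [set: 'rV[R]_n] f -> (forall x, 0 <= f x)%E ->
  (\int[mu n]_x f (x + v)%R = \int[mu n]_x f x)%E.
Proof.
elim: n v f => [|n IH] v f mf f0.
  by apply: eq_integral => x _; congr f; apply/rowP => -[].
have mfv : measurable_fun [set: 'rV[R]_n.+1] (fun x => f (x + v)).
  by apply: (measurableT_comp mf); exact: measurable_shift.
have mfc : measurable_fun [set: 'rV[R]_n * measurableTypeR R]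
    (fun p => f (rV_cons p)).
  exact: (measurableT_comp mf (@measurable_rV_cons R n)).
etransitivity; first exact: rV_cons_integral.
apply: esym; etransitivity; first exact: rV_cons_integral.
apply: esym.
move: mfv; rewrite [v]rV_consE => mfv.
set v' := \row_i _; set t' := v ord0 ord0.
under eq_integral => x _.
  under eq_integral => t _ do rewrite -rV_consD.
  rewrite (@integral_shift1 t' (fun t => f (rV_cons (x + v', t))))//; last first.
    exact: (measurable_fun_pair2 (x + v') mfc).
  over.
rewrite (IH v' (fun x => \int[lebesgue_measure]_t f (rV_cons (x, t)))%E)//.
- exact: (@measurable_fun_fubini_tonelli_F _ _ _ _ _ lebesgue_measure
    (f \o @rV_cons R n) mfc (fun p => f0 (rV_cons p))).
- by move=> x; exact: integral_ge0.
Qed.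

End lebesgue_rV.

(** * L^r norms *)

Section pnorm.
Context d (T : measurableType d) (R : realType).
Variable mu : {measure set T -> \bar R}.
Implicit Types (D : set T) (f g : T -> R).

Definition pnorm D (r : R) f : \bar R :=
  ((\int[mu]_(x in D) (`|f x| `^ r)%:E) `^ r^-1)%E.

Lemma measurable_fun_abs_powR D r f :
  measurable_fun D f -> measurable_fun D (fun x => (`|f x| `^ r)%:E).
Proof.
move=> mf; apply/measurable_EFinP.
by apply: (measurableT_comp (measurable_powR r)); exact: measurableT_comp.
Qed.

Lemma pnorm_ge0 D r f : (0 <= pnorm D r f)%E.
Proof. exact: poweR_ge0. Qed.

Lemma integral_powR_ge0 D r f : (0 <= \int[mu]_(x in D) (`|f x| `^ r)%:E)%E.
Proof. by apply: integral_ge0 => x _; rewrite lee_fin powR_ge0. Qed.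

(** Through this identity the inequalities of Minkowski and Hölder, which are stated on the whole
    space, apply on [D]. *)
Lemma pnormE D r f : pnorm D r f = Lnorm mu r%:E (EFin \o (f \_ D)).
Proof.
have [->|r0] := eqVneq r 0.
  by rewrite unlock /Lnorm /pnorm invr0 !poweRe0.
rewrite unlock /Lnorm /pnorm; congr (poweR _ _).
rewrite integral_mkcond; apply: eq_integral => x _; rewrite /= !patchE.
by case: ifPn => xD //; rewrite normr0 powR0.
Qed.

Lemma pnormX D r f : r != 0 ->
  (pnorm D r f `^ r)%E = (\int[mu]_(x in D) (`|f x| `^ r)%:E)%E.
Proof.
by move=> r0; rewrite -poweRrM mulVf// poweRe1// integral_powR_ge0.
Qed.

Lemma pnorm_leP D r f e : 0 < r -> 0 <= e ->
  (pnorm D r f <= e%:E)%E <->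
  (\int[mu]_(x in D) (`|f x| `^ r)%:E <= (e `^ r)%:E)%E.
Proof.
move=> r0 e0; split => h.
  rewrite -pnormX ?gt_eqF// -poweR_EFin; apply: gt0_ler_poweR => //; first exact: ltW.
    by rewrite in_itv/= pnorm_ge0 leey.
  by rewrite in_itv/= lee_fin e0 leey.
have -> : e%:E = ((e `^ r)%:E `^ r^-1)%E.
  by rewrite poweR_EFin -powRrM mulfV ?gt_eqF// powRr1.
apply: gt0_ler_poweR => //; first by rewrite invr_ge0 ltW.
  by rewrite in_itv/= integral_powR_ge0 leey.
by rewrite in_itv/= lee_fin powR_ge0 leey.
Qed.

Lemma le_pnorm D r f g : measurable D -> 0 <= r ->
  measurable_fun D f -> measurable_fun D g ->
  (forall x, D x -> `|f x| <= `|g x|) -> (pnorm D r f <= pnorm D r g)%E.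
Proof.
move=> mD r0 mf mg fg; apply: gt0_ler_poweR; rewrite ?invr_ge0//.
- by rewrite in_itv/= integral_powR_ge0 leey.
- by rewrite in_itv/= integral_powR_ge0 leey.
apply: ge0_le_integral => //.
- exact: measurable_fun_abs_powR.
- exact: measurable_fun_abs_powR.
- by move=> x Dx; rewrite lee_fin ge0_ler_powR// ?nnegrE// fg.
Qed.

Lemma eq_pnorm D r f g : (forall x, D x -> `|f x| = `|g x|) ->
  pnorm D r f = pnorm D r g.
Proof.
move=> fg; rewrite /pnorm (eq_integral (fun x => (`|g x| `^ r)%:E))// => x /set_mem Dx.
by rewrite fg.
Qed.

Lemma subset_pnorm D E r f : measurable D -> measurable E -> 0 <= r ->
  D `<=` E -> measurable_fun E f -> (pnorm D r f <= pnorm E r f)%E.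
Proof.
move=> mD mE r0 DE mf; apply: gt0_ler_poweR; rewrite ?invr_ge0//.
- by rewrite in_itv/= integral_powR_ge0 leey.
- by rewrite in_itv/= integral_powR_ge0 leey.
apply: ge0_subset_integral => //; exact: measurable_fun_abs_powR.
Qed.

Lemma pnorm_triangle D r f g : measurable D -> 1 <= r ->
  measurable_fun D f -> measurable_fun D g ->
  (pnorm D r (f \+ g)%R <= pnorm D r f + pnorm D r g)%E.
Proof.
move=> mD r1 mf mg; rewrite !pnormE.
have -> : (f \+ g)%R \_ D = ((f \_ D) \+ (g \_ D))%R.
  by apply/funext => x /=; rewrite !patchE; case: ifPn => //; rewrite addr0.
by apply: minkowski_EFin => //; apply/(measurable_restrictT _ mD).
Qed.

Lemma pnorm_cst0 D r : 0 < r -> pnorm D r (fun=> 0) = 0%E.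
Proof.
move=> r0; rewrite /pnorm (eq_integral (cst 0%E)) ?integral0 ?poweR0r//.
  by rewrite invr_neq0// gt_eqF.
by move=> x _; rewrite normr0 powR0// gt_eqF.
Qed.

Lemma pnorm_sum D r (I : Type) (s : seq I) (F : I -> T -> R) :
  measurable D -> 1 <= r -> (forall i, measurable_fun D (F i)) ->
  (pnorm D r (fun x => \sum_(i <- s) F i x)%R <= \sum_(i <- s) pnorm D r (F i))%E.
Proof.
move=> mD r1 mF; elim: s => [|i s IH].
  rewrite big_nil (_ : (fun _ => _) = fun=> 0); last by apply/funext => x; rewrite big_nil.
  by rewrite pnorm_cst0//; exact: lt_le_trans r1.
rewrite big_cons; apply: le_trans (leeD2l _ IH).
rewrite (_ : (fun _ => _) = F i \+ (fun x => \sum_(i <- s) F i x)).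
  by apply: pnorm_triangle => //; exact: measurable_sum.
by apply/funext => x /=; rewrite big_cons.
Qed.

Lemma pnormZ D r f (c : R) : measurable D -> 0 < r -> measurable_fun D f ->
  pnorm D r (fun x => c * f x) = (`|c|%:E * pnorm D r f)%E.
Proof.
move=> mD r0 mf; rewrite /pnorm.
under eq_integral do rewrite normrM powRM// EFinM.
rewrite ge0_integralZl//; last exact: measurable_fun_abs_powR.
rewrite poweRM ?lee_fin ?powR_ge0 ?integral_powR_ge0//; congr (_ * _)%E.
by rewrite poweR_EFin -powRrM mulfV ?gt_eqF// powRr1.
Qed.

Lemma pnorm_cst D r (c m : R) : measurable D -> 0 < r -> mu D = m%:E ->
  pnorm D r (fun=> c) = (`|c| * m `^ r^-1)%:E.
Proof.
move=> mD r0 Dm; have m0 : 0 <= m by rewrite -lee_fin -Dm.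
rewrite /pnorm integral_cst// Dm -EFinM poweR_EFin powRM ?powR_ge0//.
by rewrite -powRrM mulfV ?gt_eqF// powRr1.
Qed.

(** Hölder's inequality for [|f|^r] and the constant 1, with conjugate exponents [q / r] and
    [(1 - r / q)^-1], followed by an r-th root. The case [r = q], where the second exponent
    degenerates, is separate. *)
Lemma pnorm_le_exponent D r q f (m : R) : measurable D -> measurable_fun D f ->
  mu D = m%:E -> 0 < r -> r <= q ->
  (pnorm D r f <= (m `^ (r^-1 - q^-1))%:E * pnorm D q f)%E.
Proof.
move=> mD mf Dm r0; rewrite le_eqVlt => /predU1P[<-|rq].
  by rewrite subrr powRr0 mul1e.
have q0 : 0 < q by exact: lt_trans rq.
have m0 : 0 <= m by rewrite -lee_fin -Dm.
pose u : T -> R := (fun x => `|f x| `^ r : R) \_ D.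
pose v : T -> R := (fun=> 1 : R) \_ D.
have mu_ : measurable_fun [set: T] u.
  by apply/(measurable_restrictT _ mD)/measurable_EFinP/measurable_fun_abs_powR.
have mv : measurable_fun [set: T] v by apply/(measurable_restrictT _ mD).
have s0 : 0 < q / r by rewrite divr_gt0.
have t0 : 0 < (1 - r / q)^-1.
  by rewrite invr_gt0 subr_gt0 ltr_pdivrMr// mul1r.
have := hoelder mu mu_ mv s0 t0.
rewrite invf_div invrK addrC subrK => /(_ erefl).
have -> : (u \* v)%R = (fun x => `|f x| `^ r : R) \_ D.
  apply/funext => x; rewrite /u /v/= !patchE.
  by case: ifPn => _; rewrite ?mulr1// mulr0.
rewrite -!pnormE => H.
have E1 : pnorm D 1 (fun x => `|f x| `^ r) =
    (\int[mu]_(x in D) (`|f x| `^ r)%:E)%E.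
  rewrite /pnorm invr1 poweRe1.
    by apply: eq_integral => x _; rewrite powRr1// ger0_norm ?powR_ge0.
  by apply: integral_ge0 => x _; rewrite lee_fin powR_ge0.
have E2 : pnorm D (q / r) (fun x => `|f x| `^ r) = (pnorm D q f `^ r)%E.
  rewrite /pnorm -poweRrM invf_div [(q^-1 * r)%R]mulrC; congr (poweR _ _).
  apply: eq_integral => x _; rewrite ger0_norm ?powR_ge0// -powRrM.
  by rewrite mulrCA mulfV ?mulr1// gt_eqF.
rewrite E1 E2 (pnorm_cst 1 mD t0 Dm) normr1 mul1r invrK in H.
have -> : (m `^ (r^-1 - q^-1))%:E = ((m `^ (1 - r / q))%:E `^ r^-1)%E.
  rewrite poweR_EFin -powRrM; congr (_ `^ _)%:E.
  by rewrite mulrBl mul1r mulrAC mulfV ?mul1r// gt_eqF.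
have -> : pnorm D q f = ((pnorm D q f `^ r) `^ r^-1)%E.
  by rewrite -poweRrM mulfV ?gt_eqF// poweRe1// pnorm_ge0.
rewrite -poweRM ?lee_fin ?powR_ge0 ?poweR_ge0// muleC.
apply: gt0_ler_poweR => //; first by rewrite invr_ge0 ltW.
  by rewrite in_itv/= integral_powR_ge0 leey.
by rewrite in_itv/= leey andbT mule_ge0// ?lee_fin ?powR_ge0// poweR_ge0.
Qed.

Lemma limn_einf_le (u : (\bar R)^nat) (c : \bar R) :
  (forall n, u n <= c)%E -> (limn_einf u <= c)%E.
Proof.
move=> uc; rewrite limn_einf_lim; apply: lime_le; first exact: is_cvg_einfs.
by apply: nearW => n; apply: le_trans (uc n); apply: ereal_inf_lbound; exists n => /=.
Qed.

(** By monotone convergence the sum of the absolute values is integrable, hence finite almost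
    everywhere, and an absolutely convergent series converges. *)
Lemma ae_cvg_series (f : nat -> T -> R) D (c : R) : measurable D ->
  (forall k, measurable_fun D (f k)) ->
  (\sum_(k <oo) \int[mu]_(x in D) `|f k x|%:E <= c%:E)%E ->
  \forall x \ae mu, D x -> cvgn (series (fun k => f k x)).
Proof.
move=> mD mf fc.
pose S x : \bar R := (\sum_(k <oo) `|f k x|%:E)%E.
have mfk k : measurable_fun D (fun x => `|f k x|%:E).
  by apply/measurable_EFinP; exact: measurableT_comp.
have iS : (\int[mu]_(x in D) S x <= c%:E)%E.
  by rewrite /S integral_nneseries// => k x _; rewrite lee_fin.
have S0 x : (0 <= S x)%E by apply: nneseries_ge0 => k _ _; rewrite lee_fin.
have : mu.-integrable D S.
  apply/integrableP; split; first exact: ge0_emeasurable_sum.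
  under eq_integral do rewrite gee0_abs//.
  exact: le_lt_trans iS (ltry _).
move=> /(integrable_ae mD); apply: filterS => x Sx Dx.
have {}Sx := Sx Dx.
apply: normed_cvg; apply: nondecreasing_is_cvgn.
  by apply: nondecreasing_series => k _ _ /=.
exists (fine (S x)) => _ [n _ <-]; rewrite -lee_fin fineK//.
rewrite /series/= -sumEFin.
apply: (@nneseries_lim_ge _ _ xpredT) => k _ _.
by rewrite lee_fin.
Qed.

End pnorm.

(** * Almost everywhere convergence, Fatou's lemma and completeness of L^r *)

Section complete.
Context d (T : measurableType d) (R : realType).
Variable mu : {measure set T -> \bar R}.

Lemma measurable_fun_limn_einf D (u : (T -> \bar R)^nat) :
  (forall n, measurable_fun D (u n)) ->
  measurable_fun D (fun x => limn_einf (u^~ x)).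
Proof.
move=> mu_.
rewrite (_ : (fun _ => _) = (fun x => - limn_esup (fun n => - u n x))%E).
  apply: measurableT_comp => //; apply: measurable_fun_limn_esup => n.
  exact: measurableT_comp.
apply/funext => x; rewrite -limn_einfN; congr limn_einf.
by apply/funext => n /=; rewrite oppeK.
Qed.

Lemma continuous_abs_powR (r : R) : 0 < r -> continuous (fun t : R => `|t| `^ r).
Proof.
move=> r0 t; have [->|t0] := eqVneq t 0.
  apply/cvgrPdist_lt => e e0 /=; rewrite normr0 powR0 ?gt_eqF//.
  near=> x; rewrite sub0r normrN ger0_norm ?powR_ge0//.
  rewrite -[ltRHS](@powRr1 _ e) ?ltW// -(@mulVf _ r) ?gt_eqF// powRrM.
  rewrite gt0_ltr_powR// ?nnegrE ?powR_ge0//.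
  near: x; apply/nbhs_ballP; exists (e `^ r^-1); first by rewrite /= powR_gt0.
  by move=> x; rewrite /ball/= sub0r normrN.
apply: (@cvg_trans _ (expR (r * ln `|x|) @[x --> t])).
  apply: near_eq_cvg; near=> x.
  rewrite /powR; case: eqP => // /normr0_eq0 x0.
  exfalso; move/eqP: x0; apply/negP; near: x.
  exact: (@cvgr_neq0 _ _ _ (nbhs t) _ idfun t).
rewrite /powR normr_eq0 (negbTE t0).
apply: (@continuous_cvg _ _ _ (nbhs t) _ (fun x => r * ln `|x|) expR); first exact: continuous_expR.
apply: cvgM; first exact: cvg_cst.
apply: (@continuous_cvg _ _ _ (nbhs t) _ (fun x : R => `|x|) (@ln R)).
  by apply: continuous_ln; rewrite normr_gt0.
exact: cvg_norm.
Unshelve. all: by end_near. Qed.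

Lemma geometric_nneseries (M t : R) : 0 <= M -> 0 <= t < 1 ->
  (\sum_(k <oo) (M * t ^+ k)%:E <= (M / (1 - t))%:E)%E.
Proof.
move=> M0 /andP[t0 t1]; apply: lime_le.
  by apply: is_cvg_nneseries => k _ _; rewrite lee_fin mulr_ge0// exprn_ge0.
apply: nearW => n /=; rewrite sumEFin lee_fin -mulr_sumr ler_wpM2l//.
have := subrX1 t n; rewrite big_mkord.
have : 0 <= t ^+ n by rewrite exprn_ge0.
rewrite -[(1 - t)^-1]div1r ler_pdivlMr ?subr_gt0//.
set S := \sum_(_ < _) _; nra.
Qed.

(** As [D] has finite measure, the L^1 norms are bounded by the L^r norms and thus have a finite
    sum. *)
Lemma pnorm_fast_cvg_ae D r (h : nat -> T -> R) (m M : R) :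
  measurable D -> 1 <= r -> mu D = m%:E -> 0 <= M ->
  (forall k, measurable_fun D (h k)) ->
  (forall k, pnorm mu D r (h k) <= (M * (2^-1) ^+ k)%:E)%E ->
  \forall x \ae mu, D x -> cvgn (series (fun k => h k x)).
Proof.
move=> mD r1 Dm M0 mh hM.
apply: (@ae_cvg_series _ _ _ mu h D (m `^ (1^-1 - r^-1) * M / (1 - 2^-1))) => //.
have m0 : 0 <= m by rewrite -lee_fin -Dm.
apply: le_trans (geometric_nneseries _ _); last 2 first.
- by rewrite mulr_ge0 ?powR_ge0.
- by apply/andP; split; lra.
apply: lee_nneseries => [k _ _|k].
  by apply: integral_ge0 => x _; rewrite lee_fin.
have := pnorm_le_exponent mD (mh k) Dm ltr01 r1.
rewrite {1}/pnorm invr1 poweRe1 ?integral_powR_ge0//.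
under eq_integral do rewrite powRr1//.
move=> H _; apply: (le_trans H).
by rewrite -mulrA EFinM lee_wpmul2l// lee_fin powR_ge0.
Qed.

(** Fatou's lemma for [|f j|^r], whose lower limit is [|g|^r] almost everywhere since [t -> |t|^r]
    is continuous. *)
Lemma pnorm_fatou D r (f : nat -> T -> R) (g : T -> R) (M : R) :
  measurable D -> 0 < r -> 0 <= M ->
  (forall k, measurable_fun D (f k)) -> measurable_fun D g ->
  (\forall x \ae mu, D x -> f j x @[j --> \oo] --> g x) ->
  (forall k, pnorm mu D r (f k) <= M%:E)%E -> (pnorm mu D r g <= M%:E)%E.
Proof.
move=> mD r0 M0 mf mg fg fM; apply/pnorm_leP => //.
pose u j x := (`|f j x| `^ r)%:E.
have mu_ j : measurable_fun D (u j) by exact: measurable_fun_abs_powR.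
apply: (@le_trans _ _ (\int[mu]_(x in D) limn_einf (u^~ x))%E).
  apply: ae_ge0_le_integral => //.
  - exact: measurable_fun_abs_powR.
  - move=> x Dx; rewrite limn_einf_lim; apply: lime_ge; first exact: is_cvg_einfs.
    apply: nearW => n; apply/ereal_infP => _ [j _ <-].
    by rewrite lee_fin powR_ge0.
  - exact: measurable_fun_limn_einf.
  apply: filterS fg => x + Dx => /(_ Dx) fx.
  have -> : limn_einf (u^~ x) = (`|g x| `^ r)%:E.
    apply: (cvg_limn_einf_sup _).1; apply: cvg_EFin; first exact: nearW.
    apply: (@cvg_comp _ _ _ _ (fun t => `|t| `^ r) _ (nbhs (g x))) => //.
    exact: continuous_abs_powR.
  by [].
apply: (le_trans (fatou mu mD mu_ _)) => [j x _|]; first by rewrite lee_fin powR_ge0.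
by apply: limn_einf_le => j; exact/(pnorm_leP _ _ _ r0 M0).
Qed.

Theorem pnorm_complete D r (f : nat -> T -> R) (m : R) :
  measurable D -> mu D = m%:E -> 1 <= r ->
  (forall k, measurable_fun D (f k)) ->
  (forall e, 0 < e -> exists N, forall k l, (N <= k)%N -> (N <= l)%N ->
     (pnorm mu D r (f k \- f l)%R <= e%:E)%E) ->
  exists2 g, measurable_fun D g &
    forall e, 0 < e -> exists N, forall k, (N <= k)%N ->
     (pnorm mu D r (f k \- g)%R <= e%:E)%E.
Proof.
move=> mD Dm r1 mf fC.
have r0 : 0 < r by exact: lt_le_trans r1.
have /choice[N NP] (j : nat) : exists N, forall k l, (N <= k)%N -> (N <= l)%N ->
     (pnorm mu D r (f k \- f l)%R <= (1 * (2^-1) ^+ j)%:E)%E.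
  by apply: fC; rewrite mul1r exprn_gt0.
(* The partial sum places both [s j] and [s j.+1] beyond [N j]; the summand [j] makes [s] tend to
   infinity even if all [N i] vanish. *)
pose s j := (\sum_(i < j.+1) N i + j)%N.
have sN j : (N j <= s j)%N by rewrite /s big_ord_recr /= -addnA addnC -addnA leq_addr.
have sS j : (N j <= s j.+1)%N.
  by rewrite (leq_trans (sN j))// /s [X in (_ <= X + _)%N]big_ord_recr /= leq_add// leq_addr.
pose h j := (f (s j.+1) \- f (s j))%R.
have mh k : measurable_fun D (h k) by exact: measurable_funB.
have hM k : (pnorm mu D r (h k) <= (1 * (2^-1) ^+ k)%:E)%E by exact: NP.
have hcvg := pnorm_fast_cvg_ae mD r1 Dm ler01 mh hM.
(* The upper limit is defined and measurable everywhere, and it is the limit wherever that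
   exists. *)
pose g x := fine (limn_esup (fun j => (f (s j) x)%:E)).
have mg : measurable_fun D g.
  apply: (measurableT_comp (fine_measurable measurableT)).
  by apply: measurable_fun_limn_esup => k; exact/measurable_EFinP.
have fg : \forall x \ae mu, D x -> f (s j) x @[j --> \oo] --> g x.
  apply: filterS hcvg => x + Dx => /(_ Dx) hx.
  have fx : cvgn (fun j => f (s j) x).
    have -> : (fun j => f (s j) x) =
        (fun j => f (s 0%N) x + series (fun k => h k x) j).
      apply/funext => j; rewrite /series/=; elim: j => [|j IH].
        by rewrite big_geq// addr0.
      rewrite big_nat_recr//= addrA -IH /h/=; ring.
    by apply: is_cvgD => //; exact: is_cvg_cst.
  have fex : (f (s j) x)%:E @[j --> \oo] --> (limn (fun j => f (s j) x))%:E.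
    by apply: cvg_EFin => //; exact: nearW.
  by rewrite /g (cvg_limn_einf_sup fex).
exists g => // e e0.
have [K KP] := fC _ e0; exists K => k Kk.
have JK j : (K <= s (j + K))%N by rewrite /s addnA leq_addl.
apply: (@pnorm_fatou D r (fun j => f k \- f (s (j + K)%N))%R) => //.
- exact: ltW.
- by move=> j; exact: measurable_funB.
- exact: measurable_funB.
- apply: filterS fg => x + Dx => /(_ Dx) fx.
  apply: cvgB; first exact: cvg_cst.
  by have := fx; rewrite -(cvg_shiftn K).
- by move=> j; exact: KP.
Qed.

End complete.

(** * Difference quotients *)

Section difference_quotient.
Context {R : realType} {n : nat}.
Local Notation mu := (@lebesgue_rV R n).
Local Notation leb := (@lebesgue_measure R).
Implicit Types (u : 'rV[R]_n -> R) (i : 'I_n) (x : 'rV[R]_n).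

Definition ei i : 'rV[R]_n := delta_mx ord0 i.

Lemma enorm_ge0 x : 0 <= enorm x.
Proof. exact: sqrtr_ge0. Qed.

Lemma coord_le_enorm x i : `|x ord0 i| <= enorm x.
Proof.
rewrite -sqrtr_sqr ler_wsqrtr// (bigD1 i)//= lerDl.
by apply: sumr_ge0 => j _; exact: sqr_ge0.
Qed.

Lemma partial_le_grad u i x : `|partial i u x| <= enorm (grad u x).
Proof. by have := coord_le_enorm (grad u x) i; rewrite mxE. Qed.

Lemma continuous_line x i : continuous (fun t : R => x + t *: ei i).
Proof.
move=> t; apply: cvgD; first exact: cvg_cst.
by apply: cvgZr_tmp; exact: cvg_id.
Qed.

(** [partial i u] and the derivative of [t -> u (x + t e_i)] are limits of the same quotients, so
    derivability and the value of the derivative pass from one to the other. *)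
Lemma line_quotient u i x t :
  (fun h : R => h^-1 *: (((fun s : R => u (x + s *: ei i)) \o shift t) (h *: (1:R)) - u (x + t *: ei i))) =
  (fun h : R => h^-1 *: ((u \o shift (x + t *: ei i)) (h *: ei i) - u (x + t *: ei i))).
Proof.
apply/funext => h /=; congr (_ *: (u _ - _)).
by rewrite scalerDl addrCA [h *: 1]mulr1.
Qed.

Lemma derive_line u i x t :
  (fun s : R => u (x + s *: ei i))^`()%classic t = partial i u (x + t *: ei i).
Proof. by rewrite derive1E /partial /derive line_quotient. Qed.

Lemma derivable_line u i x t :
  derivable u (x + t *: ei i) (ei i) ->
  derivable (fun s : R => u (x + s *: ei i)) t 1.
Proof. by rewrite /derivable line_quotient. Qed.

Section one_direction.
Variables (u : 'rV[R]_n -> R) (i : 'I_n).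
Hypotheses (cu : continuous u) (du : forall x, derivable u x (ei i))
  (cdu : continuous (partial i u)).

Let cline x : continuous (fun t : R => partial i u (x + t *: ei i)).
Proof.
move=> t; apply: (@continuous_comp _ _ _ (fun t : R => x + t *: ei i) (partial i u)).
  exact: continuous_line.
exact: cdu.
Qed.

Let uline x : continuous (fun t : R => u (x + t *: ei i)).
Proof.
move=> t; apply: (@continuous_comp _ _ _ (fun t : R => x + t *: ei i) u).
  exact: continuous_line.
exact: cu.
Qed.

Lemma FTC_line x v : 0 < v ->
  (\int[leb]_(t in `[0%R, v]) (partial i u (x + t *: ei i))%:E =
   (u (x + v *: ei i) - u x)%:E)%E.
Proof.
move=> v0.
rewrite (@continuous_FTC2 _ _ (fun t => u (x + t *: ei i)) _ _ v0).
- by rewrite scale0r addr0 EFinB.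
- apply: continuous_subspaceT; exact: cline.
- split.
  + by move=> t _; exact: derivable_line.
  + exact/cvg_at_right_filter/uline.
  + exact/cvg_at_left_filter/uline.
- by move=> t _; rewrite derive_line.
Qed.

(** The fundamental theorem of calculus bounds the increment by the L^1 norm of the derivative on
    the segment; Hölder's inequality on an interval of length [v] yields the factor [v^(p - 1)]. *)
Lemma increment_powR_le x v p : 0 < v -> 1 <= p ->
  ((`|u (x + v *: ei i) - u x| `^ p)%:E <=
   (v `^ (p - 1))%:E *
   \int[leb]_(t in `[0%R, v]) (`|partial i u (x + t *: ei i)| `^ p)%:E)%E.
Proof.
move=> v0 p1.
have p0 : 0 < p by exact: lt_le_trans p1.
have mI : measurable `[0%R, v] by exact: measurable_itv.
pose f (t : R) := partial i u (x + t *: ei i).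
have mf : measurable_fun (`[0%R, v]%classic : set (measurableTypeR R)) f.
  apply: (measurable_funS measurableT) => //.
  apply: continuous_measurable_fun; exact: cline.
have lI : leb `[0%R, v]%classic = v%:E.
  by rewrite lebesgue_measure_itv/= lte_fin v0 sube0.
have H1 : (`|u (x + v *: ei i) - u x|%:E <= pnorm leb `[0%R, v]%classic 1 f)%E.
  rewrite -abse_EFin -FTC_line//.
  apply: le_trans (le_abse_integral _ _ _) _ => //; first exact/measurable_EFinP.
  rewrite /pnorm invr1 poweRe1.
    apply: ge0_le_integral => //.
    - by do 2! apply: measurableT_comp => //; exact/measurable_EFinP.
    - exact: measurable_fun_abs_powR.
    - by move=> t _; rewrite powRr1.
  by apply: integral_ge0 => t _; rewrite lee_fin powR_ge0.
have H2 := @pnorm_le_exponent _ _ _ leb _ 1 p f v mI mf lI ltr01 p1.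
have H3 := le_trans H1 H2.
have : ((`|u (x + v *: ei i) - u x|%:E `^ p) <=
   ((v `^ (1^-1 - p^-1))%:E * pnorm leb `[0%R, v]%classic p f) `^ p)%E.
  apply: gt0_ler_poweR => //; first exact: ltW.
  by rewrite in_itv/= lee_fin normr_ge0 leey.
  by rewrite in_itv/= leey andbT mule_ge0// ?pnorm_ge0// lee_fin powR_ge0.
rewrite poweRM ?pnorm_ge0 ?lee_fin ?powR_ge0// !poweR_EFin.
rewrite pnormX ?gt_eqF// -powRrM mulrBl invr1 mul1r mulVf ?gt_eqF//.
Qed.

(** Integrate [increment_powR_le] over [A] and exchange the integrals. For fixed [t] the translate
    of [A] by [t *: ei i] lies in [B], so the inner integral is at most the one over [B]; the length
    of the interval of [t] turns [v^(p - 1)] into [v^p]. *)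
Lemma integral_increment_le (A B : set 'rV[R]_n) v p :
  measurable A -> measurable B -> 0 <= v -> 1 <= p ->
  (forall x t, A x -> 0 <= t <= v -> B (x + t *: ei i)) ->
  (\int[mu]_(x in A) (`|u (x + v *: ei i)%R - u x| `^ p)%:E <=
   (v `^ p)%:E * \int[mu]_(x in B) (`|partial i u x| `^ p)%:E)%E.
Proof.
move=> mA mB; rewrite le_eqVlt => /predU1P[<-|v0] p1 AB.
  rewrite (eq_integral (cst 0%E)) ?integral0.
    by rewrite mule_ge0 ?integral_powR_ge0// lee_fin powR_ge0.
  move=> x _; rewrite scale0r addr0 subrr normr0 powR0//.
  by rewrite gt_eqF// (lt_le_trans _ p1).
have p0 : 0 < p by exact: lt_le_trans p1.
have mpu : measurable_fun [set: 'rV[R]_n] (fun x => (`|partial i u x| `^ p)%:E).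
  by apply: measurable_fun_abs_powR; exact: continuous_measurable_rV.
pose P (z : 'rV[R]_n * measurableTypeR R) : 'rV[R]_n := z.1 + (z.2 : R) *: ei i.
have mP : measurable_fun [set: _] P.
  apply: measurable_fun_rV => k.
  rewrite (_ : _ \o _ = fun z : 'rV[R]_n * measurableTypeR R =>
    z.1 ord0 k + (z.2 : R) * ei i ord0 k); last first.
    by apply/funext => z; rewrite /P /= !mxE.
  apply: measurable_funD.
    exact: (measurableT_comp (@measurable_coord R n k) measurable_fst).
  by apply: measurable_funM => //; exact: measurable_snd.
pose I := `[0%R, v]%classic.
(* Both domains enter through indicators, so that Tonelli's theorem applies on the whole product. *)
pose G (z : 'rV[R]_n * measurableTypeR R) : \bar R :=
  ((\1_A z.1 * \1_I z.2)%:E * (`|partial i u (P z)| `^ p)%:E)%E.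
have mI : measurable (I : set (measurableTypeR R)) by exact: measurable_itv.
have mG : measurable_fun [set: _] G.
  apply: emeasurable_funM; last exact: (measurableT_comp mpu).
  apply/measurable_EFinP; apply: measurable_funM.
    by apply: measurableT_comp measurable_fst; exact: measurable_indic.
  by apply: measurableT_comp measurable_snd; exact: measurable_indic.
have G0 z : (0 <= G z)%E by rewrite mule_ge0 ?lee_fin ?powR_ge0 ?mulr_ge0.
have [m mE] := @lebesgue_rV_sf R n.
have muE D f : (\int[mu]_(x in D) f x = \int[m]_(x in D) f x)%E.
  by apply: eq_measure_integral => C _ _; exact/esym/mE.
have GE x : (\int[leb]_t G (x, t) =
    (\1_A x)%:E * \int[leb]_(t in I) (`|partial i u (x + t *: ei i)| `^ p)%:E)%E.
  rewrite [X in (_ * X)%E]integral_mkcond -ge0_integralZl//.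
  - apply: eq_integral => t _; rewrite /G /P/= EFinM patchE !indicE.
    by case: ifPn => tI; rewrite ?mule1 ?mule0 ?mul0e.
  - apply/(measurable_restrictT _ mI)/(measurable_funS measurableT) => //.
    by have := measurable_fun_pair2 x (measurableT_comp mpu mP).
  - by move=> t _; apply: erestrict_ge0 => s _; rewrite lee_fin powR_ge0.
apply: (@le_trans _ _ ((v `^ (p - 1))%:E * \int[m]_x \int[leb]_t G (x, t))%E).
  rewrite muE integral_mkcond -ge0_integralZl//; last 3 first.
  - exact: (measurable_fun_fubini_tonelli_F _ mG G0).
  - by move=> x _; exact: integral_ge0.
  - by rewrite lee_fin powR_ge0.
  apply: ge0_le_integral => //.
  - by move=> x _; apply: erestrict_ge0 => z _; rewrite lee_fin powR_ge0.
  - apply/(measurable_restrictT _ mA)/(measurable_funS measurableT) => //.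
    apply: measurable_fun_abs_powR; apply: measurable_funB.
      apply: (measurableT_comp _ (measurable_shift _)).
      exact: continuous_measurable_rV.
    exact: continuous_measurable_rV.
  - apply: emeasurable_funM => //; exact: (measurable_fun_fubini_tonelli_F _ mG G0).
  move=> x _; rewrite GE patchE indicE; case: ifPn => _.
    by rewrite mul1e; exact: increment_powR_le.
  by rewrite mul0e mule0.
rewrite (fubini_tonelli _ mG)//.
have -> : (v `^ p = v `^ (p - 1) * v)%R.
  by rewrite -[X in _ * X](powRr1 (ltW v0)) -powRD ?subrK// gt_eqF// implybT.
rewrite EFinM -muleA; apply: lee_wpmul2l; first by rewrite lee_fin powR_ge0.
have -> : (v%:E * \int[mu]_(x in B) (`|partial i u x| `^ p)%:E =
    \int[leb]_t ((\1_I t)%:E * \int[mu]_(x in B) (`|partial i u x| `^ p)%:E))%E.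
  rewrite ge0_integralZr//; last 2 first.
  - by apply/measurable_EFinP; exact: measurable_indic.
  - exact: integral_powR_ge0.
  rewrite integral_indic// setIT; congr (_ * _)%E; apply/esym.
  by rewrite /I -[LHS]/(leb _) lebesgue_measure_itv/= lte_fin v0 sube0.
apply: ge0_le_integral => //.
- by move=> t _; exact: integral_ge0.
- exact: (@measurable_fun_fubini_tonelli_G _ _ _ _ _ m _ mG G0).
- by apply: emeasurable_funM => //; apply/measurable_EFinP; exact: measurable_indic.
move=> t _.
rewrite indicE; case: (boolP (t \in I)) => tI; last first.
  rewrite mul0e (eq_integral (cst 0%E)) ?integral0// => x _.
  by rewrite /G/= [X in _ * X]indicE (negbTE tI) mulr0 mul0e.
rewrite mul1e [leRHS]integral_mkcond.
have mB' : measurable_fun [set: 'rV[R]_n]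
    ((fun x => (`|partial i u x| `^ p)%:E) \_ B).
  by apply/(measurable_restrictT _ mB)/(measurable_funS measurableT).
have B0 x : (0 <= ((fun x => (`|partial i u x| `^ p)%:E) \_ B) x)%E.
  by apply: erestrict_ge0 => z _; rewrite lee_fin powR_ge0.
rewrite -(integral_shift (t *: ei i) mB' B0) muE.
apply: ge0_le_integral; first exact: measurableT.
- by move=> x _; exact: G0.
- exact: (measurable_fun_pair1 t mG).
- exact: (measurableT_comp mB' (measurable_shift _)).
move=> x _; rewrite /G/= [X in X * _]indicE [X in _ * X]indicE tI mulr1.
case: (boolP (x \in A)) => xA; last by rewrite mul0e.
rewrite mul1e patchE mem_set//; apply: AB; first exact: set_mem.
by have := set_mem tI; rewrite /I/= in_itv.
Qed.

End one_direction.
End difference_quotient.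

(** * Averages over boxes *)

Section averages.
Context {R : realType} {n : nat}.
Local Notation mu := (@lebesgue_rV R n).
Implicit Types (u v : 'rV[R]_n -> R) (c h w : 'rV[R]_n).

Definition vol h : R := \prod_i h ord0 i.

Definition avg c h u : R := (vol h)^-1 * \int[mu]_(x in box c h) u x.

Definition pos_sides h := forall i, 0 < h ord0 i.

Lemma vol_gt0 h : pos_sides h -> 0 < vol h.
Proof. by move=> h0; apply: prodr_gt0 => i _. Qed.

Lemma mu_box c h : pos_sides h -> mu (box c h) = (vol h)%:E.
Proof. by move=> h0; apply: lebesgue_rV_box => i; exact: ltW. Qed.

Lemma Ck1P u : Ck 1 u -> [/\ continuous u,
  forall i x, derivable u x (ei i) & forall i, continuous (partial i u)].
Proof. by move=> [cu du]; split => // i; have [? []] := du i. Qed.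

Lemma integrable_box c h u : pos_sides h -> continuous u ->
  mu.-integrable (box c h) (EFin \o u).
Proof.
move=> h0 cu; apply: measurable_bounded_integrable.
- exact: measurable_box.
- by rewrite /= mu_box ?ltry.
- by apply: continuous_measurable_rV => //; exact: measurable_box.
pose K := [set x : 'rV[R]_n | forall i, `[c ord0 i, c ord0 i + h ord0 i]%classic (x ord0 i)].
have cK : compact K 
  by apply: (@rV_compact _ n (fun i => `[c ord0 i, c ord0 i + h ord0 i]%classic)) => i; exact: segment_compact.
have /compact_bounded : compact (u @` K).
  by apply: continuous_compact => //; exact: continuous_subspaceT.
move=> [M [Mr MP]]; exists M; split => // m Mm x xB.
apply: (MP m Mm); exists x => // i; have := xB i.
by rewrite /= in_itv/=; move=> /andP[-> /ltW].
Qed.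

Lemma continuous_translate w : continuous (fun x : 'rV[R]_n => x + w).
Proof.
move=> x; apply: (@continuousD _ _ _ idfun (cst w)); first by move=> A.
exact: cst_continuous.
Qed.

(** Translation invariance is available for non-negative functions; it is applied to the positive
    and the negative part. *)
Lemma Rintegral_box_shift c h w u : pos_sides h -> continuous u ->
  \int[mu]_(x in box (c + w) h) u x = \int[mu]_(x in box c h) u (x + w).
Proof.
move=> h0 cu; rewrite /Rintegral; congr fine.
rewrite integralE [RHS]integralE; congr (_ - _)%E.
- rewrite integral_mkcond [RHS]integral_mkcond.
  rewrite -(@integral_shift _ _ w); last 2 first.
  + apply/(measurable_restrictT _ (measurable_box _ _)).
    apply: measurable_funepos; apply/measurable_EFinP.
    by apply: continuous_measurable_rV => //; exact: measurable_box.
  + by apply: erestrict_ge0 => x _.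
  apply: eq_integral => x _; rewrite !patchE.
  have -> : (x + w \in box (c + w) h) = (x \in box c h).
    apply/idP/idP => /set_mem xB; apply/mem_set => i; have := xB i;
    by rewrite !mxE; lra.
  by rewrite !funeposE.
- rewrite integral_mkcond [RHS]integral_mkcond.
  rewrite -(@integral_shift _ _ w); last 2 first.
  + apply/(measurable_restrictT _ (measurable_box _ _)).
    apply: measurable_funeneg; apply/measurable_EFinP.
    by apply: continuous_measurable_rV => //; exact: measurable_box.
  + by apply: erestrict_ge0 => x _.
  apply: eq_integral => x _; rewrite !patchE.
  have -> : (x + w \in box (c + w) h) = (x \in box c h).
    apply/idP/idP => /set_mem xB; apply/mem_set => i; have := xB i;
    by rewrite !mxE; lra.
  by rewrite !funenegE.
Qed.

Lemma avg_shift c h w u : pos_sides h -> continuous u ->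
  avg (c + w) h u = avg c h (fun x => u (x + w)).
Proof. by move=> h0 cu; rewrite /avg Rintegral_box_shift. Qed.

Lemma avgB c h u v : pos_sides h -> continuous u -> continuous v ->
  avg c h (fun x => u x - v x) = avg c h u - avg c h v.
Proof.
move=> h0 cu cv; rewrite /avg RintegralB ?mulrBr//.
- exact: measurable_box.
- exact: integrable_box.
- exact: integrable_box.
Qed.

Lemma avg_cst c h (a : R) : pos_sides h -> avg c h (fun=> a) = a.
Proof.
move=> h0; rewrite /avg Rintegral_cst; last exact: measurable_box.
by rewrite mu_box//= mulrCA mulVf ?mulr1// gt_eqF// vol_gt0.
Qed.

Lemma abs_avg_le c h u r (M : R) : pos_sides h -> continuous u -> 1 <= r ->
  (pnorm mu (box c h) r u <= M%:E)%E ->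
  `|avg c h u| <= M * vol h `^ (- r^-1).
Proof.
move=> h0 cu r1 uM.
have V0 := vol_gt0 h0.
have mB := measurable_box c h.
have mu_ : measurable_fun (box c h) u by exact: continuous_measurable_rV.
have H := pnorm_le_exponent mB mu_ (mu_box c h0) ltr01 r1.
have H1 : (`|\int[mu]_(x in box c h) u x|%:E <= pnorm mu (box c h) 1 u)%E.
  rewrite EFin_normr_Rintegral//; last exact: integrable_box.
  apply: le_trans (le_abse_integral _ _ _) _ => //; first exact/measurable_EFinP.
  rewrite /pnorm invr1 poweRe1.
    apply: ge0_le_integral => //.
    - by do 2! apply: measurableT_comp => //; exact/measurable_EFinP.
    - exact: measurable_fun_abs_powR.
    - by move=> t _; rewrite powRr1.
  by apply: integral_ge0 => t _; rewrite lee_fin powR_ge0.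
have : (`|\int[mu]_(x in box c h) u x|%:E <= (vol h `^ (1^-1 - r^-1) * M)%:E)%E.
  apply: le_trans H1 _; apply: le_trans H _; rewrite EFinM.
  by apply: lee_wpmul2l => //; rewrite lee_fin powR_ge0.
rewrite lee_fin invr1 => {}H1.
rewrite /avg normrM ger0_norm ?invr_ge0 ?(ltW V0)//.
rewrite mulrC ler_pdivrMr//; apply: le_trans H1 _.
rewrite -mulrA [leRHS]mulrC ler_wpM2r//.
  by rewrite -lee_fin; apply: le_trans uM; exact: pnorm_ge0.
rewrite powRD; first by rewrite powRr1 ?(ltW V0)// mulrC.
by rewrite (gt_eqF V0) implybT.
Qed.

Lemma avg_dist_le c h u (a e : R) : pos_sides h -> continuous u ->
  (forall x, box c h x -> `|u x - a| <= e) -> `|avg c h u - a| <= e.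
Proof.
move=> h0 cu ue.
have V0 := vol_gt0 h0.
have ca : continuous (fun _ : 'rV[R]_n => a) by exact: cst_continuous.
have cua : continuous (fun x : 'rV[R]_n => u x - a) by move=> x; apply: continuousB; [exact: cu|exact: cst_continuous].
have mB := measurable_box c h.
rewrite -[X in _ - X](avg_cst c a h0) -avgB//.
rewrite /avg normrM ger0_norm ?invr_ge0 ?(ltW V0)// mulrC ler_pdivrMr//.
apply: le_trans (le_normr_Rintegral _ _) _ => //; first exact: integrable_box.
have -> : e * vol h = \int[mu]_(x in box c h) e.
  by rewrite Rintegral_cst//= mu_box.
apply: le_Rintegral => //.
- apply: integrable_box => // x.
  apply: (@continuous_comp _ _ _ (fun x => u x - a) Num.norm x); first exact: cua.
  exact: norm_continuous.
- by apply: integrable_box => // x; exact: cst_continuous.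
Qed.

(** * Averages over translated boxes *)

Section chain.
Variables (u : 'rV[R]_n -> R) (p G : R) (B : set 'rV[R]_n) (h : 'rV[R]_n).
Hypotheses (u1 : Ck 1 u) (p1 : 1 <= p) (mB : measurable B) (h0 : pos_sides h)
  (uG : (\int[mu]_(x in B) (enorm (grad u x) `^ p)%:E <= G%:E)%E).

(** Bound for the change of the average per unit of displacement: an L^p norm of the gradient, and
    the power of the volume that Hölder's inequality leaves after averaging. *)
Let N := G `^ p^-1 * vol h `^ (- p^-1).

Lemma continuous_enorm_grad : continuous (fun x => enorm (grad u x)).
Proof.
have [cu du cdu] := Ck1P u1.
have cs : continuous (fun y => \sum_i partial i u y ^+ 2).
  move=> y; apply: continuous_big => [|i _]; first exact: add_continuous.
  move=> z; apply: (@continuous_comp _ _ _ (partial i u) (fun t => t ^+ 2) z).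
    exact: cdu.
  exact: exprn_continuous.
rewrite (_ : (fun x => enorm (grad u x)) =
    Num.sqrt \o (fun y => \sum_i partial i u y ^+ 2)).
  by move=> x; apply: continuous_comp; [exact: cs|exact: sqrt_continuous].
by apply/funext => x; rewrite /enorm /=; congr Num.sqrt; apply: eq_bigr => i _; rewrite mxE.
Qed.

Let G0 : 0 <= G.
Proof.
rewrite -lee_fin; apply: le_trans uG; apply: integral_ge0 => x _.
by rewrite lee_fin powR_ge0.
Qed.

Lemma integral_partial_le i :
  (\int[mu]_(x in B) (`|partial i u x| `^ p)%:E <= G%:E)%E.
Proof.
have [cu du cdu] := Ck1P u1.
apply: le_trans uG; apply: ge0_le_integral => //.
- by apply: measurable_fun_abs_powR; exact: continuous_measurable_rV.
- apply/measurable_EFinP; apply: (measurableT_comp (measurable_powR p)).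
  by apply: continuous_measurable_rV => //; exact: continuous_enorm_grad.
- move=> x _; rewrite lee_fin ge0_ler_powR ?nnegrE ?enorm_ge0 ?partial_le_grad//.
  exact: le_trans p1.
Qed.

Lemma avg_step c i (v : R) : 0 <= v ->
  (forall t, 0 <= t <= v -> box (c + t *: ei i) h `<=` B) ->
  `|avg (c + v *: ei i) h u - avg c h u| <= v * N.
Proof.
move=> v0 cB.
have p0 : 0 < p by exact: lt_le_trans p1.
have [cu du cdu] := Ck1P u1.
have cs : continuous (fun x : 'rV[R]_n => u (x + v *: ei i)).
  move=> x; apply: (@continuous_comp _ _ _ (fun x : 'rV[R]_n => x + v *: ei i) u).
    exact: continuous_translate.
  exact: cu.
rewrite avg_shift// -avgB// /N mulrA.
apply: (abs_avg_le (r := p)) => //.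
  by move=> x; apply: continuousB; [exact: cs|exact: cu].
apply/pnorm_leP => //; first by rewrite mulr_ge0// powR_ge0.
rewrite powRM// ?powR_ge0// -powRrM mulVf ?gt_eqF// powRr1// EFinM.
apply: le_trans (@integral_increment_le _ _ u i cu (du i) (cdu i) (box c h) B v p _ mB v0 p1 _) _.
- exact: measurable_box.
- move=> x t xB tv; apply: (cB t tv) => k; rewrite !mxE.
  by have := xB k; lra.
by apply: lee_wpmul2l; [rewrite lee_fin powR_ge0|exact: integral_partial_le].
Qed.

(** The box travels from [c] to [c'] along one axis after the other. All corners met on the way have
    coordinates between those of [c] and [c'], so the hypothesis keeps the moving box in [B]. *)
Lemma avg_chain c c' :
  (forall a : 'rV[R]_n, (forall i, Num.min (c ord0 i) (c' ord0 i) <= a ord0 i <=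
    Num.max (c ord0 i) (c' ord0 i)) -> box a h `<=` B) ->
  `|avg c' h u - avg c h u| <= (\sum_i `|c' ord0 i - c ord0 i|) * N.
Proof.
move=> cB.
(* After [k] moves the first [k] coordinates are those of [c']. *)
pose a (k : nat) : 'rV[R]_n :=
  \row_i (if (i < k)%N then c' ord0 i else c ord0 i).
have a0 : a 0 = c by apply/rowP => i; rewrite mxE.
have an : a n = c' by apply/rowP => i; rewrite mxE ltn_ord.
have aB k (i : 'I_n) (s : R) : (i = k :> nat) ->
  Num.min (c ord0 i) (c' ord0 i) <= s <= Num.max (c ord0 i) (c' ord0 i) ->
  box (a k + (s - c ord0 i) *: ei i) h `<=` B.
  move=> ik sP; apply: cB => m; rewrite !mxE eqxx/=.
  have [->|mi] := eqVneq m i.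
    by rewrite ik ltnn mulr1 addrC subrK.
  rewrite mulr0 addr0; case: ifP => _.
    by rewrite ge_min le_max !lexx !orbT.
  by rewrite ge_min le_max !lexx.
have step (i : 'I_n) : `|avg (a i.+1) h u - avg (a i) h u| <= `|c' ord0 i - c ord0 i| * N.
  have aS : a i.+1 = a i + (c' ord0 i - c ord0 i) *: ei i.
    apply/rowP => m; rewrite !mxE eqxx/= ltnS.
    have [->|mi] := eqVneq m i; first by rewrite leqnn ltnn mulr1 addrC subrK.
    by rewrite mulr0 addr0 leq_eqVlt (negbTE (mi : val m != val i)).
  (* [avg_step] moves a box in the positive direction only; if the coordinate decreases, the move is
     read backwards, starting from [a i.+1]. *)
  have [cc|cc] := leP (c ord0 i) (c' ord0 i).
    rewrite aS [X in _ <= X * _]ger0_norm ?subr_ge0//; apply: avg_step => [|t tv].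
      by rewrite subr_ge0.
    rewrite -[t](addrK (c ord0 i)); apply: aB => //.
    by rewrite (min_idPl cc) (max_idPr cc); lra.
  have -> : a i = a i.+1 + (c ord0 i - c' ord0 i) *: ei i.
    rewrite aS -addrA -scalerDl.
    have -> : c' ord0 i - c ord0 i + (c ord0 i - c' ord0 i) = 0 :> R by ring.
    by rewrite scale0r addr0.
  rewrite distrC [X in _ <= X * _]ltr0_norm ?subr_lt0// opprB; apply: avg_step => [|t tv].
    by rewrite subr_ge0 ltW.
  rewrite aS -addrA -scalerDl.
  rewrite (_ : _ + t = (c' ord0 i + t) - c ord0 i); last by ring.
  apply: aB => //.
  by rewrite (min_idPr (ltW cc)) (max_idPl (ltW cc)); lra.
rewrite -{1}an -{1}a0 mulr_suml.
have -> : avg (a n) h u - avg (a 0) h u =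
    \sum_(i < n) (avg (a i.+1) h u - avg (a i) h u).
  by rewrite -(big_mkord xpredT (fun i => avg (a i.+1) h u - avg (a i) h u)) telescope_sumr.
apply: le_trans (ler_norm_sum _ _ _) _.
by apply: ler_sum => i _.
Qed.

End chain.

(** * Dyadic subdivision of a box *)

Section children.
Implicit Types (b : {ffun 'I_n -> bool}).

Definition half h : 'rV[R]_n := 2^-1 *: h.

Definition child c h b : 'rV[R]_n :=
  \row_i (c ord0 i + (b i)%:R * (half h) ord0 i).

Lemma pos_half h : pos_sides h -> pos_sides (half h).
Proof. by move=> h0 i; rewrite mxE mulr_gt0. Qed.

Lemma vol_half h : vol (half h) = 2^-1 ^+ n * vol h.
Proof.
rewrite /vol; under eq_bigr do rewrite mxE.
by rewrite big_split/= prodr_const card_ord.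
Qed.

(** Since the sides are half-open, [b] can be computed from [x]: it records in which half each
    coordinate lies. Covering and disjointness of the children both follow from this form. *)
Lemma box_childP c h b x : pos_sides h ->
  box (child c h b) (half h) x <->
  forall i, c ord0 i <= x ord0 i < c ord0 i + h ord0 i /\
    b i = (c ord0 i + 2^-1 * h ord0 i <= x ord0 i).
Proof.
move=> h0; split => xB i; have := xB i; have := h0 i; rewrite !mxE.
  move: (c ord0 i) (x ord0 i) (h ord0 i) => C X H H0.
  case: (b i) => /=; rewrite ?mul1r ?mul0r ?addr0 => /andP[H1 H2].
    by have -> : C + 2^-1 * H <= X by []; split => //; lra.
  have H3 : X < C + 2^-1 * H by [].
  by split; [lra|apply/esym/negbTE; rewrite -ltNge].
move: (c ord0 i) (x ord0 i) (h ord0 i) => C X H H0 [H1 ->].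
by case: (leP (C + 2^-1 * H) X) => H2 /=; rewrite ?mul1r ?mul0r ?addr0; lra.
Qed.

Lemma box_child_sub c h b : pos_sides h ->
  box (child c h b) (half h) `<=` box c h.
Proof. by move=> h0 x /(box_childP _ _ _ h0) xB i; have [] := xB i. Qed.

Lemma box_children c h : pos_sides h ->
  box c h = \big[setU/set0]_(b : {ffun 'I_n -> bool}) box (child c h b) (half h).
Proof.
move=> h0; rewrite -bigcup_seq; apply/seteqP; split => x.
  move=> xB; exists [ffun i => c ord0 i + 2^-1 * h ord0 i <= x ord0 i].
    by rewrite /= mem_index_enum.
  by apply/box_childP => // i; rewrite ffunE.
by move=> [b _ xb]; exact: (box_child_sub h0 xb).
Qed.

Lemma child_inj c h b b' x : pos_sides h ->
  box (child c h b) (half h) x -> box (child c h b') (half h) x -> b = b'.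
Proof.
move=> h0 /(box_childP _ _ _ h0) xb /(box_childP _ _ _ h0) xb'.
by apply/ffunP => i; rewrite (xb i).2 (xb' i).2.
Qed.

Lemma trivIset_children c h (D : set {ffun 'I_n -> bool}) : pos_sides h ->
  trivIset D (fun b => box (child c h b) (half h)).
Proof. by move=> h0 b b' _ _ [x [xb xb']]; exact: (child_inj h0 xb xb'). Qed.

Lemma integral_children c h (f : 'rV[R]_n -> \bar R) : pos_sides h ->
  measurable_fun (box c h) f -> (forall x, box c h x -> 0 <= f x)%E ->
  (\int[mu]_(x in box c h) f x =
   \sum_(b : {ffun 'I_n -> bool}) \int[mu]_(x in box (child c h b) (half h)) f x)%E.
Proof.
move=> h0; rewrite (box_children c h0) => mf f0.
rewrite ge0_integral_bigsetU//.
- by move=> b; exact: measurable_box.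
- exact: index_enum_uniq.
- exact: trivIset_children.
Qed.

Lemma avg_children c h u : pos_sides h -> continuous u ->
  avg c h u = 2^-1 ^+ n * \sum_(b : {ffun 'I_n -> bool}) avg (child c h b) (half h) u.
Proof.
move=> h0 cu; have hh0 := pos_half h0.
have V0 := vol_gt0 h0.
rewrite /avg -mulr_sumr vol_half invfM mulrA mulrA mulfV ?mul1r; last first.
  by rewrite expf_neq0// invr_neq0.
congr (_ * _); rewrite /Rintegral sum_fine; last first.
  move=> b _; apply: integrable_fin_num; first exact: measurable_box.
  exact: integrable_box.
congr fine; rewrite {1}(box_children c h0) integral_bigsetU_EFin//.
- by move=> b; exact: measurable_box.
- exact: index_enum_uniq.
- exact: trivIset_children.
- rewrite -(box_children c h0); apply/measurable_EFinP.
  by apply: continuous_measurable_rV => //; exact: measurable_box.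
Qed.

Lemma avg_mean_le c h u (a e : R) : pos_sides h -> continuous u ->
  (forall b, `|avg (child c h b) (half h) u - a| <= e) -> `|avg c h u - a| <= e.
Proof.
move=> h0 cu ae; rewrite avg_children//.
have N0 : (2^-1 : R) ^+ n * (2 ^ n)%:R = 1.
  by rewrite natrX -exprMn mulVf ?expr1n.
have card : #|{ffun 'I_n -> bool}| = (2 ^ n)%N by rewrite card_ffun card_bool card_ord.
have sum_cst (z : R) : (2^-1 : R) ^+ n * (\sum_(b : {ffun 'I_n -> bool}) z) = z.
  by rewrite sumr_const card -[z *+ _]mulr_natr mulrCA N0 mulr1.
rewrite -[X in _ - X](sum_cst a) -mulrBr -sumrB normrM ger0_norm ?exprn_ge0//.
rewrite -[leRHS](sum_cst e) ler_wpM2l ?exprn_ge0//.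
by apply: le_trans (ler_norm_sum _ _ _) _; exact: ler_sum.
Qed.

(** The average over the parent is the mean of those over its children, and any two children are
    translates of each other inside the parent, so [avg_chain] compares them. *)
Lemma avg_child_le c h u p G b : pos_sides h -> Ck 1 u -> 1 <= p ->
  (\int[mu]_(x in box c h) (enorm (grad u x) `^ p)%:E <= G%:E)%E ->
  `|avg (child c h b) (half h) u - avg c h u| <=
  (\sum_i (half h) ord0 i) * (G `^ p^-1 * vol (half h) `^ (- p^-1)).
Proof.
move=> h0 u1 p1 uG; have [cu _ _] := Ck1P u1.
have hh0 := pos_half h0.
rewrite distrC; apply: avg_mean_le => // b'.
apply: le_trans (avg_chain u1 p1 (measurable_box c h) hh0 uG (c := child c h b) _) _.
  move=> a ab x xa i; have := ab i; have := xa i; have := h0 i; rewrite !mxE.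
  rewrite ge_min le_max.
  by case: (b i); case: (b' i) => /=; rewrite ?mul1r ?mul0r ?addr0; lra.
apply: ler_wpM2r; first by rewrite mulr_ge0// powR_ge0.
apply: ler_sum => i _; rewrite !mxE; have := h0 i.
by case: (b i); case: (b' i) => /= hi; rewrite ?mul1r ?mul0r ?addr0 ler_norml; lra.
Qed.

End children.
End averages.

(** * Dyadic averages and their increments *)

Section dyadic.
Context {R : realType} {n : nat}.
Local Notation mu := (@lebesgue_rV R n).
Implicit Types (u : 'rV[R]_n -> R) (c h x : 'rV[R]_n) (k : nat).

(* The function equal, on each of the [2 ^ (n * k)] dyadic sub-boxes of
   generation [k], to the average of [u] over that sub-box. *)
Fixpoint dyad k c h u x : R :=
  if k is k'.+1 then
    \sum_(b : {ffun 'I_n -> bool})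
      \1_(box (child c h b) (half h)) x * dyad k' (child c h b) (half h) u x
  else avg c h u.

Lemma dyadS k c h u b x : pos_sides h -> box (child c h b) (half h) x ->
  dyad k.+1 c h u x = dyad k (child c h b) (half h) u x.
Proof.
move=> h0 xb /=; rewrite (bigD1 b)//= big1 => [|b' bb'].
  by rewrite indicE mem_set// mul1r addr0.
rewrite indicE memNset ?mul0r// => xb'.
by move/eqP: bb'; apply; exact: (child_inj h0 xb' xb).
Qed.

Lemma box_in_child c h x : pos_sides h -> box c h x ->
  exists b, box (child c h b) (half h) x.
Proof.
move=> h0; rewrite (box_children c h0) -bigcup_seq => -[b _ xb].
by exists b.
Qed.

Lemma measurable_dyad k c h u (D : set 'rV[R]_n) : measurable_fun D (dyad k c h u).
Proof.
elim: k c h => [|k IH] c h /=; first exact: measurable_cst.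
apply: measurable_sum => b; apply: measurable_funM; last exact: IH.
by apply: measurable_indic; exact: measurable_box.
Qed.

(** The sub-box of generation [k] that contains [x] has sides [2^-k h], so [u] is averaged over
    points at most that far from [x] in each coordinate. *)
Lemma dyad_dist_le k c h u x (e : R) : pos_sides h -> continuous u ->
  box c h x ->
  (forall y : 'rV[R]_n, (forall i, `|y ord0 i - x ord0 i| <= 2^-1 ^+ k * h ord0 i) ->
     `|u y - u x| <= e) ->
  `|dyad k c h u x - u x| <= e.
Proof.
move=> + cu; elim: k c h => [|k IH] c h h0 xB ue.
  apply: avg_dist_le => // y yB; apply: ue => i.
  by have := yB i; have := xB i; rewrite mul1r ler_norml; lra.
have [b xb] := box_in_child h0 xB.
rewrite (dyadS _ _ h0 xb); apply: IH => //; first exact: pos_half.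
by move=> y yx; apply: ue => i; rewrite exprSr -mulrA; have := yx i; rewrite mxE.
Qed.

Lemma dyad_cvg c h u x : pos_sides h -> continuous u -> box c h x ->
  dyad k c h u x @[k --> \oo] --> u x.
Proof.
move=> h0 cu xB; apply/cvgrPdist_le => e e0.
have /nbhs_ballP[d /= d0 dP] : \forall y \near x, `|u x - u y| <= e.
  by have /cvgrPdist_le := cu x; apply.
pose H := \sum_i h ord0 i.
have H0 : 0 <= H by apply: sumr_ge0 => i _; exact: ltW.
have hH i : h ord0 i <= H.
  by rewrite /H (bigD1 i)//= lerDl; apply: sumr_ge0 => j _; exact: ltW.
have /cvgrPdist_lt/(_ d d0) : 2^-1 ^+ k * H @[k --> \oo] --> (0 : R).
  rewrite -[X in _ --> X](mul0r H); apply: cvgM; last exact: cvg_cst.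
  by apply: cvg_expr; rewrite gtr0_norm ?invf_lt1// ltr1n.
apply: filterS => k; rewrite sub0r normrN ger0_norm ?mulr_ge0 ?exprn_ge0// => kd.
rewrite distrC; apply: dyad_dist_le => // y yx.
rewrite distrC; apply: dP; split => // i0 i; rewrite (ord1 i0) /ball/= distrC.
apply: le_lt_trans (yx i) _; apply: le_lt_trans kd.
by rewrite ler_wpM2l// exprn_ge0.
Qed.

(** Each [a i ^ s] is [a i * a i ^ (s - 1)], where the second factor is at most the same power of
    the sum. It is applied to the energies of the children with [s = q / p], whence the assumption
    [p <= q]. *)
Lemma sum_powR_le (I : finType) (a : I -> R) (s : R) : 1 <= s ->
  (forall i, 0 <= a i) -> \sum_i a i `^ s <= (\sum_i a i) `^ s.
Proof.
move=> s1 a0; have s0 : 0 < s by exact: lt_le_trans s1.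
have A0 : 0 <= \sum_i a i by exact: sumr_ge0.
rewrite -(mulr_powRB1 A0 s0) mulr_suml; apply: ler_sum => i _.
rewrite -(mulr_powRB1 (a0 i) s0) ler_wpM2l//.
apply: ge0_ler_powR; rewrite ?nnegrE ?subr_ge0//.
by rewrite (bigD1 i)//= lerDl sumr_ge0.
Qed.

Section increments.
Variables (p q : R).
Hypotheses (p1 : 1 <= p) (pq : p <= q).

Let p0 : 0 < p. Proof. exact: lt_le_trans p1. Qed.
Let q0 : 0 < q. Proof. exact: lt_le_trans pq. Qed.
Let qp1 : 1 <= q / p. Proof. by rewrite ler_pdivlMr// mul1r. Qed.

(** Halving the sides multiplies [dyad_cst] by [2^-dyad_delta]: the volume contributes [n], the sum
    of the sides [q], and the negative power of the volume [- n q / p]. *)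
Definition dyad_delta : R := q + n%:R - n%:R * (q / p).

(** The volume of the box times the q-th power of the bound in [avg_child_le], that is, the estimate
    for the first jump. *)
Definition dyad_cst h (G : R) : R := vol h *
  (\sum_i (half h) ord0 i) `^ q * G `^ (q / p) * vol (half h) `^ (- (q / p)).

Lemma dyad_cst_half h G : pos_sides h -> dyad_cst (half h) G =
  2^-1 ^+ n * 2^-1 `^ (q - n%:R * (q / p)) *
  (vol h * (\sum_i (half h) ord0 i) `^ q * vol (half h) `^ (- (q / p))) *
  G `^ (q / p).
Proof.
move=> h0; have V1 := vol_gt0 (pos_half h0).
have half0 : 0 <= (2^-1 : R) by [].
have S0 : 0 <= \sum_i (half h) ord0 i.
  by apply: sumr_ge0 => i _; exact/ltW/pos_half.
have -> : dyad_cst (half h) G = vol (half h) *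
    (2^-1 * \sum_i (half h) ord0 i) `^ q * G `^ (q / p) *
    (2^-1 ^+ n * vol (half h)) `^ (- (q / p)).
  rewrite /dyad_cst (vol_half (half h)); do 2!congr (_ * _); congr (_ * _ `^ _).
  by rewrite mulr_sumr; apply: eq_bigr => i _; rewrite mxE.
rewrite {1}vol_half !powRM ?exprn_ge0 ?(ltW V1)//.
rewrite -powR_mulrn// -powRrM powRD; last by rewrite invr_eq0 pnatr_eq0 implybT.
rewrite mulrN; ring.
Qed.

(** Induction on the generation: each child is treated with its own energy in place of [G]. These
    energies add up to at most [G], and so do their powers [q / p] by [sum_powR_le]; each generation
    thus costs only the factor [2^-dyad_delta], although the number of boxes grows. *)
Lemma dyad_increment_le k c h u G : pos_sides h -> Ck 1 u -> 0 <= G ->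
  (\int[mu]_(x in box c h) (enorm (grad u x) `^ p)%:E <= G%:E)%E ->
  (\int[mu]_(x in box c h) (`|dyad k.+1 c h u x - dyad k c h u x| `^ q)%:E <=
   (dyad_cst h G * (2^-1 `^ dyad_delta) ^+ k)%:E)%E.
Proof.
move=> + u1; elim: k c h G => [|k IH] c h G h0 G0 uG.
  have hh0 := pos_half h0.
  rewrite integral_children//; last first.
    apply: measurable_fun_abs_powR.
    by apply: measurable_funB; exact: measurable_dyad.
  pose M := (\sum_i (half h) ord0 i) * (G `^ p^-1 * vol (half h) `^ (- p^-1)).
  apply: (@le_trans _ _ (\sum_(b : {ffun 'I_n -> bool}) (vol (half h) * M `^ q)%:E)).
    apply: lee_sum => b _.
    rewrite (eq_integral (fun=> (`|avg (child c h b) (half h) u - avg c h u| `^ q)%:E)).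
      rewrite integral_cst; last exact: measurable_box.
      rewrite [X in (_ * X)%E]mu_box// -EFinM lee_fin mulrC ler_wpM2l//.
        exact/ltW/vol_gt0.
      apply: ge0_ler_powR; rewrite ?nnegrE ?(ltW q0)//.
        rewrite /M !mulr_ge0 ?powR_ge0//; apply: sumr_ge0 => i _; exact/ltW/hh0.
      exact: avg_child_le.
    by move=> x /set_mem xb; rewrite (dyadS _ _ h0 xb).
  rewrite sumEFin lee_fin sumr_const card_ffun card_bool card_ord.
  rewrite expr0 mulr1 -[leLHS]mulr_natl mulrA.
  have -> : (2 ^ n)%:R * vol (half h) = vol h.
    by rewrite vol_half natrX mulrA -exprMn mulfV// expr1n mul1r.
  rewrite /dyad_cst /M.
  rewrite !powRM ?powR_ge0//; last 2 first.
  - apply: sumr_ge0 => i _; exact/ltW/hh0.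
  - rewrite mulr_ge0 ?powR_ge0//; apply: sumr_ge0 => i _; exact/ltW/hh0.
  by rewrite -!powRrM mulNr ![p^-1 * q]mulrC !mulrA.
have hh0 := pos_half h0.
rewrite integral_children//; last first.
  apply: measurable_fun_abs_powR.
  by apply: measurable_funB; exact: measurable_dyad.
pose Gb b := \int[mu]_(x in box (child c h b) (half h)) (enorm (grad u x) `^ p).
have mg : measurable_fun [set: 'rV[R]_n] (fun x => (enorm (grad u x) `^ p)%:E).
  apply/measurable_EFinP; apply: (measurableT_comp (measurable_powR p)).
  by apply: continuous_measurable_rV => //; exact: continuous_enorm_grad.
have uGb : (\sum_b (\int[mu]_(x in box (child c h b) (half h))
    (enorm (grad u x) `^ p)%:E) <= G%:E)%E.
  have mgB := measurable_funS measurableT (@subsetT _ (box c h)) mg.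
  by rewrite -(integral_children h0 mgB)// => x _; rewrite lee_fin powR_ge0.
have ib0 b : (0 <= \int[mu]_(x in box (child c h b) (half h))
    (enorm (grad u x) `^ p)%:E)%E.
  by apply: integral_ge0 => x _; rewrite lee_fin powR_ge0.
have GbE b : ((Gb b)%:E = \int[mu]_(x in box (child c h b) (half h))
    (enorm (grad u x) `^ p)%:E)%E.
  rewrite /Gb /Rintegral fineK// ge0_fin_numE//.
  apply: le_lt_trans (ltry G); apply: le_trans uGb.
  by rewrite (bigD1 b)//= leeDl// sume_ge0.
have Gb0 b : 0 <= Gb b by rewrite -lee_fin GbE.
have sGb : \sum_b Gb b <= G.
  by rewrite -lee_fin -sumEFin; under eq_bigr do rewrite GbE.
apply: (@le_trans _ _ (\sum_(b : {ffun 'I_n -> bool})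
    (dyad_cst (half h) (Gb b) * (2^-1 `^ dyad_delta) ^+ k)%:E)).
  apply: lee_sum => b _.
  apply: le_trans (IH (child c h b) (half h) (Gb b) hh0 (Gb0 b) _); last by rewrite GbE.
  rewrite (eq_integral (fun x => (`|dyad k.+1 (child c h b) (half h) u x -
     dyad k (child c h b) (half h) u x| `^ q)%:E))//.
  by move=> x /set_mem xb; rewrite !(dyadS _ _ h0 xb).
rewrite sumEFin lee_fin -mulr_suml.
under eq_bigr do rewrite dyad_cst_half//.
rewrite -mulr_sumr exprSr [leRHS]mulrA [leRHS]mulrAC ler_wpM2r ?exprn_ge0 ?powR_ge0//.
have -> : dyad_cst h G * 2^-1 `^ dyad_delta =
    2^-1 ^+ n * 2^-1 `^ (q - n%:R * (q / p)) *
  (vol h * (\sum_i (half h) ord0 i) `^ q * vol (half h) `^ (- (q / p))) *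
  G `^ (q / p).
  rewrite /dyad_delta addrAC [X in 2^-1 `^ X]addrC (@powRD _ _ n%:R).
    by rewrite powR_mulrn// /dyad_cst; ring.
  by rewrite invr_eq0 pnatr_eq0 implybT.
apply: ler_wpM2l.
  rewrite !mulr_ge0 ?exprn_ge0 ?powR_ge0//; exact/ltW/vol_gt0.
apply: le_trans (sum_powR_le qp1 Gb0) _.
apply: ge0_ler_powR => //; rewrite ?nnegrE//; first exact: le_trans qp1.
exact: sumr_ge0.
Qed.

(** The jumps beyond generation [k] telescope and are summed as a geometric series; Fatou's lemma
    passes to the pointwise limit [u]. *)
Lemma pnorm_dyad_le k c h u G : pos_sides h -> Ck 1 u -> 0 <= G ->
  0 < dyad_delta ->
  (\int[mu]_(x in box c h) (enorm (grad u x) `^ p)%:E <= G%:E)%E ->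
  (pnorm mu (box c h) q (u \- dyad k c h u)%R <=
   (dyad_cst h G `^ q^-1 * (2^-1 `^ (dyad_delta / q)) ^+ k /
    (1 - 2^-1 `^ (dyad_delta / q)))%:E)%E.
Proof.
move=> h0 u1 G0 d0 uG.
have q1 : 1 <= q by exact: le_trans pq.
have [cu _ _] := Ck1P u1.
set A := dyad_cst h G `^ q^-1.
set th := 2^-1 `^ (dyad_delta / q).
have V0 := vol_gt0 h0.
have A0 : 0 <= A by exact: powR_ge0.
have th0 : 0 <= th by exact: powR_ge0.
have th1 : th < 1.
  have <- : 1 `^ (dyad_delta / q) = 1 :> R by rewrite powR1.
  by rewrite /th gt0_ltr_powR ?nnegrE ?divr_gt0// invf_lt1// ltr1n.
have C0 : 0 <= dyad_cst h G.
  by rewrite /dyad_cst !mulr_ge0 ?powR_ge0// ltW.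
have step j : (pnorm mu (box c h) q (dyad j.+1 c h u \- dyad j c h u)%R <=
    (A * th ^+ j)%:E)%E.
  apply/pnorm_leP => //; first by rewrite mulr_ge0// exprn_ge0.
  rewrite powRM ?exprn_ge0// /A -powRrM mulVf ?gt_eqF// powRr1//.
  have -> : (th ^+ j) `^ q = (2^-1 `^ dyad_delta) ^+ j.
    rewrite -(powR_mulrn j th0) -(powR_mulrn j (powR_ge0 2^-1 dyad_delta)).
    rewrite /th -!powRrM; congr (powR _ _).
    by rewrite mulrCA divfK ?gt_eqF// mulrC.
  exact: dyad_increment_le.
have mB := measurable_box c h.
apply: (@pnorm_fatou _ _ _ mu _ q (fun J => dyad (k + J) c h u \- dyad k c h u)%R) => //.
- by rewrite !mulr_ge0 ?exprn_ge0// invr_ge0 subr_ge0 ltW.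
- by move=> J; apply: measurable_funB; exact: measurable_dyad.
- apply: measurable_funB; last exact: measurable_dyad.
  exact: continuous_measurable_rV.
- apply: aeW => x xB; apply: cvgB; last exact: cvg_cst.
  have := dyad_cvg h0 cu xB; rewrite -(cvg_shiftn k).
  by under eq_fun do rewrite addnC.
move=> J.
have -> : (dyad (k + J) c h u \- dyad k c h u)%R =
    (fun x => \sum_(j < J) (dyad (k + j.+1) c h u x - dyad (k + j) c h u x)).
  apply/funext => x; rewrite -(big_mkord xpredT (fun j =>
    dyad (k + j.+1) c h u x - dyad (k + j) c h u x)).
  by rewrite (telescope_sumr (fun j => dyad (k + j) c h u x))// addn0.
apply: le_trans.
  apply: (pnorm_sum mu _ (F := fun (j : 'I_J) x =>
    dyad (k + j.+1) c h u x - dyad (k + j) c h u x)) => //.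
  by move=> j; apply: measurable_funB; exact: measurable_dyad.
apply: (@le_trans _ _ (\sum_(j < J) (A * th ^+ (k + j))%:E)%E).
  by apply: lee_sum => j _; rewrite addnS; exact: step.
rewrite sumEFin lee_fin -mulr_sumr -mulrA ler_wpM2l//.
under eq_bigr do rewrite exprD.
rewrite -mulr_sumr ler_wpM2l ?exprn_ge0//.
rewrite -div1r ler_pdivlMr ?subr_gt0// mulrC.
have := subrX1 th J; have : 0 <= th ^+ J by rewrite exprn_ge0.
set S := \sum_(_ < _) _; nra.
Qed.

End increments.
End dyadic.

(** * The Sobolev inequality on shells *)

Section sobolev_box.
Context {R : realType} {n : nat}.
Local Notation mu := (@lebesgue_rV R n).
Implicit Types (u : 'rV[R]_n -> R) (c h x : 'rV[R]_n) (k : nat).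

Definition side_sum h : R := \sum_i h ord0 i.

Lemma side_sum_half h : side_sum (half h) = 2^-1 * side_sum h.
Proof. by rewrite /side_sum mulr_sumr; apply: eq_bigr => i _; rewrite mxE. Qed.

Lemma side_sum_ge0 h : pos_sides h -> 0 <= side_sum h.
Proof. by move=> h0; apply: sumr_ge0 => i _; exact/ltW/h0. Qed.

(** [C] and [th] are chosen before the box and the function: the box enters only through its volume
    and its sides, which makes the estimate scale exactly on the shells. *)
Lemma sobolev_box (p r : R) : 1 <= p -> 1 <= r -> p < n%:R ->
  r < n%:R * p / (n%:R - p) ->
  exists C th, [/\ 0 <= C, 0 <= th, th < 1 &
    forall u c h k G, pos_sides h -> Ck 1 u -> 0 <= G ->
    (\int[mu]_(x in box c h) (enorm (grad u x) `^ p)%:E <= G%:E)%E ->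
    (pnorm mu (box c h) r (u \- dyad k c h u)%R <=
      (C * th ^+ k * (vol h `^ r^-1 * side_sum h * G `^ p^-1 * vol h `^ (- p^-1)))%:E)%E].
Proof.
move=> p1 r1 pn rlt.
have p0 : 0 < p by exact: lt_le_trans p1.
have r0 : 0 < r by exact: lt_le_trans r1.
(* The dyadic estimate requires an exponent at least [p]. If [r < p] it is used with [q = p], where
   [dyad_delta] is [p], and Hölder's inequality on the box lowers the exponent to [r]. *)
pose q := Num.max r p.
have rq : r <= q by rewrite le_max lexx.
have pq : p <= q by rewrite le_max lexx orbT.
have q0 : 0 < q by exact: lt_le_trans pq.
have d0 : 0 < dyad_delta (n := n) p q.
  rewrite /dyad_delta /q; have [rp|pr] := leP r p.
    by rewrite divff ?gt_eqF// mulr1 addrK.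
  move: rlt; rewrite ltr_pdivlMr ?subr_gt0// => rlt.
  by rewrite mulrA ltr_pdivrMr//; nra.
pose th := 2^-1 `^ (dyad_delta (n := n) p q / q) : R.
have th0 : 0 <= th by exact: powR_ge0.
have th1 : th < 1.
  have <- : 1 `^ (dyad_delta (n := n) p q / q) = 1 :> R by rewrite powR1.
  by rewrite /th gt0_ltr_powR ?nnegrE ?divr_gt0// invf_lt1// ltr1n.
exists ((2^-1 * (2^-1 ^+ n) `^ (- p^-1)) / (1 - th)), th; split => //.
  by rewrite !mulr_ge0 ?powR_ge0// invr_ge0 subr_ge0 ltW.
move=> u c h k G h0 u1 G0 uG.
have V0 := vol_gt0 h0.
have [cu _ _] := Ck1P u1.
have mB := measurable_box c h.
have mf : measurable_fun (box c h) (u \- dyad k c h u).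
  apply: measurable_funB; last exact: measurable_dyad.
  exact: continuous_measurable_rV.
apply: le_trans (pnorm_le_exponent mB mf (mu_box c h0) r0 rq) _.
apply: (@le_trans _ _ ((vol h `^ (r^-1 - q^-1))%:E *
   (dyad_cst p q h G `^ q^-1 * th ^+ k / (1 - th))%:E)%E).
  apply: lee_wpmul2l; first by rewrite lee_fin powR_ge0.
  exact: pnorm_dyad_le.
rewrite -EFinM lee_fin.
have S0 : 0 <= side_sum (half h) by exact/side_sum_ge0/pos_half.
have -> : dyad_cst p q h G `^ q^-1 = vol h `^ q^-1 *
   (2^-1 * side_sum h) * G `^ p^-1 * ((2^-1 ^+ n) `^ (- p^-1) * vol h `^ (- p^-1)).
  rewrite /dyad_cst !powRM ?mulr_ge0 ?powR_ge0 ?(ltW V0)//.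
  rewrite -/(side_sum (half h)) -!powRrM mulfV ?gt_eqF// powRr1//.
  have E1 : q / p / q = p^-1 by rewrite mulrAC mulfV ?mul1r// gt_eqF.
  rewrite mulNr E1 side_sum_half vol_half [X in _ * X = _]powRM ?exprn_ge0//.
  exact: ltW.
have -> : vol h `^ r^-1 = vol h `^ (r^-1 - q^-1) * vol h `^ q^-1.
  by rewrite -powRD ?subrK// (gt_eqF V0) implybT.
rewrite le_eqVlt; apply/orP; left; apply/eqP; ring.
Qed.

End sobolev_box.

(** * Geometry of the shells *)

Section shells.
Context {R : realType} {n : nat}.
Local Notation mu := (@lebesgue_rV R n).
Implicit Types (u : 'rV[R]_n -> R) (x : 'rV[R]_n) (i : 'I_n) (s : bool) (l : R).

(* On the box [shell i s l], [x_i] lies in [[l, 3 l[] if [s] and in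
   [[- 3 l, - l[] otherwise, the other coordinates in [[- 3 l, 3 l[]; the [2 n]
   boxes of size [l] cover the points of sup norm in [[l, 3 l[]. *)
Definition shell_c i s : 'rV[R]_n :=
  \row_j (if j == i then (if s then 1 else - 3) else - 3).

Definition shell_h i : 'rV[R]_n := \row_j (if j == i then 2 else 6).

Definition shell i s l : set 'rV[R]_n := box (l *: shell_c i s) (l *: shell_h i).

(** The outer radius leaves room for the shell of size [2 l], where coordinates reach [6 l] in
    modulus; the factor [n] bounds the Euclidean norm by the largest coordinate. *)
Definition annulus l : set 'rV[R]_n :=
  [set x | l <= enorm x <= 6 * n%:R * l].

Lemma enorm_le_sum x : enorm x <= \sum_j `|x ord0 j|.
Proof.
have S0 : 0 <= \sum_j `|x ord0 j| by exact: sumr_ge0.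
rewrite -(ger0_norm S0) -sqrtr_sqr ler_wsqrtr// expr2 mulr_suml.
apply: ler_sum => j _; rewrite -normr_id -real_normK ?num_real// normr_id expr2.
by rewrite ler_wpM2l// (bigD1 j)//= lerDl sumr_ge0.
Qed.

Lemma continuous_coord i : continuous (fun x : 'rV[R]_n => x ord0 i).
Proof. exact: coord_continuous. Qed.

Lemma continuous_enorm : continuous (fun x : 'rV[R]_n => enorm x).
Proof.
have cs : continuous (fun y : 'rV[R]_n => \sum_i y ord0 i ^+ 2).
  move=> y; apply: continuous_big => [|i _]; first exact: add_continuous.
  move=> z; apply: (@continuous_comp _ _ _ (fun x : 'rV[R]_n => x ord0 i) (fun t => t ^+ 2) z).
    exact: continuous_coord.
  exact: exprn_continuous.
move=> x; apply: (@continuous_comp _ _ _ (fun y : 'rV[R]_n => \sum_i y ord0 i ^+ 2) Num.sqrt x).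
  exact: cs.
exact: sqrt_continuous.
Qed.

Lemma measurable_annulus l : measurable (annulus l).
Proof.
have -> : annulus l = (fun x : 'rV[R]_n => enorm x) @^-1` `[l, (6 * n%:R * l)].
  by apply/seteqP; split => x /=; rewrite in_itv.
rewrite -[X in measurable X]setTI.
by apply: continuous_measurable_rV => //; exact: continuous_enorm.
Qed.

Lemma pos_shell i l : 0 < l -> pos_sides (l *: shell_h i).
Proof. by move=> l0 j; rewrite !mxE mulr_gt0//; case: ifP. Qed.

Lemma half_shell i l : half ((2 * l) *: shell_h i) = l *: shell_h i.
Proof. by rewrite /half scalerA mulrA mulVf// mul1r. Qed.

Lemma vol_shell i l : 0 <= l -> vol (l *: shell_h i) = l `^ n%:R * vol (shell_h i).
Proof.
move=> l0; rewrite powR_mulrn// /vol; under eq_bigr do rewrite mxE.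
by rewrite big_split/= prodr_const card_ord.
Qed.

Lemma vol_shell_h i : vol (shell_h i) = 2 * 6 ^+ n.-1.
Proof.
rewrite /vol (bigD1 i)//= mxE eqxx; congr (_ * _).
rewrite (eq_bigr (fun=> 6)) => [|m mi]; last by rewrite mxE (negbTE mi).
by rewrite prodr_const cardC1 card_ord.
Qed.

Lemma side_sum_shell i l : 0 <= l -> side_sum (l *: shell_h i) <= 6 * n%:R * l.
Proof.
move=> l0; apply: (@le_trans _ _ (\sum_(j < n) (6 * l))).
  by apply: ler_sum => j _; rewrite !mxE; case: ifP => _; lra.
by rewrite sumr_const card_ord -[leLHS]mulr_natr mulrAC.
Qed.

Lemma annulusP x i l : 0 < l -> l <= `|x ord0 i| ->
  (forall j, `|x ord0 j| <= 6 * l) -> annulus l x.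
Proof.
move=> l0 xi xj; apply/andP; split.
  exact: le_trans (coord_le_enorm x i).
apply: le_trans (enorm_le_sum x) _.
apply: (@le_trans _ _ (\sum_(j < n) (6 * l))); first by apply: ler_sum.
by rewrite sumr_const card_ord -[leLHS]mulr_natr mulrAC.
Qed.

Lemma shell_sub i s l : 0 < l -> shell i s l `<=` annulus l.
Proof.
move=> l0 x xW; apply: (@annulusP _ i) => //.
  have := xW i; rewrite !mxE eqxx; case: s {xW} => xi.
    by rewrite ger0_norm; lra.
  by rewrite ltr0_norm; lra.
move=> j; have := xW j; rewrite !mxE; case: eqP => _; case: (s) => xj;
  by rewrite ler_norml; lra.
Qed.

Lemma shell_abs i s l x : 0 < l -> shell i s l x -> l <= `|x ord0 i|.
Proof.
move=> l0 xW; have := xW i; rewrite !mxE eqxx; case: s {xW} => xi.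
  by rewrite ger0_norm; lra.
by rewrite ltr0_norm; lra.
Qed.

Lemma shell_cover l x i : 0 < l -> l < `|x ord0 i| <= 2 * l ->
  (forall j, `|x ord0 j| <= `|x ord0 i|) -> shell i (0 < x ord0 i) l x.
Proof.
move=> l0 xi xj j; rewrite !mxE; case: eqP => [->|_].
  have [x0|x0] := ltP 0 (x ord0 i).
    by move: xi; rewrite (gtr0_norm x0); lra.
  by move: xi; rewrite (ler0_norm x0); lra.
have : `|x ord0 j| <= 2 * l by have := xj j; lra.
by rewrite ler_norml; lra.
Qed.

(** The children of the box of size [2 l] are translates of the box of size [l]. While the box moves
    from one to the other, the i-th coordinate keeps its sign and a modulus at least [l], so the
    origin is avoided. *)
Lemma avg_shell_step u p G i s l : 1 <= p -> Ck 1 u -> 0 < l ->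
  (\int[mu]_(x in annulus l) (enorm (grad u x) `^ p)%:E <= G%:E)%E ->
  `|avg ((2 * l) *: shell_c i s) ((2 * l) *: shell_h i) u -
    avg (l *: shell_c i s) (l *: shell_h i) u| <=
  3 * n%:R * l * (G `^ p^-1 * vol (l *: shell_h i) `^ (- p^-1)).
Proof.
move=> p1 u1 l0 uG; have [cu _ _] := Ck1P u1.
have h2 : pos_sides ((2 * l) *: shell_h i) by apply: pos_shell; rewrite mulr_gt0.
apply: avg_mean_le => // b; rewrite half_shell.
apply: le_trans (avg_chain u1 p1 (measurable_annulus l) (pos_shell i l0) uG
  (c := l *: shell_c i s) _) _.
  move=> a ab x xa; apply: (@annulusP _ i) => //.
    have := ab i; have := xa i; rewrite !mxE eqxx ge_min le_max.
    case: s {ab xa}; case: (b i) => /=; rewrite ?mul1r ?mul0r ?addr0 => xi ai.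
    - by rewrite ger0_norm; lra.
    - by rewrite ger0_norm; lra.
    - by rewrite ltr0_norm; lra.
    - by rewrite ltr0_norm; lra.
  move=> j; have := ab j; have := xa j; rewrite !mxE ge_min le_max.
  case: eqP => _; case: (s); case: (b j) => /=; rewrite ?mul1r ?mul0r ?addr0 => xi ai;
    by rewrite ler_norml; lra.
apply: ler_wpM2r; first by rewrite mulr_ge0// powR_ge0.
(* No coordinate of the corner moves by more than [3 l]. *)
apply: (@le_trans _ _ (\sum_(j < n) (3 * l))); last first.
  by rewrite sumr_const card_ord -[leLHS]mulr_natr mulrAC.
apply: ler_sum => j _; rewrite !mxE.
case: eqP => _; case: (s); case: (b j) => /=; rewrite ?mul1r ?mul0r ?addr0;
  by rewrite ler_norml; lra.
Qed.

End shells.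

(** * Weighted estimates *)

Section weights.
Context {R : realType} {n : nat}.
Local Notation mu := (@lebesgue_rV R n).
Implicit Types (u : 'rV[R]_n -> R) (x : 'rV[R]_n) (i : 'I_n) (s : bool) (l : R).

Lemma powRDp (l b c : R) : 0 < l -> l `^ b * l `^ c = l `^ (b + c).
Proof. by move=> l0; rewrite powRD// (gt_eqF l0) implybT. Qed.

(** The exponent may have either sign; the maximum covers both cases. *)
Lemma powR_between (l t K b : R) : 0 < l -> 1 <= K -> l <= t <= K * l ->
  t `^ b <= Num.max 1 (K `^ b) * l `^ b.
Proof.
move=> l0 K1 /andP[lt tK].
have -> : t = t / l * l by rewrite divfK ?gt_eqF.
have tl1 : 1 <= t / l by rewrite ler_pdivlMr// mul1r.
have tlK : t / l <= K by rewrite ler_pdivrMr.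
rewrite powRM ?(ltW l0)//; last exact: le_trans tl1.
apply: ler_wpM2r; first exact: powR_ge0.
rewrite le_max; have [b0|b0] := leP 0 b.
  apply/orP; right; apply: ge0_ler_powR; rewrite ?nnegrE//.
    exact: le_trans tl1.
  exact: le_trans K1.
by apply/orP; left; rewrite -(powRr0 (t / l)) ler_powR// ltW.
Qed.

Lemma measurable_enorm_powR (b : R) (D : set 'rV[R]_n) : measurable D ->
  measurable_fun D (fun x => enorm x `^ b).
Proof.
move=> mD; apply: (measurableT_comp (measurable_powR b)).
by apply: continuous_measurable_rV => //; exact: continuous_enorm.
Qed.

Lemma measurable_origin : measurable [set (0 : 'rV[R]_n)].
Proof.
have -> : [set (0 : 'rV[R]_n)] = \bigcap_k box 0 (const_mx (k.+1%:R^-1)).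
  apply/seteqP; split => [_ -> k _ i|x xB].
    by rewrite !mxE lexx add0r invr_gt0 ltr0Sn.
  apply/rowP => i; rewrite mxE; apply/eqP; rewrite eq_le.
  have xi k : 0 <= x ord0 i < k.+1%:R^-1 by have := xB k I i; rewrite !mxE add0r.
  have /andP[-> _] := xi 0%N; rewrite andbT.
  rewrite leNgt; apply/negP => x0.
  have := xi (Num.truncn (x ord0 i)^-1); apply/negP; rewrite negb_and -leNgt.
  by apply/orP; right; rewrite invf_ple ?posrE//; exact/ltW/truncnS_gt.
by apply: bigcap_measurable => // k _; exact: measurable_box.
Qed.

Lemma lebesgue_rV_origin : (0 < n)%N -> mu [set 0] = 0%E.
Proof.
move=> n0; have m0 := measurable_origin.
apply/eqP; rewrite eq_le measure_ge0 andbT; apply/lee_addgt0Pr => e e0.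
pose d := Num.min e 1.
have d0 : 0 < d by rewrite lt_min e0 ltr01.
have hd : @pos_sides R n (const_mx d) by move=> i; rewrite mxE.
rewrite add0e; apply: (@le_trans _ _ (mu (box 0 (const_mx d)))).
  apply: le_measure; rewrite ?inE//; first exact: measurable_box.
  by move=> _ -> i; rewrite !mxE lexx add0r.
rewrite mu_box// lee_fin /vol; under eq_bigr do rewrite mxE.
rewrite prodr_const card_ord -(prednK n0) exprS.
apply: (@le_trans _ _ (d * 1)); last by rewrite mulr1 ge_min lexx.
by rewrite ler_wpM2l ?(ltW d0)// exprn_ile1// ?(ltW d0)// ge_min lexx orbT.
Qed.

Lemma dyadic_scale (L t : R) : 0 < t < L ->
  exists m, L * 2^-1 ^+ m.+1 < t <= 2 * (L * 2^-1 ^+ m.+1).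
Proof.
move=> /andP[t0 tL].
have L0 : 0 < L by exact: lt_trans tL.
have : exists m, L * 2^-1 ^+ m < t.
  have /cvgrPdist_lt/(_ t t0)[m _ mP] : L * 2^-1 ^+ k @[k --> \oo] --> (0 : R).
    rewrite -[X in _ --> X](mulr0 L); apply: cvgM; first exact: cvg_cst.
    by apply: cvg_expr; rewrite gtr0_norm ?invf_lt1// ltr1n.
  exists m; have := mP m (leqnn m); rewrite /= sub0r normrN ger0_norm//.
  by rewrite mulr_ge0 ?exprn_ge0// ltW.
(* The least [m] with [L 2^-m < t] is positive because [t < L]; minimality gives the upper bound at
   its predecessor. *)
move=> /ex_minnP[[|m] mt mmin].
  by move: mt; rewrite expr0 mulr1 ltNge (ltW tL).
exists m; rewrite mt/= exprS mulrCA [2 * _]mulrA mulfV// mul1r leNgt.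
by apply/negP => /mmin; rewrite ltnn.
Qed.

Section cover.
Variables (L : R) (f : 'rV[R]_n -> \bar R).
Hypotheses (n0 : (0 < n)%N) (mf : measurable_fun [set: 'rV[R]_n] f)
  (f0 : forall x, (0 <= f x)%E)
  (fL : forall x i, L <= `|x ord0 i| -> f x = 0%E).

(** A point [x] other than the origin with [f x] nonzero lies in the shell given by a coordinate of
    largest modulus, by its sign and by the dyadic size of that modulus. The shells overlap, so this
    is only an inequality. *)
Lemma integral_shell_cover : (\int[mu]_x f x <=
  \sum_(m <oo) \sum_(z : 'I_n * bool)
    \int[mu]_(x in shell z.1 z.2 (L * 2^-1 ^+ m.+1)) f x)%E.
Proof.
pose W m (z : 'I_n * bool) : set 'rV[R]_n := shell z.1 z.2 (L * 2^-1 ^+ m.+1).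
have mW m z : measurable (W m z) by exact: measurable_box.
have mfW m z : measurable_fun [set: 'rV[R]_n] (f \_ (W m z)).
  by apply/(measurable_restrictT _ (mW m z)); exact: measurable_funS mf.
have fW0 m z x : (0 <= (f \_ (W m z)) x)%E by apply: erestrict_ge0.
have -> : (\sum_(m <oo) \sum_(z : 'I_n * bool) \int[mu]_(x in W m z) f x =
    \int[mu]_x \sum_(m <oo) \sum_(z : 'I_n * bool) (f \_ (W m z)) x)%E.
  rewrite integral_nneseries//; last 2 first.
  - by move=> m; apply: emeasurable_sum => z; exact: mfW.
  - by move=> m x _; apply: sume_ge0 => z _.
  apply: eq_eseriesr => m _; rewrite ge0_integral_sum//.
  by apply: eq_bigr => z _; exact: integral_mkcond.
have negl : mu.-negligible [set (0 : 'rV[R]_n)].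
  exists [set 0]; split => //; first exact: measurable_origin.
  exact: lebesgue_rV_origin.
apply: ae_ge0_le_integral => //.
- by move=> x _; apply: nneseries_ge0 => m _ _; apply: sume_ge0.
- apply: ge0_emeasurable_sum => [m x _ _|m _]; first exact: sume_ge0.
  by apply: emeasurable_sum => z; exact: mfW.
apply: negligibleS negl => x /= /not_implyP[_].
move=> /negP; rewrite -ltNge => Hx; apply/eqP/negP => /negP x0.
move: Hx; apply/negP; rewrite -leNgt.
have [fx|fx] := eqVneq (f x) 0%E.
  by rewrite fx; apply: nneseries_ge0 => m _ _; apply: sume_ge0.
have [i0 _] : exists i : 'I_n, true by exists (Ordinal n0).
pose i := [arg max_(i > i0) `|x ord0 i|]%O.
have xi j : `|x ord0 j| <= `|x ord0 i|.
  by rewrite /i; case: Order.TotalTheory.arg_maxP => // k _; apply.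
have xi0 : 0 < `|x ord0 i|.
  rewrite lt_neqAle normr_ge0 andbT eq_sym; apply: contra x0 => /eqP x00.
  apply/eqP/rowP => j; rewrite mxE; apply/normr0_eq0/eqP.
  by rewrite eq_le normr_ge0 andbT -x00.
have xiL : `|x ord0 i| < L.
  by rewrite ltNge; apply: contra fx => /fL ->.
have [|m mP] := @dyadic_scale L `|x ord0 i|; first by rewrite xi0.
have L0 : 0 < L by exact: lt_trans xiL.
have xW : W m (i, 0 < x ord0 i) x.
  apply: shell_cover => //; first by rewrite mulr_gt0// exprn_gt0.
apply: (@le_trans _ _ ((f \_ (W m (i, 0 < x ord0 i))) x)).
  by rewrite patchE mem_set.
rewrite (nneseriesD1 (n := m))//; last by move=> k _; apply: sume_ge0.
apply: (@le_trans _ _ (\sum_(z : 'I_n * bool) (f \_ (W m z)) x)%E).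
  by rewrite (bigD1 (i, 0 < x ord0 i))//= leeDl// sume_ge0.
by rewrite leeDl//; apply: nneseries_ge0 => k _ _; apply: sume_ge0.
Qed.

End cover.

(** * Estimates on a single shell *)

Section shell_estimates.
Variables (p a r alpha L : R).
Hypotheses (p1 : 1 <= p) (pn : p < n%:R) (r1 : 1 <= r)
  (rlt : r < n%:R * p / (n%:R - p)) (alt : a < (n%:R - p) / p) (L0 : 0 < L).

Let p0 : 0 < p. Proof. exact: lt_le_trans p1. Qed.
Let r0 : 0 < r. Proof. exact: lt_le_trans r1. Qed.
Let K : R := 6 * n%:R.
Let K1 : 1 <= K.
Proof. by rewrite /K; have := pn; have := p1; lra. Qed.

(** The r-th root of the weight: weighted norms become plain norms of the product with it, so
    Minkowski's inequality applies to them directly. *)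
Definition radial_weight x : R := enorm x `^ (- alpha / r).

Definition dyadic_length (m : nat) : R := L * 2^-1 ^+ m.

(** [N] is a bound for the weighted norm of the gradient and not its value, so that one [N] can
    serve a whole family of functions. *)
Definition energy_bounded u (N : R) : Prop :=
  [/\ Ck 1 u, (forall x i, L <= `|x ord0 i| -> u x = 0), 0 <= N &
   (\int[mu]_x (enorm x `^ (- (a * p)) * enorm (grad u x) `^ p)%:E <=
    (N `^ p)%:E)%E].

(** Averages over shells of size [l] may grow like [l^-kap] at the origin; [kap] is positive because
    [a < (n - p) / p]. *)
Let kap : R := n%:R / p - 1 - a.

(* The weighted norm of [u] over the shell of size [l] is bounded by the energy
   times [l `^ scaling_exponent]; positivity of this exponent is the upper bound on [alpha]. *)
Definition scaling_exponent : R := 1 + a - n%:R / p + (n%:R - alpha) / r.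

Let kap0 : 0 < kap.
Proof. by move: alt; rewrite /kap mulrBl divff ?gt_eqF//; lra. Qed.

Lemma scale_gt0 m : 0 < dyadic_length m.
Proof. by rewrite mulr_gt0// exprn_gt0. Qed.

Lemma scaleS m : dyadic_length m = 2 * dyadic_length m.+1.
Proof. by rewrite /dyadic_length exprS mulrCA [2 * _]mulrA mulfV// mul1r. Qed.

Let Kg : R := Num.max 1 (K `^ (a * p)).
Let Kg0 : 0 <= Kg. Proof. by rewrite le_max ler01. Qed.

Let Kw : R := Num.max 1 (K `^ (- alpha / r)).
Let Kw0 : 0 <= Kw. Proof. by rewrite le_max ler01. Qed.

Let V : R := 2 * 6 ^+ n.-1.
Let V0 : 0 < V. Proof. by rewrite mulr_gt0// exprn_gt0. Qed.

Let measurable_energy u (D : set 'rV[R]_n) : Ck 1 u -> measurable D ->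
  measurable_fun D (fun x => (enorm (grad u x) `^ p)%:E).
Proof.
move=> u1 mD; apply/measurable_EFinP; apply: (measurableT_comp (measurable_powR p)).
by apply: continuous_measurable_rV => //; exact: continuous_enorm_grad.
Qed.

Lemma energy_annulus u N l : energy_bounded u N -> 0 < l ->
  (\int[mu]_(x in annulus l) (enorm (grad u x) `^ p)%:E <=
   (Kg * l `^ (a * p) * N `^ p)%:E)%E.
Proof.
move=> [u1 _ N0 uN] l0; have mA := @measurable_annulus R n l.
have mw : measurable_fun [set: 'rV[R]_n]
    (fun x => (enorm x `^ (- (a * p)) * enorm (grad u x) `^ p)%:E).
  apply/measurable_EFinP/measurable_funM; first exact: measurable_enorm_powR.
  by apply/measurable_EFinP; exact: measurable_energy.
apply: (@le_trans _ _ (\int[mu]_(x in annulus l) ((Kg * l `^ (a * p))%:E *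
    (enorm x `^ (- (a * p)) * enorm (grad u x) `^ p)%:E))%E).
  apply: ge0_le_integral => //.
  - by move=> x _; rewrite lee_fin powR_ge0.
  - exact: measurable_energy.
  - by apply: emeasurable_funM => //; exact: measurable_funS mw.
  move=> x xA; rewrite -EFinM lee_fin mulrA.
  have x0 : 0 < enorm x by move/andP: xA => [lx _]; exact: lt_le_trans lx.
  rewrite -[leLHS]mul1r ler_wpM2r ?powR_ge0//.
  rewrite powRN ler_pdivlMr ?powR_gt0// mul1r.
  exact: powR_between.
rewrite ge0_integralZl//; last 3 first.
- exact: measurable_funS mw.
- by move=> x _; rewrite lee_fin mulr_ge0// powR_ge0.
- by rewrite lee_fin mulr_ge0// powR_ge0.
rewrite [leRHS]EFinM; apply: lee_wpmul2l; first by rewrite lee_fin mulr_ge0// powR_ge0.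
apply: le_trans uN; apply: ge0_subset_integral => //.
by move=> x _; rewrite lee_fin mulr_ge0// powR_ge0.
Qed.

Lemma energy_factor i l N : 0 < l -> 0 <= N ->
  (Kg * l `^ (a * p) * N `^ p) `^ p^-1 * vol (l *: shell_h i) `^ (- p^-1) =
  Kg `^ p^-1 * V `^ (- p^-1) * N * l `^ (a - n%:R / p).
Proof.
move=> l0 N0; rewrite vol_shell ?(ltW l0)// vol_shell_h -/V.
rewrite !powRM ?mulr_ge0 ?powR_ge0 ?(ltW V0)// -!powRrM.
rewrite -[a * p / p]mulrA mulfV ?gt_eqF// !mulr1 powRr1//.
rewrite -(powRDp _ _ l0) -mulrN; ring.
Qed.

(* The average over a shell is compared with those over the shells 2, 4, ...
   times larger, out to where [u] vanishes; the geometric series converges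
   because [a < (n - p) / p]. *)
Lemma avg_shell_le : exists2 C, 0 <= C &
  forall u N i s m, energy_bounded u N ->
  `|avg (dyadic_length m *: shell_c i s) (dyadic_length m *: shell_h i) u| <=
    C * N * (dyadic_length m) `^ (- kap).
Proof.
pose C1 := 3 * n%:R * (Kg `^ p^-1 * V `^ (- p^-1)).
have C10 : 0 <= C1 by rewrite !mulr_ge0 ?powR_ge0.
pose t := 2 `^ (- kap) : R.
have t1 : t < 1.
  have E : 1 `^ kap = 1 :> R by rewrite powR1.
  by rewrite /t powRN invf_lt1 ?powR_gt0// -[ltLHS]E gt0_ltr_powR ?nnegrE// ltr1n.
have C0 : 0 <= C1 / (1 - t) by rewrite mulr_ge0// invr_ge0 subr_ge0 ltW.
exists (C1 / (1 - t)) => // u N i s m uN.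
have [u1 uL N0 _] := uN; have [cu _ _] := Ck1P u1.
elim: m => [|m IH].
  rewrite -[avg _ _ _]subr0; apply: (@le_trans _ _ 0); last first.
    by rewrite mulr_ge0 ?powR_ge0// mulr_ge0.
  apply: avg_dist_le => //; first exact/pos_shell/scale_gt0.
  move=> x xW; rewrite (uL x i) ?subrr ?normr0//.
  have := shell_abs (scale_gt0 0) xW.
  by rewrite /dyadic_length expr0 mulr1.
set l := dyadic_length m.+1 in IH *.
have l0 : 0 < l by exact: scale_gt0.
have := avg_shell_step i s p1 u1 l0 (energy_annulus uN l0).
rewrite energy_factor// -scaleS.
set A := avg (dyadic_length m *: _) _ _ in IH *.
set B := avg (l *: _) _ _.
have -> : 3 * n%:R * l * (Kg `^ p^-1 * V `^ (- p^-1) * N * l `^ (a - n%:R / p)) =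
   C1 * N * l `^ (- kap).
  have -> : - kap = 1 + (a - n%:R / p) by rewrite /kap; ring.
  by rewrite -(powRDp 1 _ l0) powRr1 ?(ltW l0)// /C1; ring.
move=> AB; have BA : `|B| <= `|A| + C1 * N * l `^ (- kap).
  rewrite -(subrK A B) addrC; apply: le_trans (ler_normD _ _) _.
  by rewrite lerD2l distrC.
apply: le_trans BA _.
have -> : C1 / (1 - t) * N * l `^ (- kap) =
   C1 / (1 - t) * N * (dyadic_length m) `^ (- kap) + C1 * N * l `^ (- kap).
  rewrite scaleS powRM ?(ltW l0)// -/t; field.
  by rewrite subr_eq0 gt_eqF.
by rewrite lerD2r.
Qed.

Lemma wgt_shell_le i s l x : 0 < l -> shell i s l x ->
  radial_weight x <= Kw * l `^ (- alpha / r).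
Proof. by move=> l0 xW; apply: powR_between => //; exact: shell_sub xW. Qed.

Lemma wgt_ge0 x : 0 <= radial_weight x. Proof. exact: powR_ge0. Qed.

Lemma measurable_wgt (D : set 'rV[R]_n) : measurable D -> measurable_fun D radial_weight.
Proof. exact: measurable_enorm_powR. Qed.

Lemma pnorm_wgt_le i s l (f : 'rV[R]_n -> R) : 0 < l ->
  measurable_fun (shell i s l) f ->
  (pnorm mu (shell i s l) r (radial_weight \* f)%R <=
   (Kw * l `^ (- alpha / r))%:E * pnorm mu (shell i s l) r f)%E.
Proof.
move=> l0 mf; have mW : measurable (shell i s l) by exact: measurable_box.
have k0 : 0 <= Kw * l `^ (- alpha / r) by rewrite mulr_ge0// powR_ge0.
rewrite -{1}(ger0_norm k0) -pnormZ//.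
apply: le_pnorm => //.
- exact: ltW.
- by apply: measurable_funM => //; exact: measurable_wgt.
- exact: measurable_funM.
move=> x xW; rewrite /= normrM (ger0_norm (wgt_ge0 x)) normrM (ger0_norm k0).
by rewrite ler_wpM2r//; exact: wgt_shell_le xW.
Qed.

Lemma vol_shell_root i l : 0 < l ->
  vol (l *: shell_h i) `^ r^-1 = l `^ (n%:R / r) * V `^ r^-1.
Proof.
move=> l0; rewrite vol_shell ?(ltW l0)// vol_shell_h -/V.
by rewrite powRM ?powR_ge0 ?(ltW V0)// -powRrM.
Qed.

Lemma shell_bounded_le : exists2 C, 0 <= C &
  forall i s l (f : 'rV[R]_n -> R) (e : R), 0 < l -> 0 <= e ->
  measurable_fun (shell i s l) f -> (forall x, shell i s l x -> `|f x| <= e) ->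
  (pnorm mu (shell i s l) r (radial_weight \* f)%R <= (C * e * l `^ ((n%:R - alpha) / r))%:E)%E.
Proof.
exists (Kw * V `^ r^-1); first by rewrite mulr_ge0// powR_ge0.
move=> i s l f e l0 e0 mf fe.
have mW : measurable (shell i s l) by exact: measurable_box.
apply: le_trans (pnorm_wgt_le l0 mf) _.
apply: (@le_trans _ _ ((Kw * l `^ (- alpha / r))%:E *
   pnorm mu (shell i s l) r (fun=> e))%E).
  apply: lee_wpmul2l; first by rewrite lee_fin mulr_ge0// powR_ge0.
  apply: le_pnorm => //; first exact: ltW.
  by move=> x xW; rewrite (ger0_norm e0) fe.
rewrite (pnorm_cst e mW r0 (mu_box _ (pos_shell i l0))) (ger0_norm e0).
rewrite -EFinM lee_fin vol_shell_root// mulrBl -(powRDp _ _ l0) -mulNr.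
by rewrite le_eqVlt; apply/orP; left; apply/eqP; ring.
Qed.

(** [sobolev_box] at scale [l]: the powers of [l] that come from the weight, the volume, the sides
    and the energy combine to [scaling_exponent], and what remains is the same for all shells. *)
Lemma shell_dyad_le : exists C th, [/\ 0 <= C, 0 <= th, th < 1 &
  forall u N i s l k, energy_bounded u N -> 0 < l ->
  (pnorm mu (shell i s l) r
    (radial_weight \* (u \- dyad k (l *: shell_c i s) (l *: shell_h i) u))%R <=
   (C * th ^+ k * N * l `^ scaling_exponent)%:E)%E].
Proof.
have [C [th [C0 th0 th1 H]]] := sobolev_box p1 r1 pn rlt.
exists (Kw * C * V `^ r^-1 * K * (Kg `^ p^-1 * V `^ (- p^-1))), th; split => //.
  by rewrite !mulr_ge0 ?powR_ge0// (le_trans ler01 K1).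
move=> u N i s l k uN l0.
have [u1 uL N0 _] := uN; have [cu _ _] := Ck1P u1.
have mW : measurable (shell i s l) by exact: measurable_box.
apply: le_trans (pnorm_wgt_le l0 _) _.
  apply: measurable_funB; last exact: measurable_dyad.
  exact: continuous_measurable_rV.
have GE : (\int[mu]_(x in shell i s l) (enorm (grad u x) `^ p)%:E <=
   (Kg * l `^ (a * p) * N `^ p)%:E)%E.
  apply: le_trans (energy_annulus uN l0); apply: ge0_subset_integral => //.
  - exact: measurable_annulus.
  - by apply: measurable_energy => //; exact: measurable_annulus.
  - by move=> x _; rewrite lee_fin powR_ge0.
  - exact: shell_sub.
have G0 : 0 <= Kg * l `^ (a * p) * N `^ p by rewrite !mulr_ge0 ?powR_ge0.
apply: (@le_trans _ _ ((Kw * l `^ (- alpha / r))%:E * (C * th ^+ k *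
   (vol (l *: shell_h i) `^ r^-1 * (K * l) *
    ((Kg * l `^ (a * p) * N `^ p) `^ p^-1 * vol (l *: shell_h i) `^ (- p^-1))))%:E)%E).
  apply: lee_wpmul2l; first by rewrite lee_fin mulr_ge0// powR_ge0.
  apply: le_trans (H u _ _ k _ (pos_shell i l0) u1 G0 GE) _.
  rewrite lee_fin ler_wpM2l ?mulr_ge0 ?exprn_ge0//.
  rewrite mulrA ler_wpM2r ?powR_ge0// ler_wpM2r ?powR_ge0// ler_wpM2l ?powR_ge0//.
  exact/side_sum_shell/ltW.
rewrite -EFinM lee_fin energy_factor// vol_shell_root//.
have -> : l `^ scaling_exponent = l `^ (- alpha / r) * l `^ (n%:R / r) * l * l `^ (a - n%:R / p).
  rewrite -[X in _ = _ * X * _](powRr1 (ltW l0)) !powRDp//; congr (powR _ _).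
  by rewrite /scaling_exponent mulrBl; ring.
by rewrite le_eqVlt; apply/orP; left; apply/eqP; ring.
Qed.

(** [u] is split into its deviation from the average over the shell and the average itself. Both
    parts have the same order, since [scaling_exponent] equals [- kap + (n - alpha) / r]. *)
Lemma shell_le : exists2 C, 0 <= C &
  forall u N i s m, energy_bounded u N ->
  (pnorm mu (shell i s (dyadic_length m)) r (radial_weight \* u)%R <=
    (C * N * (dyadic_length m) `^ scaling_exponent)%:E)%E.
Proof.
have [C1 C10 H1] := avg_shell_le.
have [C2 C20 H2] := shell_bounded_le.
have [C3 [th [C30 th0 th1 H3]]] := shell_dyad_le.
exists (C3 + C2 * C1) => [|u N i s m uN]; first by rewrite addr_ge0// mulr_ge0.
have [u1 uL N0 _] := uN; have [cu _ _] := Ck1P u1.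
set l := dyadic_length m; have l0 : 0 < l by exact: scale_gt0.
have mW : measurable (shell i s l) by exact: measurable_box.
set A := avg (l *: shell_c i s) (l *: shell_h i) u.
have mu_ : measurable_fun (shell i s l) u by exact: continuous_measurable_rV.
have -> : (radial_weight \* u)%R = ((radial_weight \* (u \- fun=> A)) \+ (radial_weight \* (fun=> A)))%R.
  by apply/funext => x /=; rewrite -mulrDr subrK.
apply: le_trans (pnorm_triangle _ _ _ _ _) _ => //.
- apply: measurable_funM; first exact: measurable_wgt.
  exact: measurable_funB.
- by apply: measurable_funM => //; exact: measurable_wgt.
(* In generation 0 the dyadic function is the constant [A]. *)
have := H3 u N i s l 0%N uN l0; rewrite expr0 mulr1 => H3'.
have := H2 i s l (fun=> A) `|A| l0 (normr_ge0 _) (measurable_cst _) (fun x _ => lexx _).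
move=> H2'; apply: le_trans (leeD H3' H2') _.
rewrite -EFinD lee_fin [(C3 + _) * N]mulrDl [leRHS]mulrDl lerD2l.
apply: (@le_trans _ _ (C2 * (C1 * N * l `^ (- kap)) * l `^ ((n%:R - alpha) / r))).
  by rewrite ler_wpM2r ?powR_ge0// ler_wpM2l// /A; exact: H1.
have -> : l `^ scaling_exponent = l `^ (- kap) * l `^ ((n%:R - alpha) / r).
  by rewrite powRDp//; congr (powR _ _); rewrite /scaling_exponent /kap; ring.
by rewrite le_eqVlt; apply/orP; left; apply/eqP; ring.
Qed.

End shell_estimates.
End weights.

Lemma powR_expn {R : realType} (x s : R) k : 0 <= x -> (x ^+ k) `^ s = (x `^ s) ^+ k.
Proof.
move=> x0; rewrite -(powR_mulrn k x0) -powRrM mulrC powRrM.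
by rewrite powR_mulrn ?powR_ge0.
Qed.

(** * Summation over the shells *)

Section global_estimates.
Context {R : realType} {n : nat}.
Local Notation mu := (@lebesgue_rV R n).
Implicit Types (u : 'rV[R]_n -> R) (x : 'rV[R]_n) (i : 'I_n) (s : bool) (l : R).
Variables (p a r alpha L : R).
Hypotheses (p1 : 1 <= p) (pn : p < n%:R) (r1 : 1 <= r)
  (rlt : r < n%:R * p / (n%:R - p)) (alt : a < (n%:R - p) / p) (L0 : 0 < L)
  (alphalt : alpha < (1 + a) * r + n%:R * (1 - r / p)).

Local Notation wgt := (radial_weight r alpha).
Local Notation scale := (dyadic_length L).
Local Notation energy_le := (energy_bounded p a L).
Local Notation sig := (scaling_exponent (n := n) p a r alpha).

Let p0 : 0 < p. Proof. exact: lt_le_trans p1. Qed.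
Let r0 : 0 < r. Proof. exact: lt_le_trans r1. Qed.
Let n0 : (0 < n)%N.
Proof. by rewrite -(ltr_nat R); exact: lt_trans pn. Qed.

Let sig0 : 0 < sig.
Proof.
rewrite -(pmulr_lgt0 _ r0) /scaling_exponent mulrDl divfK ?gt_eqF//.
have -> : (1 + a - n%:R / p) * r = (1 + a) * r - n%:R * (r / p) by ring.
by move: alphalt; rewrite mulrBr mulr1; lra.
Qed.

Lemma scale_le m : scale m <= L.
Proof.
rewrite /dyadic_length ler_piMr ?(ltW L0)// exprn_ile1//.
by rewrite invf_le1// ler1n.
Qed.

(** The bounds [b m] are left free: the imbedding takes one formula at all scales, while
    [weighted_ehrling] takes a different one at the finitely many large scales. The factor [2 n]
    counts the boxes of one size. *)
Lemma pnorm_wgt_cover u (b : nat -> R) (M t : R) : continuous u ->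
  (forall x i, L <= `|x ord0 i| -> u x = 0) ->
  0 <= M -> 0 <= t < 1 -> (forall m, 0 <= b m) ->
  (forall m i s, pnorm mu (shell i s (scale m.+1)) r (wgt \* u)%R <= (b m)%:E)%E ->
  (forall m, (2 * n)%:R * b m `^ r <= M * t ^+ m) ->
  (\int[mu]_x (`|(wgt \* u)%R x| `^ r)%:E <= (M / (1 - t))%:E)%E.
Proof.
move=> cu uL M0 t01 b0 ub bM.
have mw : measurable_fun [set: 'rV[R]_n] (wgt \* u)%R.
  apply: measurable_funM; first exact: measurable_wgt.
  exact: continuous_measurable_rV.
apply: le_trans (integral_shell_cover (L := L) n0 _ _ _) _.
- exact: measurable_fun_abs_powR.
- by move=> x; rewrite lee_fin powR_ge0.
- by move=> x i xi; rewrite /= (uL x i xi) mulr0 normr0 powR0// gt_eqF.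
apply: le_trans (geometric_nneseries M0 t01); apply: lee_nneseries => [m _ _|m].
  by apply: sume_ge0 => z _; exact: integral_powR_ge0.
move=> _; apply: (@le_trans _ _ (\sum_(z : 'I_n * bool) (b m `^ r)%:E)%E).
  by apply: lee_sum => z _; apply/pnorm_leP => //; exact: ub.
rewrite sumEFin lee_fin sumr_const card_prod card_ord card_bool mulnC.
by rewrite -[leLHS]mulr_natl; exact: bM.
Qed.

Lemma weighted_embedding : exists2 C, 0 <= C &
  forall u N, energy_le u N -> (pnorm mu setT r (wgt \* u)%R <= (C * N)%:E)%E.
Proof.
have [C C0 H] := shell_le alpha p1 pn r1 rlt alt L0.
pose t : R := 2^-1 `^ (sig * r).
have t0 : 0 <= t by exact: powR_ge0.
have t1 : t < 1.
  have <- : 1 `^ (sig * r) = 1 :> R by rewrite powR1.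
  by rewrite /t gt0_ltr_powR ?nnegrE ?mulr_gt0// invf_lt1// ltr1n.
pose D := (2 * n)%:R * (C * L `^ sig) `^ r / (1 - t).
have D0 : 0 <= D by rewrite !mulr_ge0 ?powR_ge0// invr_ge0 subr_ge0 ltW.
exists (D `^ r^-1) => [|u N uN]; first exact: powR_ge0.
have [u1 uL N0 _] := uN; have [cu _ _] := Ck1P u1.
apply/pnorm_leP => //; first by rewrite mulr_ge0// powR_ge0.
rewrite powRM ?powR_ge0// -powRrM mulVf ?gt_eqF// powRr1//.
have -> : D * N `^ r = (2 * n)%:R * (C * L `^ sig * N) `^ r / (1 - t).
  by rewrite [in RHS]powRM ?mulr_ge0 ?powR_ge0// /D; ring.
apply: (pnorm_wgt_cover (b := fun m => C * N * scale m.+1 `^ sig)) => //.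
- by rewrite mulr_ge0// powR_ge0.
- by rewrite t0.
- by move=> m; rewrite !mulr_ge0// powR_ge0.
- by move=> m i s; exact: H.
move=> m; rewrite -[leRHS]mulrA ler_wpM2l//.
have -> : C * N * scale m.+1 `^ sig = C * L `^ sig * N * (2^-1 ^+ m.+1) `^ sig.
  by rewrite /dyadic_length powRM ?exprn_ge0 ?(ltW L0)//; ring.
rewrite powRM ?mulr_ge0 ?powR_ge0//; apply: ler_wpM2l; first exact: powR_ge0.
have -> : (2^-1 ^+ m.+1) `^ sig `^ r = t ^+ m.+1.
  by rewrite powR_expn// powR_expn ?powR_ge0// -powRrM.
by rewrite exprS ler_piMl ?exprn_ge0// ltW.
Qed.

(** An inequality of Ehrling type. The small shells are negligible by the power of their size,
    uniformly for energies bounded by [N]; on the remaining ones [u] is close to its dyadic averages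
    of a high generation, which are small by assumption. *)
Lemma weighted_ehrling N eta : 0 <= N -> 0 < eta ->
  exists M k, exists2 tau, 0 < tau &
  forall u, energy_le u N ->
  (forall m i s x, (m < M)%N -> `|dyad k (scale m.+1 *: shell_c i s)
     (scale m.+1 *: shell_h i) u x| <= tau) ->
  (pnorm mu setT r (wgt \* u)%R <= eta%:E)%E.
Proof.
move=> N0 eta0.
have [C1 C10 H1] := shell_le alpha p1 pn r1 rlt alt L0.
have [C2 C20 H2] := @shell_bounded_le R n p r alpha p1 pn r1.
have [C3 [th [C30 th0 th1 H3]]] := @shell_dyad_le R n p a r alpha L p1 pn r1 rlt.
(* Half of the decay [2^-(sig * r)] is spent on making the tail beyond [M] small, the other half on
   keeping the series summable. *)
pose t : R := 2^-1 `^ (sig * r / 2).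
have t0 : 0 < t by exact: powR_gt0.
have t1 : t < 1.
  have <- : 1 `^ (sig * r / 2) = 1 :> R by rewrite powR1.
  by rewrite /t gt0_ltr_powR ?nnegrE ?divr_gt0 ?mulr_gt0// invf_lt1// ltr1n.
have tt01 : 0 <= t < 1 by rewrite (ltW t0).
pose D := (2 * n)%:R * (C1 * N * L `^ sig) `^ r.
have D0 : 0 <= D by rewrite mulr_ge0// powR_ge0.
(* Chosen so that a geometric series with first term [2 E] and ratio [t] has sum [eta ^ r]. *)
pose E := eta `^ r * (1 - t) / 2.
have E0 : 0 < E by rewrite !mulr_gt0 ?powR_gt0// subr_gt0.
have [M MP] : exists M, D * t ^+ M <= E.
  have : D * t ^+ k @[k --> \oo] --> (0 : R).
    rewrite -[X in _ --> X](mulr0 D); apply: cvgM; first exact: cvg_cst.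
    by apply: cvg_expr; rewrite gtr0_norm.
  move=> /cvgrPdist_le/(_ E E0)[M _ MP]; exists M.
  have := MP M (leqnn M); rewrite /= sub0r normrN ger0_norm//.
  by rewrite mulr_ge0 ?exprn_ge0// ltW.
(* The norm allowed on each of the large shells: [2 n] boxes contribute [E t^M], which is below
   [2 E t^m] for [m < M]. The deviation from the dyadic averages and these averages get [b / 2]
   each. *)
pose b := (E * t ^+ M / (2 * n)%:R) `^ r^-1.
have nn0 : 0 < (2 * n)%:R :> R by rewrite ltr0n muln_gt0.
have b0 : 0 < b by rewrite powR_gt0// divr_gt0// mulr_gt0// exprn_gt0.
pose A := C3 * N * L `^ sig.
have A0 : 0 <= A by rewrite !mulr_ge0// powR_ge0.
have [k kP] : exists k, A * th ^+ k <= b / 2.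
  have : A * th ^+ k @[k --> \oo] --> (0 : R).
    rewrite -[X in _ --> X](mulr0 A); apply: cvgM; first exact: cvg_cst.
    by apply: cvg_expr; rewrite ger0_norm.
  have b20 : 0 < b / 2 by rewrite divr_gt0.
  move=> /cvgrPdist_le/(_ _ b20)[k _ kP]; exists k.
  have := kP k (leqnn k); rewrite /= sub0r normrN ger0_norm//.
  by rewrite mulr_ge0 ?exprn_ge0.
(* The sum dominates each of the scaling factors of the [M] large shells; adding 1 below keeps the
   denominator of [tau] positive. *)
pose X := \sum_(m < M) scale m.+1 `^ ((n%:R - alpha) / r).
have X0 : 0 <= X by apply: sumr_ge0 => m _; exact: powR_ge0.
have CX0 : 0 < C2 * X + 1 by rewrite ltr_wpDl// mulr_ge0.
pose tau := b / 2 / (C2 * X + 1).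
have tau0 : 0 < tau by rewrite !divr_gt0.
exists M, k, tau => // u uN utau.
have [u1 uL _ _] := uN; have [cu _ _] := Ck1P u1.
apply/pnorm_leP => //; first exact: ltW.
have -> : eta `^ r = 2 * E / (1 - t).
  by rewrite /E; field; rewrite subr_eq0 gt_eqF.
apply: (pnorm_wgt_cover (b := fun m => if (m < M)%N then b else
  C1 * N * scale m.+1 `^ sig)) => //.
- by rewrite mulr_ge0// ltW.
- by move=> m; case: ifP => _; [exact: ltW|rewrite !mulr_ge0// powR_ge0].
- move=> m i s; case: ifPn => mM; last exact: H1.
  set l := scale m.+1; have l0 : 0 < l by exact: scale_gt0.
  set d := dyad k (l *: shell_c i s) (l *: shell_h i) u.
  have mW : measurable (shell i s l) by exact: measurable_box.
  have md : measurable_fun (shell i s l) d by exact: measurable_dyad.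
  have mu_ : measurable_fun (shell i s l) u by exact: continuous_measurable_rV.
  have -> : (wgt \* u)%R = ((wgt \* (u \- d)) \+ (wgt \* d))%R.
    by apply/funext => x /=; rewrite -mulrDr subrK.
  apply: le_trans (pnorm_triangle _ _ _ _ _) _ => //.
  + apply: measurable_funM; first exact: measurable_wgt.
    exact: measurable_funB.
  + by apply: measurable_funM => //; exact: measurable_wgt.
  have H3' := H3 u N i s l k uN l0.
  have H2' := H2 i s l d tau l0 (ltW tau0) md (fun x _ => utau m i s x mM).
  apply: le_trans (leeD H3' H2') _.
  rewrite -EFinD lee_fin [leRHS](splitr b); apply: lerD.
    apply: le_trans kP; rewrite /A [C3 * _ * N]mulrAC [leRHS]mulrAC.
    rewrite ler_wpM2l ?mulr_ge0 ?exprn_ge0//.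
    by apply: ge0_ler_powR; rewrite ?nnegrE ?(ltW l0) ?(ltW L0) ?(ltW sig0)// scale_le.
  rewrite mulrAC; apply: (@le_trans _ _ (C2 * X * tau)).
    rewrite ler_wpM2r ?(ltW tau0)// ler_wpM2l// /X (bigD1 (Ordinal mM))//= lerDl.
    by apply: sumr_ge0 => *; exact: powR_ge0.
  rewrite /tau mulrCA ler_piMr//; first by rewrite divr_ge0// ltW.
  by rewrite ler_pdivrMr// mul1r lerDl.
move=> m; case: ifPn => mM.
  rewrite /b -powRrM mulVf ?gt_eqF// powRr1; last first.
    by rewrite divr_ge0// mulr_ge0 ?exprn_ge0 ?ltW.
  rewrite mulrC divfK ?gt_eqF// [2 * E]mulrC -[leRHS]mulrA ler_wpM2l ?(ltW E0)//.
  apply: (@le_trans _ _ (t ^+ m)); last by rewrite ler_peMl ?exprn_ge0 ?(ltW t0)// ler1n.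
  by apply: ler_wiXn2l; rewrite ?(ltW t0) ?(ltW t1)// ltnW.
rewrite -leqNgt in mM.
have -> : C1 * N * scale m.+1 `^ sig = C1 * N * L `^ sig * (2^-1 ^+ m.+1) `^ sig.
  by rewrite /dyadic_length powRM ?exprn_ge0 ?(ltW L0)//; ring.
rewrite powRM ?mulr_ge0 ?powR_ge0// mulrA -/D.
have -> : (2^-1 ^+ m.+1) `^ sig `^ r = t ^+ m.+1 * t ^+ m.+1.
  by rewrite powR_expn// powR_expn ?powR_ge0// -powRrM -exprMn /t powRDp// -splitr.
apply: (@le_trans _ _ (D * t ^+ M * t ^+ m)).
  rewrite -mulrA ler_wpM2l// ler_pM ?exprn_ge0 ?(ltW t0)//.
    by apply: ler_wiXn2l; rewrite ?(ltW t0) ?(ltW t1)// (leq_trans mM).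
  by apply: ler_wiXn2l; rewrite ?(ltW t0) ?(ltW t1).
rewrite ler_wpM2r ?exprn_ge0 ?(ltW t0)//; apply: le_trans MP _.
by rewrite ler_peMl ?(ltW E0)// ler1n.
Qed.

End global_estimates.

(** * Compactness *)

Section ultrafilter_compactness.
Context {R : realType} {n : nat}.
Local Notation mu := (@lebesgue_rV R n).
Implicit Types (u : 'rV[R]_n -> R) (x : 'rV[R]_n) (i : 'I_n) (s : bool) (l : R).
Variables (p a r alpha L : R).
Hypotheses (p1 : 1 <= p) (pn : p < n%:R) (r1 : 1 <= r)
  (rlt : r < n%:R * p / (n%:R - p)) (alt : a < (n%:R - p) / p) (L0 : 0 < L)
  (alphalt : alpha < (1 + a) * r + n%:R * (1 - r / p)).

Local Notation wgt := (radial_weight r alpha).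
Local Notation scale := (dyadic_length L).
Local Notation energy_le := (energy_bounded p a L).

Let p0 : 0 < p. Proof. exact: lt_le_trans p1. Qed.
Let r0 : 0 < r. Proof. exact: lt_le_trans r1. Qed.
Let n0 : (0 < n)%N.
Proof. by rewrite -(ltr_nat R); exact: lt_trans pn. Qed.

(** On the annulus the reciprocal of the weight is bounded, so the weighted imbedding controls the
    plain L^r norm on the box and hence the average. *)
Lemma avg_energy_le N c h l : 0 < l -> pos_sides h -> box c h `<=` annulus l ->
  exists M, forall u, energy_le u N -> `|avg c h u| <= M.
Proof.
move=> l0 h0 cl; have [C C0 H] := weighted_embedding p1 pn r1 rlt alt L0 alphalt.
pose W := Num.max 1 ((6 * n%:R) `^ (alpha / r)) * l `^ (alpha / r).
have W0 : 0 <= W by rewrite mulr_ge0 ?powR_ge0// le_max ler01.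
exists (W * (C * N) * vol h `^ (- r^-1)) => u uN; apply: (abs_avg_le h0) r1 _.
  by have [u1 _ _ _] := uN; have [] := Ck1P u1.
have cu : continuous u by have [u1 _ _ _] := uN; have [] := Ck1P u1.
have mB := measurable_box c h.
have mw (A : set 'rV[R]_n) : measurable A -> measurable_fun A (wgt \* u)%R.
  move=> mA; apply: measurable_funM; first exact: measurable_wgt.
  exact: continuous_measurable_rV.
apply: (@le_trans _ _ (pnorm mu (box c h) r (fun x => W * (wgt \* u)%R x))).
  apply: le_pnorm => //; first exact: ltW.
  - exact: continuous_measurable_rV.
  - by apply: measurable_funM => //; exact: mw.
  move=> x /cl/andP[x1 x2]; rewrite (normrM W) (normrM (wgt x)) mulrA.
  have x0 : 0 < enorm x by exact: lt_le_trans x1.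
  rewrite -[leLHS]mul1r ler_wpM2r//.
  rewrite (ger0_norm W0) [`|wgt x|]ger0_norm ?powR_ge0//.
  apply: (@le_trans _ _ (enorm x `^ (alpha / r) * wgt x)).
    by rewrite /radial_weight powRDp// mulNr subrr powRr0.
  rewrite ler_wpM2r ?powR_ge0//; apply: powR_between => //.
    have : 1 <= n%:R :> R by rewrite ler1n.
    lra.
  by rewrite x1.
rewrite pnormZ ?(ger0_norm W0)//; last exact: mw.
rewrite [leRHS]EFinM; apply: lee_wpmul2l; first by rewrite lee_fin.
apply: le_trans (H _ _ uN); apply: subset_pnorm => //; first exact: ltW.
exact: mw.
Qed.

Variables (N : R) (u_ : nat -> 'rV[R]_n -> R).
Hypotheses (N0 : 0 <= N) (uN : forall j j', energy_le (u_ j \- u_ j')%R N).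
Variable U : set_system nat.
Context {UU : UltraFilter U}.

(* An ultrafilter replaces the extraction of nested subsequences, one for each
   of the finitely many averages involved. *)
Lemma bounded_ultra (b : nat -> R) M tau : 0 < tau ->
  (forall j, `|b j| <= M) ->
  exists2 A, U A & forall j j', A j -> A j' -> `|b j - b j'| <= tau.
Proof.
move=> tau0 bM; have [y [_ yb]] : (`[- M, M]%classic `&` cluster (b @ U)) !=set0.
  apply: segment_compact; apply: (@filterE _ U) => j /=.
  by rewrite in_itv/= -ler_norml bM.
have t20 : 0 < tau / 2 by rewrite divr_gt0.
exists (b @^-1` ball y (tau / 2)) => [|j j' bj bj'].
  (* If the preimage of the ball were not in [U], its complement would be, and [y] could not be a
     cluster point. *)
  have [//|UB] := in_ultra_setVsetC (b @^-1` ball y (tau / 2)) UU.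
  have [z [/= z1 z2]] := yb (~` ball y (tau / 2)) _ UB (nbhsx_ballx y _ t20).
  by case: (z1 z2).
rewrite (splitr tau) (_ : b j - b j' = (b j - y) + (y - b j')); last by ring.
apply: le_trans (ler_normD _ _) _; rewrite distrC.
by apply: lerD; exact: ltW.
Qed.

Lemma dyad_ultra k c h l tau : 0 < l -> pos_sides h -> box c h `<=` annulus l ->
  0 < tau -> exists2 A, U A & forall j j' x, A j -> A j' ->
    `|dyad k c h (u_ j \- u_ j')%R x| <= tau.
Proof.
move=> l0 + + tau0; elim: k c h => [|k IH] c h h0 cl.
  have [M MP] := avg_energy_le N l0 h0 cl.
  (* Energies are bounded for differences only, so all averages are taken relative to [u_ 0]. *)
  have [A UA AP] := bounded_ultra tau0 (fun j => MP _ (uN j 0)).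
  exists A => // j j' x Aj Aj' /=; move: (AP _ _ Aj Aj'); rewrite -avgB//.
  - have -> : (fun x => (u_ j \- u_ 0%N)%R x - (u_ j' \- u_ 0%N)%R x) = (u_ j \- u_ j')%R.
      by apply/funext => z /=; ring.
    by [].
  - by have [+ _ _ _] := uN j 0; case/Ck1P.
  - by have [+ _ _ _] := uN j' 0; case/Ck1P.
have /choice[A AP] (b : {ffun 'I_n -> bool}) : exists A, U A /\ forall j j' x, A j -> A j' ->
    `|dyad k (child c h b) (half h) (u_ j \- u_ j')%R x| <= tau.
  have [|A UA AP] := IH (child c h b) (half h) (pos_half h0).
    by apply: subset_trans cl; exact: box_child_sub.
  by exists A.
exists [set j | forall b, A b j] => [|j j' x Aj Aj'].
  by apply: filter_forall => b; have [] := AP b.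
have [[b xb]|xb] := pselect (exists b, box (child c h b) (half h) x).
  by rewrite (dyadS _ _ h0 xb); have [_] := AP b; exact.
rewrite /= big1 ?normr0 ?ltW// => b _; rewrite indicE memNset ?mul0r// => xb'.
by apply: xb; exists b.
Qed.

(** [weighted_ehrling] tests finitely many dyadic functions; each one provides a set of [U], and [U]
    is closed under finite intersections. *)
Lemma pnorm_wgt_ultra eta : 0 < eta ->
  exists2 A, U A & forall j j', A j -> A j' ->
  (pnorm mu setT r (wgt \* (u_ j \- u_ j'))%R <= eta%:E)%E.
Proof.
move=> eta0.
have [M [k [tau tau0 H]]] := weighted_ehrling p1 pn r1 rlt alt L0 alphalt N0 eta0.
have /choice[A AP] (z : 'I_M * ('I_n * bool)) : exists A, U A /\ forall j j' x, A j -> A j' ->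
    `|dyad k (scale z.1.+1 *: shell_c z.2.1 z.2.2) (scale z.1.+1 *: shell_h z.2.1)
      (u_ j \- u_ j')%R x| <= tau.
  have s0 := scale_gt0 L0 z.1.+1.
  by have [A UA AP] := dyad_ultra k s0 (pos_shell z.2.1 s0) (@shell_sub _ _ _ z.2.2 _ s0) tau0; exists A.
exists [set j | forall z, A z j] => [|j j' Aj Aj'].
  by apply: filter_forall => z; have [] := AP z.
apply: H => // m i s x mM; have [_] := AP (Ordinal mM, (i, s)); exact.
Qed.

End ultrafilter_compactness.

(** * Extraction of a subsequence *)

Section sequential_compactness.
Context {R : realType} {n : nat}.
Local Notation mu := (@lebesgue_rV R n).
Variables (p a r alpha L : R).
Hypotheses (p1 : 1 <= p) (pn : p < n%:R) (r1 : 1 <= r)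
  (rlt : r < n%:R * p / (n%:R - p)) (alt : a < (n%:R - p) / p) (L0 : 0 < L)
  (alphalt : alpha < (1 + a) * r + n%:R * (1 - r / p)).

Lemma weighted_compact N (u_ : nat -> 'rV[R]_n -> R) : 0 <= N ->
  (forall j j', energy_bounded p a L (u_ j \- u_ j')%R N) ->
  exists2 sigma : nat -> nat, {homo sigma : k l / (k < l)%N} &
  forall k l, (k <= l)%N ->
   (pnorm mu setT r (radial_weight r alpha \* (u_ (sigma k) \- u_ (sigma l)))%R <=
     (k.+1%:R^-1)%:E)%E.
Proof.
move=> N0 uN; have [U [UU ooU]] := ultraFilterLemma (F := \oo) _.
have UF : ProperFilter U := ultra_proper.
have /choice[A AP] (k : nat) : exists A, U A /\ forall j j', A j -> A j' ->
  (pnorm mu setT r (radial_weight r alpha \* (u_ j \- u_ j'))%R <= (k.+1%:R^-1)%:E)%E.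
  have k0 : 0 < (k.+1%:R^-1 : R) by rewrite invr_gt0.
  by have [A UA AP] := pnorm_wgt_ultra p1 pn r1 rlt alt L0 alphalt N0 uN k0; exists A.
(* The sets decrease and belong to [U]. As [U] refines the filter at infinity, each of them contains
   arbitrarily large indices, so [sigma] can be chosen increasing with [sigma k] in [B k]. *)
pose B := fix B k := if k is k'.+1 then B k' `&` A k else A 0%N.
have UB k : U (B k).
  elim: k => [|k IH] /=; first by have [] := AP 0%N.
  by apply: filterI => //; have [] := AP k.+1.
have subB k l : (k <= l)%N -> B l `<=` B k.
  move=> /subnK <-; elim: (l - k)%N => [//|d IH].
  by rewrite addSn; apply: subset_trans IH => x [].
have BA k : B k `<=` A k by case: k => [//|k] x [].
have /choice[g gP] (km : nat * nat) : exists j, B km.1 j /\ (km.2 < j)%N.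
  have := filter_ex (filterI (UB km.1) (ooU _ (nbhs_infty_gt km.2))).
  by move=> [j [Bj mj]]; exists j.
pose sigma := fix s k := if k is k'.+1 then g (k, s k') else g (0, 0)%N.
have sB k : B k (sigma k) by case: k => [|k]; [have [] := gP (0, 0)%N|have [] := gP (k.+1, sigma k)].
exists sigma => [|k l kl].
  apply: homo_ltn; first exact: ltn_trans.
  by move=> k; have [_] := gP (k.+1, sigma k).
by have [_] := AP k; apply; apply: BA => //; apply: subB kl _ _.
Qed.
End sequential_compactness.

(** * Closability of the gradient *)

Section null_sequences.
Context d (T : measurableType d) (R : realType) (mu : {measure set T -> \bar R}).

(** Along [s] the norms are at most [2^-k], so the series of the values converges almost everywhere
    and its terms tend to 0. The bound [k <= s k] replaces monotonicity of [s]. *)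
Lemma pnorm_null_subseq D r (f : nat -> T -> R) (m : R) : measurable D ->
  1 <= r -> mu D = m%:E -> (forall k, measurable_fun D (f k)) ->
  (forall e, 0 < e -> exists N, forall k, (N <= k)%N -> (pnorm mu D r (f k) <= e%:E)%E) ->
  exists2 s : nat -> nat, (forall k, (k <= s k)%N) &
    \forall x \ae mu, D x -> f (s k) x @[k --> \oo] --> (0 : R).
Proof.
move=> mD r1 Dm mf f0.
have /choice[s sP] (k : nat) : exists s, (k <= s)%N /\
    (pnorm mu D r (f s) <= (1 * 2^-1 ^+ k)%:E)%E.
  have [|N NP] := f0 (1 * 2^-1 ^+ k); first by rewrite mul1r exprn_gt0.
  by exists (maxn k N); rewrite leq_maxl; split => //; apply: NP; rewrite leq_maxr.
exists s => [k|]; first by have [] := sP k.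
have mfs k : measurable_fun D (f (s k)) by [].
have fs k : (pnorm mu D r (f (s k)) <= (1 * 2^-1 ^+ k)%:E)%E by have [] := sP k.
apply: filterS (pnorm_fast_cvg_ae mD r1 Dm ler01 mfs fs) => x + Dx => /(_ Dx).
exact: cvg_series_cvg_0.
Qed.

End null_sequences.

Section Ck_linear.
Context {R : realType} {n : nat}.
Implicit Types (f g : 'rV[R]_n -> R) (x : 'rV[R]_n) (i : 'I_n).

Lemma partial_lin i c f g : (forall x, derivable f x (ei i)) ->
  (forall x, derivable g x (ei i)) ->
  partial i (fun x => c * f x + g x) = fun x => c * partial i f x + partial i g x.
Proof.
move=> df dg; apply/funext => x; rewrite /partial.
rewrite (_ : (fun x => _) = (c \*: f) + g)//.
by rewrite deriveD ?deriveZ//; exact: derivableZ.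
Qed.

Lemma Ck_lin k c f g : Ck k f -> Ck k g -> Ck k (fun x => c * f x + g x).
Proof.
elim: k f g => [|k IH] f g [cf df] [cg dg].
  split => // x; apply: (@continuousD _ _ _ (fun x => c * f x) g); last exact: cg.
  exact: (@continuousZl_tmp R R^o _ f c x (cf x)).
split.
  move=> x; apply: (@continuousD _ _ _ (fun x => c * f x) g); last exact: cg.
  exact: (@continuousZl_tmp R R^o _ f c x (cf x)).
move=> i; have [d1 c1] := df i; have [d2 c2] := dg i; split.
  move=> x; rewrite (_ : (fun x => _) = (c \*: f) + g)//.
  by apply: derivableD => //; exact: derivableZ.
by rewrite partial_lin//; exact: IH.
Qed.

Lemma CkB k f g : Ck k f -> Ck k g -> Ck k (f \- g).
Proof.
move=> kf kg; rewrite (_ : f \- g = fun x => -1 * g x + f x); first exact: Ck_lin.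
by apply/funext => x /=; rewrite mulN1r addrC.
Qed.

Lemma partialB i f g : (forall x, derivable f x (ei i)) ->
  (forall x, derivable g x (ei i)) ->
  partial i (f \- g) = partial i f \- partial i g.
Proof.
move=> df dg; rewrite (_ : f \- g = fun x => -1 * g x + f x); last first.
  by apply/funext => x /=; rewrite mulN1r addrC.
by rewrite partial_lin//; apply/funext => x /=; rewrite mulN1r addrC.
Qed.

End Ck_linear.

Section closability.
Context {R : realType} {n : nat}.
Local Notation mu := (@lebesgue_rV R n).
Implicit Types (u : 'rV[R]_n -> R) (x : 'rV[R]_n) (i : 'I_n).

Lemma pnorm_shift_le (A B : set 'rV[R]_n) (v : 'rV[R]_n) r u : measurable A -> measurable B ->
  0 < r -> continuous u -> (forall x, A x -> B (x + v)) ->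
  (pnorm mu A r (fun x => u (x + v)%R) <= pnorm mu B r u)%E.
Proof.
move=> mA mB r0 cu AB; apply: gt0_ler_poweR; rewrite ?invr_ge0 ?(ltW r0)//.
- by rewrite in_itv/= integral_powR_ge0 leey.
- by rewrite in_itv/= integral_powR_ge0 leey.
have mu_ : measurable_fun [set: 'rV[R]_n] (fun x => (`|u x| `^ r)%:E).
  by apply: measurable_fun_abs_powR; exact: continuous_measurable_rV.
pose F := ((fun x => (`|u x| `^ r)%:E) \_ B)%E.
have mF : measurable_fun [set: 'rV[R]_n] F.
  by apply/(measurable_restrictT _ mB); exact: measurable_funS mu_.
have F0 x : (0 <= F x)%E by apply: erestrict_ge0 => z _; rewrite lee_fin powR_ge0.
rewrite [leRHS]integral_mkcond -/F -(integral_shift v mF F0) integral_mkcond.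
have mFv : measurable_fun [set: 'rV[R]_n] (fun x => F (x + v)).
  exact: (measurableT_comp mF (measurable_shift v)).
apply: ge0_le_integral => //.
- by move=> x _; apply: erestrict_ge0 => z _; rewrite lee_fin powR_ge0.
- apply/(measurable_restrictT _ mA); apply: (measurable_funS measurableT) => //.
  exact: (measurableT_comp mu_ (measurable_shift v)).
- move=> x _; rewrite patchE; case: ifPn => // /set_mem Ax.
  by rewrite /F patchE mem_set//; exact: AB.
Qed.

(* Fatou's lemma is applied twice to the difference quotients of [f l - f k]:
   first as [k] tends to infinity along a subsequence with [f k] null a.e., then
   as the increment tends to [0]. *)
Lemma partial_closable (A B : set 'rV[R]_n) i (v0 p r m M : R) (f : nat -> 'rV[R]_n -> R) l :
  measurable A -> measurable B -> mu A = m%:E -> 1 <= p -> 1 <= r -> 0 < v0 -> 0 <= M ->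
  (forall x t, A x -> 0 <= t <= v0 -> B (x + t *: ei i)) ->
  (forall k, Ck 1 (f k)) ->
  (forall e, 0 < e -> exists N, forall k, (N <= k)%N -> (pnorm mu B r (f k) <= e%:E)%E) ->
  (forall k, (l <= k)%N -> (pnorm mu B p (partial i (f l \- f k)%R) <= M%:E)%E) ->
  (pnorm mu A p (partial i (f l)) <= M%:E)%E.
Proof.
move=> mA mB Am p1 r1 v00 M0 AB f1 f0 fM.
have p0 : 0 < p by exact: lt_le_trans p1.
have r0 : 0 < r by exact: lt_le_trans r1.
have cf k : continuous (f k) by have [] := Ck1P (f1 k).
have mf k (D : set 'rV[R]_n) : measurable D -> measurable_fun D (f k).
  by move=> mD; exact: continuous_measurable_rV.
have cfv k v : continuous (fun x => f k (x + v)).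
  by move=> x; apply: (@continuous_comp _ _ _ (fun x => x + v) (f k)); [exact: continuous_translate|exact: cf].
have mfv k v : measurable_fun A (fun x => f k (x + v)) by exact: continuous_measurable_rV.
have incr v : 0 < v <= v0 ->
    (pnorm mu A p (fun x => v^-1 * (f l (x + v *: ei i) - f l x))%R <= M%:E)%E.
  move=> /andP[v1 v2].
  pose h k x := f k (x + v *: ei i) - f k x.
  have mh k : measurable_fun A (h k) by apply: measurable_funB => //; exact: mf.
  have h0 e : 0 < e -> exists N, forall k, (N <= k)%N -> (pnorm mu A r (h k) <= e%:E)%E.
    move=> e0; have e20 : 0 < e / 2 by rewrite divr_gt0.
    have [N NP] := f0 _ e20; exists N => k /NP fk.
    have mN : measurable_fun A (fun x => - f k x) by apply: measurable_funN; exact: mf.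
    apply: le_trans (pnorm_triangle mu mA r1 (mfv k (v *: ei i)) mN) _.
    rewrite (splitr e) EFinD; apply: leeD.
      apply: le_trans fk; apply: pnorm_shift_le => // x Ax; apply: AB => //.
      by rewrite (ltW v1).
    apply: le_trans fk; rewrite (@eq_pnorm _ _ _ mu A r _ (f k)) => [|x _]; last by rewrite normrN.
    apply: subset_pnorm => //; [exact: ltW| |exact: mf].
    by move=> x Ax; rewrite -[x]addr0 -(scale0r (ei i)); apply: AB => //; rewrite lexx ltW.
  have [s sk hs] := pnorm_null_subseq mA r1 Am mh h0.
  apply: (pnorm_fatou (f := fun k x => v^-1 * (h l x - h (s (l + k)%N) x))) => //.
  - by move=> k; apply: measurable_funM => //; exact: measurable_funB.
  - by apply: measurable_funM => //; exact: mh.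
  - apply: filterS hs => x + Ax => /(_ Ax) hx.
    apply: cvgM; first exact: cvg_cst.
    rewrite -[X in _ --> X]subr0; apply: cvgB; first exact: cvg_cst.
    by under eq_fun do rewrite addnC; have := hx; rewrite -(cvg_shiftn l).
  move=> k; have sl : (l <= s (l + k))%N by apply: leq_trans (sk _); exact: leq_addr.
  move: sl (fM _ sl); set j := s _ => lj fj.
  rewrite pnormZ//; last exact: measurable_funB.
  rewrite gtr0_norm ?invr_gt0// lee_pdivrMl//.
  have [cw dw cdw] := Ck1P (CkB (f1 l) (f1 j)).
  rewrite -EFinM; apply/pnorm_leP => //; first by rewrite mulr_ge0// ltW.
  have AB' x t : A x -> 0 <= t <= v -> B (x + t *: ei i).
    by move=> Ax /andP[t0 tv]; apply: AB => //; rewrite t0 (le_trans tv).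
  have := @integral_increment_le _ _ (f l \- f j)%R i cw (dw i) (cdw i) A B v p mA mB (ltW v1) p1 AB'.
  have -> : (\int[mu]_(x in A) (`|(f l \- f j)%R (x + v *: ei i)%R - (f l \- f j)%R x| `^ p)%:E =
      \int[mu]_(x in A) (`|h l x - h j x| `^ p)%:E)%E.
    by apply: eq_integral => x _; congr ((powR `|_| _)%:E); rewrite /h /=; ring.
  move/le_trans; apply; rewrite powRM// ?(ltW v1)// [leRHS]EFinM.
  apply: lee_wpmul2l; first by rewrite lee_fin powR_ge0.
  exact/pnorm_leP.
have [_ dl cdl] := Ck1P (f1 l).
apply: (pnorm_fatou (f := fun k x => (v0 / k.+1%:R)^-1 * (f l (x + (v0 / k.+1%:R) *: ei i) - f l x))) => //.
- move=> k; apply: measurable_funM => //; apply: measurable_funB => //; exact: mf.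
- by apply: continuous_measurable_rV => //; exact: cdl.
- apply: aeW => x Ax.
  have := dl i x; rewrite /derivable => /cvg_ex[g gP].
  rewrite /partial /derive (cvg_lim _ gP)//.
  have v_cvg0 : v0 / k.+1%:R @[k --> \oo] --> (0 : R).
    by rewrite -(mulr0 v0); apply: cvgM; [exact: cvg_cst|exact: cvg_harmonic].
  (* The derivative is a limit over the punctured neighbourhoods of 0, so the increments must also
     be nonzero. *)
  have v_cvg : v0 / k.+1%:R @[k --> \oo] --> (0 : R)^'.
    move=> P P0; have := v_cvg0 _ (P0 : nbhs (0 : R) (fun y => y != 0 -> P y)).
    rewrite /= !nbhs_simpl /=; apply: (@filterS _ \oo) => k; apply.
    by rewrite gt_eqF// divr_gt0.
  have := cvg_comp _ _ v_cvg gP; apply: cvg_trans; apply: near_eq_cvg.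
  by apply: nearW => k /=; rewrite [x + _]addrC.
move=> k; apply: incr; rewrite divr_gt0//= ler_pdivrMr// ler_peMr ?ler1n//.
exact: ltW.
Qed.

Lemma normr_le_enorm x : `|x| <= enorm x.
Proof.
have [->|x0] := eqVneq x 0; first by rewrite normr0 enorm_ge0.
have /mx_norm_neq0[[i j]] : mx_norm x != 0 by rewrite -[mx_norm x]/`|x| normr_eq0.
by rewrite -[mx_norm x]/`|x| /= (ord1 i) => ->; exact: coord_le_enorm.
Qed.

Lemma coord_le_normr x i : `|x ord0 i| <= `|x|.
Proof.
rewrite -[`|x|]/(mx_norm x) mx_normrE.
by apply: (le_bigmax _ (fun ij : 'I_1 * 'I_n => `|x ij.1 ij.2|) (ord0, i)).
Qed.

Lemma enorm_le_normr x : enorm x <= n%:R * `|x|.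
Proof.
apply: le_trans (enorm_le_sum x) _.
apply: (@le_trans _ _ (\sum_(j < n) `|x|)).
  by apply: ler_sum => j _; exact: coord_le_normr.
by rewrite sumr_const card_ord mulr_natl.
Qed.

(** Both radii are free here, and they refer to the sup norm, in which a translation by [t *: ei i]
    changes [|x|] by at most [|t|]. *)
Definition sup_annulus a b : set 'rV[R]_n := [set x | a <= `|x| <= b].

Lemma measurable_sup_annulus a b : measurable (sup_annulus a b).
Proof.
have mN : measurable_fun [set: 'rV[R]_n] (fun x : 'rV[R]_n => `|x|).
  by apply: continuous_measurable_rV => // x; exact: norm_continuous.
rewrite (_ : sup_annulus a b = [set: 'rV[R]_n] `&` (fun x : 'rV[R]_n => `|x|) @^-1` `[a, b]).
  by apply: mN.
by rewrite setTI; apply/seteqP; split => x /=; rewrite in_itv.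
Qed.

Lemma enorm_powR_sup_annulus b c : 0 < c -> c <= b -> (0 < n)%N -> forall beta,
  exists2 W, 0 < W & forall x, sup_annulus c b x -> enorm x `^ beta <= W.
Proof.
move=> c0 cb n0 beta.
exists (Num.max 1 ((n%:R * b / c) `^ beta) * c `^ beta) => [|x /andP[x1 x2]].
  by rewrite mulr_gt0 ?powR_gt0// lt_max ltr01.
have n1 : 1 <= n%:R :> R by rewrite ler1n.
apply: powR_between => //.
  rewrite ler_pdivlMr// mul1r (le_trans cb)// ler_peMl//.
  exact: le_trans (ltW c0) cb.
rewrite (le_trans x1 (normr_le_enorm x))/= divfK ?gt_eqF//.
by apply: le_trans (enorm_le_normr x) _; rewrite ler_wpM2l.
Qed.

Lemma pnorm_indic (D : set 'rV[R]_n) q u : q != 0 -> measurable D ->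
  pnorm mu setT q (fun x => \1_D x * u x) = pnorm mu D q u.
Proof.
move=> q0 mD; rewrite /pnorm [in RHS]integral_mkcond; congr (poweR _ _).
apply: eq_integral => x _; rewrite patchE indicE; case: ifPn => xD.
  by rewrite mul1r.
by rewrite mul0r normr0 powR0.
Qed.

Lemma pnorm_unweight q alpha b c : 0 < q -> 0 < c -> c <= b -> (0 < n)%N ->
  exists2 W, 0 < W & forall u, continuous u ->
   (pnorm mu (sup_annulus c b) q u <= W%:E * pnorm mu setT q (radial_weight q alpha \* u)%R)%E.
Proof.
move=> q0 c0 cb n0; have [W W0 WP] := enorm_powR_sup_annulus c0 cb n0 (alpha / q).
have mS := measurable_sup_annulus c b; exists W => // u cu.
have mw (A : set 'rV[R]_n) : measurable A -> measurable_fun A (radial_weight q alpha \* u)%R.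
  move=> mA; apply: measurable_funM; first exact: measurable_wgt.
  exact: continuous_measurable_rV.
apply: (@le_trans _ _ (pnorm mu (sup_annulus c b) q (fun x => W * (radial_weight q alpha \* u)%R x))).
  apply: le_pnorm => //; first exact: ltW.
  - exact: continuous_measurable_rV.
  - by apply: measurable_funM => //; exact: mw.
  move=> x xS; rewrite (normrM W) (normrM (radial_weight q alpha x)) mulrA.
  have x0 : 0 < enorm x.
    by case/andP: xS => x1 _; apply: lt_le_trans (normr_le_enorm x); exact: lt_le_trans x1.
  rewrite -[leLHS]mul1r ler_wpM2r// (gtr0_norm W0) [`|radial_weight q alpha x|]ger0_norm ?powR_ge0//.
  apply: (@le_trans _ _ (enorm x `^ (alpha / q) * radial_weight q alpha x)).
    by rewrite /radial_weight powRDp// mulNr subrr powRr0.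
  by rewrite ler_wpM2r ?powR_ge0//; exact: WP.
rewrite pnormZ ?(gtr0_norm W0)//; last exact: mw.
apply: lee_wpmul2l; first by rewrite lee_fin ltW.
by apply: subset_pnorm => //; [exact: ltW|exact: mw].
Qed.

Lemma sup_annulus_box b c : sup_annulus c b `<=` box (const_mx (- `|b|)) (const_mx (2 * `|b| + 1)).
Proof.
move=> x /andP[_ xb] i; rewrite !mxE.
have := le_trans (coord_le_normr x i) (le_trans xb (ler_norm b)).
by rewrite ler_norml => /andP[h1 h2]; rewrite h1/=; lra.
Qed.

Lemma mu_sup_annulus b c : exists m : R, mu (sup_annulus c b) = m%:E.
Proof.
have pb : pos_sides (const_mx (2 * `|b| + 1) : 'rV[R]_n).
  by move=> i; rewrite mxE ltr_wpDl// mulr_ge0.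
exists (fine (mu (sup_annulus c b))); rewrite fineK// ge0_fin_numE//.
apply: (@le_lt_trans _ _ (mu (box (const_mx (- `|b|)) (const_mx (2 * `|b| + 1))))).
  apply: le_measure; rewrite ?inE; [exact: measurable_sup_annulus|exact: measurable_box|].
  exact: sup_annulus_box.
by rewrite mu_box// ltry.
Qed.

(** * Closability in the weighted norms *)

Section weighted_closability.
Variables (p a r alpha : R) (f : nat -> 'rV[R]_n -> R).
Hypotheses (n0 : (0 < n)%N) (p1 : 1 <= p) (r1 : 1 <= r) (f1 : forall k, Ck 1 (f k)).
Hypothesis f0 : forall e, 0 < e -> exists N, forall k, (N <= k)%N ->
  (pnorm mu setT r (radial_weight r alpha \* f k)%R <= e%:E)%E.
Let w := radial_weight (n := n) p (a * p).
Hypothesis fC : forall e, 0 < e -> exists N, forall k l, (N <= k)%N -> (N <= l)%N ->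
  (pnorm mu setT p (w \* (@enorm R n \o grad (f k \- f l)))%R <= e%:E)%E.

Let p0 : 0 < p. Proof. exact: lt_le_trans p1. Qed.
Let r0 : 0 < r. Proof. exact: lt_le_trans r1. Qed.
Let mw (D : set 'rV[R]_n) : measurable D -> measurable_fun D w.
Proof. exact: measurable_wgt. Qed.

Let mp k i (D : set 'rV[R]_n) : measurable D -> measurable_fun D (partial i (f k)).
Proof. by move=> mD; apply: continuous_measurable_rV => //; have [] := Ck1P (f1 k). Qed.

Let partial_le (D : set 'rV[R]_n) i k l (e : R) : measurable D ->
  (pnorm mu setT p (w \* (@enorm R n \o grad (f k \- f l)))%R <= e%:E)%E ->
  (pnorm mu D p (w \* partial i (f k \- f l))%R <= e%:E)%E.
Proof.
move=> mD; apply: le_trans.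
have f2 := CkB (f1 k) (f1 l); have [_ _ cp] := Ck1P f2.
have m1 (E : set 'rV[R]_n) : measurable E -> measurable_fun E (w \* partial i (f k \- f l))%R.
  by move=> mE; apply: measurable_funM; [exact: mw|exact: continuous_measurable_rV].
apply: (@le_trans _ _ (pnorm mu setT p (w \* partial i (f k \- f l))%R)).
  by apply: subset_pnorm => //; [exact: ltW|exact: m1].
apply: le_pnorm => //; [exact: ltW|exact: m1| |].
  apply: measurable_funM; first exact: mw.
  by apply: continuous_measurable_rV => //; exact: continuous_enorm_grad.
move=> x _; rewrite !normrM ler_wpM2l//.
by rewrite (ger0_norm (enorm_ge0 _)); exact: partial_le_grad.
Qed.

(** Away from the origin both weights can be removed at the price of constants, and
    [partial_closable] applies with a Cauchy tail as its bound. The margin [c / 2] keeps the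
    enlarged annulus away from the origin. *)
Let partial_sup_annulus i c b : 0 < c -> c <= b -> forall e, 0 < e ->
  exists N, forall k, (N <= k)%N -> (pnorm mu (sup_annulus c b) p (partial i (f k)) <= e%:E)%E.
Proof.
move=> c0 cb e e0; pose v0 := c / 2.
have v00 : 0 < v0 by rewrite divr_gt0.
have cb' : v0 <= b + v0 by rewrite lerDr (le_trans (ltW c0)).
have [W W0 WP] := pnorm_unweight (a * p) p0 v00 cb' n0.
have [V V0 VP] := pnorm_unweight alpha r0 v00 cb' n0.
have [m cbm] := mu_sup_annulus b c.
have eW : 0 < e / W by rewrite divr_gt0.
have [N NP] := fC eW; exists N => l Nl.
apply: (@partial_closable (sup_annulus c b) (sup_annulus v0 (b + v0)) i v0 p r m e f) => //.
- exact: measurable_sup_annulus.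
- exact: measurable_sup_annulus.
- exact: ltW.
- move=> x t /andP[x1 x2] /andP[t0 tv].
  have te : `|t *: (ei i : 'rV[R]_n)| <= v0.
    rewrite normrZ (ger0_norm t0) (le_trans _ tv)// ler_piMr//.
    rewrite -[`|_|]/(mx_norm _) mx_normrE; apply/bigmax_leP; split => // z _.
    by rewrite mxE; case: (_ && _); rewrite ?normr1 ?normr0.
  apply/andP; split; last by rewrite (le_trans (ler_normD _ _))// lerD.
  have := lerB_normD x (t *: ei i); rewrite /v0 in te *; lra.
- move=> d d0; have dV : 0 < d / V by rewrite divr_gt0.
  have [K KP] := f0 dV; exists K => k /KP fk.
  have ck : continuous (f k) by have [] := Ck1P (f1 k).
  apply: le_trans (VP _ ck) _; rewrite -[leRHS](_ : V%:E * (d / V)%:E = _)%E.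
    by apply: lee_wpmul2l => //; rewrite lee_fin ltW.
  by rewrite -EFinM mulrC divfK ?gt_eqF.
move=> k lk; have [_ _ cp] := Ck1P (CkB (f1 l) (f1 k)).
apply: le_trans (WP _ (cp i)) _; rewrite -[leRHS](_ : W%:E * (e / W)%:E = _)%E.
  apply: lee_wpmul2l; first by rewrite lee_fin ltW.
  by apply: partial_le => //; apply: NP => //; exact: leq_trans lk.
by rewrite -EFinM mulrC divfK ?gt_eqF.
Qed.

(** The bound [e] is independent of the annulus: the constant [W], which does depend on it,
    multiplies only the derivative of [f l], and this tends to 0 as [l] grows. *)
Let partial_sup_annulus_le i c b k N e : 0 < c -> c <= b -> 0 <= e ->
  (forall l, (N <= l)%N -> (pnorm mu setT p (w \* (@enorm R n \o grad (f k \- f l)))%R <= e%:E)%E) ->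
  (pnorm mu (sup_annulus c b) p (w \* partial i (f k))%R <= e%:E)%E.
Proof.
move=> c0 cb e0 NP; have mS := measurable_sup_annulus c b.
apply/lee_addgt0Pr => d d0.
have [W W0 WP] := enorm_powR_sup_annulus c0 cb n0 (- (a * p) / p).
have dW : 0 < d / W by rewrite divr_gt0.
have [K KP] := partial_sup_annulus i c0 cb dW.
pose l := maxn N K; have lK := KP l (leq_maxr _ _); have lN := NP l (leq_maxl _ _).
have [_ dk _] := Ck1P (f1 k); have [_ dl _] := Ck1P (f1 l).
have -> : (w \* partial i (f k))%R =
    ((w \* partial i (f k \- f l)) \+ (w \* partial i (f l)))%R.
  by apply/funext => x; rewrite partialB//=; ring.
apply: le_trans (pnorm_triangle mu mS p1 _ _) _.
- apply: measurable_funM; first exact: mw.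
  by rewrite partialB//; apply: measurable_funB; exact: mp.
- by apply: measurable_funM; [exact: mw|exact: mp].
apply: leeD; first exact: partial_le.
apply: (@le_trans _ _ (pnorm mu (sup_annulus c b) p (fun x => W * partial i (f l) x))).
  apply: le_pnorm => //; first exact: ltW.
  - by apply: measurable_funM; [exact: mw|exact: mp].
  - by apply: measurable_funM => //; exact: mp.
  move=> x xS; rewrite (normrM W) (normrM (w x)) ler_wpM2r//.
  by rewrite (gtr0_norm W0) ger0_norm ?powR_ge0//; exact: WP.
rewrite pnormZ ?(gtr0_norm W0)//; last exact: mp.
rewrite -[leRHS](_ : W%:E * (d / W)%:E = _)%E.
  by apply: lee_wpmul2l => //; rewrite lee_fin ltW.
by rewrite -EFinM mulrC divfK ?gt_eqF.
Qed.

(** The annuli exhaust the complement of the origin, a null set; the bound is uniform, so Fatou's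
    lemma carries it over whatever the weight does at 0. *)
Let partial_le_all i k N e : 0 <= e ->
  (forall l, (N <= l)%N -> (pnorm mu setT p (w \* (@enorm R n \o grad (f k \- f l)))%R <= e%:E)%E) ->
  (pnorm mu setT p (w \* partial i (f k))%R <= e%:E)%E.
Proof.
move=> e0 NP.
pose S m := sup_annulus (m.+1%:R^-1) (m.+1%:R).
have mwp (D : set 'rV[R]_n) : measurable D -> measurable_fun D (w \* partial i (f k))%R.
  by move=> mD; apply: measurable_funM; [exact: mw|exact: mp].
apply: (@pnorm_fatou _ _ _ mu setT p (fun m x => \1_(S m) x * (w \* partial i (f k))%R x)) => //.
- move=> m; apply: measurable_funM; last exact: mwp.
  by apply: measurable_indic; exact: measurable_sup_annulus.
- exact: mwp.
- exists [set 0]; split; [exact: measurable_origin|exact: lebesgue_rV_origin|].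
  move=> x /=; apply: contra_notP => x0 _.
  apply: cvg_near_cst; near=> m; rewrite indicE mem_set ?mul1r//.
  have xn0 : 0 < `|x| by rewrite normr_gt0; exact/eqP.
  have m1 : `|x|^-1 <= m%:R by near: m; exact: nbhs_infty_ger.
  have m2 : `|x| <= m%:R by near: m; exact: nbhs_infty_ger.
  have mm : m%:R <= m.+1%:R :> R by rewrite ler_nat.
  apply/andP; split; last exact: le_trans mm.
  by rewrite invf_ple ?posrE//; exact: le_trans mm.
move=> m; rewrite pnorm_indic ?gt_eqF//; last exact: measurable_sup_annulus.
apply: partial_sup_annulus_le NP => //.
by rewrite (@le_trans _ _ 1)// ?invf_le1// ler1n.
Unshelve. all: by end_near.
Qed.

Lemma gradient_closable e : 0 < e -> exists N, forall k, (N <= k)%N ->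
  (pnorm mu setT p (w \* (@enorm R n \o grad (f k)))%R <= e%:E)%E.
Proof.
move=> e0; have nn0 : 0 < n%:R :> R by rewrite ltr0n.
have en0 : 0 < e / n%:R by rewrite divr_gt0.
have [N NP] := fC en0; exists N => k Nk.
have H i : (pnorm mu setT p (w \* partial i (f k))%R <= (e / n%:R)%:E)%E.
  apply: (@partial_le_all i k N); first exact: ltW.
  by move=> l Nl; exact: NP.
have mwp i : measurable_fun setT (w \* partial i (f k))%R.
  by apply: measurable_funM; [exact: mw|exact: mp].
have mwn i : measurable_fun setT (fun x => `|(w \* partial i (f k))%R x|).
  exact: measurableT_comp.
apply: (@le_trans _ _ (pnorm mu setT p (fun x => \sum_i `|(w \* partial i (f k))%R x|))).
  apply: le_pnorm => //; first exact: ltW.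
  - apply: measurable_funM; first exact: mw.
    by apply: continuous_measurable_rV => //; exact: continuous_enorm_grad.
  - exact: measurable_sum.
  move=> x _; rewrite [leRHS]ger0_norm; last exact: sumr_ge0.
  rewrite normrM (ger0_norm (enorm_ge0 _)).
  apply: (@le_trans _ _ (`|w x| * \sum_i `|grad (f k) x ord0 i|)).
    by rewrite ler_wpM2l// enorm_le_sum.
  by rewrite mulr_sumr; apply: ler_sum => i _; rewrite mxE normrM.
apply: le_trans (pnorm_sum mu _ (F := fun i x => `|(w \* partial i (f k))%R x|) _ p1 mwn) _ => //.
apply: (@le_trans _ _ (\sum_(i < n) (e / n%:R)%:E)%E).
  apply: lee_sum => i _; apply: le_trans (H i).
  by rewrite (@eq_pnorm _ _ _ mu setT p _ (w \* partial i (f k))%R) => // x _; rewrite normr_id.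
rewrite sumEFin lee_fin sumr_const card_ord -[leLHS]mulr_natr divfK//.
by rewrite gt_eqF.
Qed.

End weighted_closability.
End closability.

(** * The imbedding *)

Section pnorm_ae.
Context d (T : measurableType d) (R : realType) (mu : {measure set T -> \bar R}).

Lemma pnorm_ae_eq D r (f g : T -> R) : measurable D -> measurable_fun D f ->
  measurable_fun D g -> (\forall x \ae mu, D x -> f x = g x) ->
  pnorm mu D r f = pnorm mu D r g.
Proof.
move=> mD mf mg fg; congr (poweR _ _); apply: ae_eq_integral => //.
- exact: measurable_fun_abs_powR.
- exact: measurable_fun_abs_powR.
- by apply: filterS fg => x + Dx => /(_ Dx) ->.
Qed.

Lemma pnorm_ae_eq0 D r (f : T -> R) : measurable D -> measurable_fun D f -> 0 < r ->
  (pnorm mu D r f <= 0)%E -> \forall x \ae mu, D x -> f x = 0.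
Proof.
move=> mD mf r0 /(pnorm_leP _ _ _ r0 (lexx 0)); rewrite powR0 ?gt_eqF// => I0.
have mF : measurable_fun D (fun x => (`|f x| `^ r)%:E) by exact: measurable_fun_abs_powR.
have : (\int[mu]_(x in D) `|(`|f x| `^ r)%:E| = 0)%E.
  apply/eqP; rewrite eq_le integral_ge0// andbT; apply: le_trans I0.
  rewrite le_eqVlt; apply/orP; left; apply/eqP; apply: eq_integral => x _.
  by rewrite gee0_abs// lee_fin powR_ge0.
move/(ae_eq_integral_abs mu mD mF); apply: filterS => x + Dx => /(_ Dx)[].
by move/powR_eq0_eq0 => /normr0_eq0.
Qed.

End pnorm_ae.

(** * Test functions *)

Section C0infty_theory.
Context {R : realType} {n : nat}.
Implicit Types (Omega : set 'rV[R]_n) (f g : 'rV[R]_n -> R).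

Lemma C0infty_out Omega f x : C0infty Omega f -> ~ Omega x -> f x = 0.
Proof.
move=> [_ _ fO] Ox; apply: contra_notP Ox => /eqP fx.
exact/fO/subset_closure.
Qed.

(** Outside [Omega] the point has a neighbourhood, the complement of the support, on which [f]
    vanishes identically. *)
Lemma C0infty_grad_out Omega f x : C0infty Omega f -> ~ Omega x -> grad f x = 0.
Proof.
move=> [_ _ fO] Ox; apply/rowP => i; rewrite !mxE /partial.
rewrite (@near_eq_derive _ _ _ f (fun=> 0 : R) x); first exact: derive_cst.
have : nbhs x (~` closure [set x | f x != 0]).
  apply: open_nbhs_nbhs; split; last by move=> /fO.
  by rewrite openC; exact: closed_closure.
apply: filterS => y fy; apply/eqP; rewrite -[_ == _]negbK.
by apply/negP => fy0; apply: fy; exact: subset_closure.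
Qed.

Lemma C0infty_lin Omega c f g : C0infty Omega f -> C0infty Omega g ->
  C0infty Omega (fun x => c * f x + g x).
Proof.
move=> [f1 f2 f3] [g1 g2 g3].
have sub : closure [set x | c * f x + g x != 0] `<=`
    closure [set x | f x != 0] `|` closure [set x | g x != 0].
  rewrite -closureU; apply: closure_subset => x /=.
  by apply: contra_neqP => /not_orP[/negP/negPn/eqP -> /negP/negPn/eqP ->]; rewrite mulr0 addr0.
split.
- by move=> k; exact: Ck_lin.
- apply: subclosed_compact sub; first exact: closed_closure.
  exact: compactU.
- by move=> x /sub[/f3|/g3].
Qed.

Lemma Ck_cst0 k : Ck k (fun=> 0 : R) (n := n).
Proof.
elim: k => [|k IH]; first by split => // x; exact: cst_continuous.
split => [x|i]; first exact: cst_continuous.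
split => [x|]; first exact: derivable_cst.
rewrite (_ : partial i _ = fun=> 0)//.
by apply/funext => x; rewrite /partial derive_cst.
Qed.

Lemma C0infty0 Omega : C0infty Omega (fun=> 0).
Proof.
have s0 : [set x | (fun=> 0 : R) x != 0] = set0 :> set 'rV[R]_n.
  by apply/seteqP; split => x //=; rewrite eqxx.
split; first exact: Ck_cst0.
- by rewrite s0 closure0; exact: compact0.
- by rewrite s0 closure0.
Qed.

Lemma C0inftyB Omega f g : C0infty Omega f -> C0infty Omega g -> C0infty Omega (f \- g).
Proof.
move=> fO gO; rewrite (_ : f \- g = fun x => -1 * g x + f x); first exact: C0infty_lin.
by apply/funext => x /=; rewrite mulN1r addrC.
Qed.

Lemma wLnormE Omega r alpha f : r != 0 ->
  wLnorm Omega r alpha f = pnorm (lebesgue_rV n) Omega r (radial_weight r alpha \* f)%R.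
Proof.
move=> r0; congr (poweR _ _); apply: eq_integral => x _.
by rewrite normrM (ger0_norm (powR_ge0 _ _)) powRM ?powR_ge0// -powRrM divfK.
Qed.

End C0infty_theory.

(** * Extension to the completion *)

Section imbedding.
Context {R : realType} {n : nat}.
Variables (Omega : set 'rV[R]_n) (p a r alpha : R).
Variables (D : completeNormedModType R) (j : ('rV[R]_n -> R) -> D).
Hypotheses (Omega_open : open Omega) (Omega_bounded : bounded_set Omega).
Hypotheses (p_gt1 : 1 < p) (p_ltn : p < n%:R) (a_lt : a < (n%:R - p) / p)
  (r_ge1 : 1 <= r) (r_lt : r < n%:R * p / (n%:R - p))
  (alpha_lt : alpha < (1 + a) * r + n%:R * (1 - r / p)).
Hypothesis Dj : is_D1p_completion Omega a p j.
Local Notation mu := (@lebesgue_rV R n).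
Local Notation w := (radial_weight (n := n) r alpha).
Local Notation egrad u := (@enorm R n \o grad u).
Implicit Types (f g t : 'rV[R]_n -> R).

Let p1 : 1 <= p. Proof. exact: ltW. Qed.
Let p0 : 0 < p. Proof. exact: lt_le_trans p1. Qed.
Let r0 : 0 < r. Proof. exact: lt_le_trans r_ge1. Qed.
Let n0 : (0 < n)%N.
Proof. by rewrite -(ltr_nat R); exact: lt_trans p_ltn. Qed.

Let mO : measurable Omega. Proof. exact: open_measurable_rV. Qed.

Let Omega_le : exists2 L, 0 < L & forall x, Omega x -> `|x| < L.
Proof. by have [L L0 LP] := ex_strict_bound_gt0 Omega_bounded; exists L. Qed.

Let mu_Omega : exists m : R, mu Omega = m%:E.
Proof.
have [L L0 LP] := Omega_le; have [m mP] := @mu_sup_annulus R n L 0.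
exists (fine (mu Omega)); rewrite fineK// ge0_fin_numE//.
apply: (@le_lt_trans _ _ (mu (sup_annulus 0 L))); last by rewrite mP ltry.
apply: le_measure; rewrite ?inE//; first exact: measurable_sup_annulus.
by move=> x /LP xL; apply/andP; split => //; exact: ltW.
Qed.

Let wgt_gt0 x : x <> 0 -> 0 < w x.
Proof.
move=> /eqP x0; apply: powR_gt0; apply: lt_le_trans (normr_le_enorm x).
by rewrite normr_gt0.
Qed.

Let ae_neq0 (P : set 'rV[R]_n) : (forall x, x <> 0 -> P x) -> \forall x \ae mu, P x.
Proof.
move=> xP; exists [set 0]; split; [exact: measurable_origin|exact: lebesgue_rV_origin|].
by move=> x /=; apply: contra_notP; exact: xP.
Qed.

Let mw f : measurable_fun Omega f -> measurable_fun Omega (w \* f)%R.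
Proof. by move=> mf; apply: measurable_funM => //; exact: measurable_wgt. Qed.

Let mC f : C0infty Omega f -> measurable_fun Omega f.
Proof. by move=> [/(_ 0) []] cf _ _ _; exact: continuous_measurable_rV. Qed.

Let jB f g : C0infty Omega f -> C0infty Omega g -> j (f \- g) = j f - j g.
Proof.
move=> fO gO; have [jl _ _] := Dj.
rewrite (_ : f \- g = fun x => -1 * g x + f x); first by rewrite jl// scaleN1r addrC.
by apply/funext => x /=; rewrite mulN1r addrC.
Qed.

Let j0 : j (fun=> 0) = 0.
Proof.
rewrite (_ : (fun=> 0) = (fun=> 0) \- (fun=> 0)); last by apply/funext => x /=; rewrite subrr.
by rewrite jB ?subrr//; exact: C0infty0.
Qed.

Let jdense v e : 0 < e -> exists2 f, C0infty Omega f & `|v - j f| < e.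
Proof.
move=> e0; have [_ _ dj] := Dj.
have ve : (ball v e !=set0) by exists v; exact: ballxx.
have vo : open (ball v e) by exact: ball_open.
have [y [vf [f fO fE]]] := dj _ ve vo.
by exists f => //; move: vf; rewrite -fE -ball_normE.
Qed.

Let pnorm_out q f : q != 0 -> (forall x, ~ Omega x -> f x = 0) ->
  pnorm mu setT q f = pnorm mu Omega q f.
Proof.
move=> q0 f0; rewrite -(pnorm_indic f q0 mO); apply: eq_pnorm => x _.
rewrite indicE; have [xO|xO] := boolP (x \in Omega); first by rewrite mul1r.
by rewrite f0 ?mulr0// => /mem_set; apply/negP.
Qed.

Let Dnorm_setT f : C0infty Omega f ->
  pnorm mu setT p (radial_weight (n := n) p (a * p) \* egrad f)%R = `|j f|%:E.
Proof.
move=> fO; have [_ jn _] := Dj; rewrite (jn _ fO) /Dnorm wLnormE ?gt_eqF//.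
apply: pnorm_out; first by rewrite gt_eqF.
move=> x xO; rewrite /= (C0infty_grad_out fO xO).
by rewrite /enorm big1 ?sqrtr0 ?mulr0// => i _; rewrite mxE expr0n.
Qed.

Let energy_C0infty L f : (forall x, Omega x -> `|x| < L) -> C0infty Omega f ->
  energy_bounded p a L f `|j f|.
Proof.
move=> LP fO; split => //; first by have [] := fO.
  move=> x i xL; apply: (C0infty_out fO) => /LP; apply/negP; rewrite -leNgt.
  exact: le_trans (coord_le_normr x i).
have := Dnorm_setT fO => /eqP; rewrite eq_le => /andP[/(pnorm_leP _ _ _ p0 (normr_ge0 _)) + _].
congr (_ <= _)%E; apply: eq_integral => x _.
rewrite normrM (ger0_norm (powR_ge0 _ _)) powRM ?powR_ge0// -powRrM.
by rewrite divfK ?gt_eqF//= ger0_norm ?enorm_ge0.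
Qed.

Let energy_le_le L f N M : N <= M -> energy_bounded p a L f N -> energy_bounded p a L f M.
Proof.
move=> NM [f1 fL N0 fN]; split => //; first exact: le_trans NM.
by apply: le_trans fN _; rewrite lee_fin ge0_ler_powR ?nnegrE// ?(ltW p0)// (le_trans N0).
Qed.

Let pnorm_wgtB f g t : measurable_fun Omega f -> measurable_fun Omega g ->
  measurable_fun Omega t ->
  (pnorm mu Omega r (w \* (f \- g))%R <=
   pnorm mu Omega r (w \* (f \- t))%R + pnorm mu Omega r (w \* (t \- g))%R)%E.
Proof.
move=> mf mg mt.
rewrite (_ : (w \* (f \- g))%R = ((w \* (f \- t)) \+ (w \* (t \- g)))%R).
  by apply: pnorm_triangle => //; apply: mw; exact: measurable_funB.
by apply/funext => x /=; ring.
Qed.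

Let pnorm_wgtC f g : pnorm mu Omega r (w \* (f \- g))%R = pnorm mu Omega r (w \* (g \- f))%R.
Proof. by apply: eq_pnorm => x _; rewrite /= !normrM distrC. Qed.

Let pnorm_wgt_ae f g : measurable_fun Omega f -> measurable_fun Omega g ->
  (pnorm mu Omega r (w \* (f \- g))%R <= 0)%E -> ae_eq mu Omega f g.
Proof.
move=> mf mg /(pnorm_ae_eq0 mO (mw (measurable_funB mf mg)) r0) fg.
(* The weight can be cancelled only off the origin: there it is positive, whereas at 0 the value of
   [powR] makes it vanish unless [alpha = 0]. *)
have x0 : \forall x \ae mu, x <> 0 by exact: ae_neq0.
apply: filterS2 fg x0 => x + x0 Ox => /(_ Ox) /eqP.
rewrite mulf_eq0 gt_eqF ?wgt_gt0//= subr_eq0.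
by move/eqP.
Qed.

(** Multiplication by the weight carries the problem to the plain L^r norm on [Omega]; the limit
    found there is divided by the weight, which is legitimate off the origin. *)
Let weighted_complete (f : nat -> 'rV[R]_n -> R) : (forall k, measurable_fun Omega (f k)) ->
  (forall e, 0 < e -> exists N, forall k l, (N <= k)%N -> (N <= l)%N ->
     (pnorm mu Omega r (w \* (f k \- f l))%R <= e%:E)%E) ->
  exists2 t, measurable_fun Omega t & forall e, 0 < e -> exists N, forall k, (N <= k)%N ->
     (pnorm mu Omega r (w \* (f k \- t))%R <= e%:E)%E.
Proof.
move=> mf fC; have [m mP] := mu_Omega.
have [||g mg gP] := @pnorm_complete _ _ _ mu Omega r (fun k => w \* f k)%R m mO mP r_ge1.
- by move=> k; exact: mw.
- move=> e /fC[N NP]; exists N => k l Nk Nl.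
  rewrite (_ : (_ \- _)%R = (w \* (f k \- f l))%R); first exact: NP.
  by apply/funext => x /=; ring.
have mt : measurable_fun Omega (fun x => enorm x `^ (alpha / r) * g x).
  by apply: measurable_funM => //; exact: measurable_enorm_powR.
exists (fun x => enorm x `^ (alpha / r) * g x) => // e /gP[N NP]; exists N => k /NP.
rewrite (@pnorm_ae_eq _ _ _ mu Omega r _ (w \* (f k \- (fun x => enorm x `^ (alpha / r) * g x)))%R)//.
- by apply: measurable_funB => //; exact: mw.
- by apply: mw; exact: measurable_funB.
apply: ae_neq0 => x /eqP x0 _ /=; rewrite mulrBr mulrA /radial_weight powRDp.
  by rewrite -mulrDl addNr mul0r powRr0 mul1r.
by apply: lt_le_trans (normr_le_enorm x); rewrite normr_gt0.
Qed.

Lemma embedding_C0infty : exists2 C, 0 <= C & forall f g, C0infty Omega f -> C0infty Omega g ->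
  (pnorm mu Omega r (w \* (f \- g))%R <= (C * `|j f - j g|)%:E)%E.
Proof.
have [L L0 LP] := Omega_le.
have [C C0 CP] := weighted_embedding p1 p_ltn r_ge1 r_lt a_lt L0 alpha_lt.
exists C => // f g fO gO; have fgO := C0inftyB fO gO.
rewrite -(jB fO gO); apply: le_trans (CP _ _ (energy_C0infty LP fgO)).
apply: subset_pnorm => //; first exact: ltW.
apply: measurable_funM; first exact: measurable_wgt.
by have [/(_ 0) []] := fgO => cf _ _ _; exact: continuous_measurable_rV.
Qed.

(* The inequality for all [f] determines [t] a.e.; linearity, continuity and
   compactness all follow from it. *)
Lemma extension_exists C : (forall f g, C0infty Omega f -> C0infty Omega g ->
    (pnorm mu Omega r (w \* (f \- g))%R <= (C * `|j f - j g|)%:E)%E) -> 0 <= C ->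
  forall v, exists t, measurable_fun Omega t /\ forall f, C0infty Omega f ->
   (pnorm mu Omega r (w \* (f \- t))%R <= (C * `|j f - v|)%:E)%E.
Proof.
move=> CP C0 v.
have /choice[f fP] (k : nat) : exists f, C0infty Omega f /\ `|v - j f| < k.+1%:R^-1.
  by have [|f fO fv] := @jdense v k.+1%:R^-1; [rewrite invr_gt0|exists f].
have fO k : C0infty Omega (f k) by have [] := fP k.
have jf : j (f k) @[k --> \oo] --> v.
  apply/cvgrPdist_le => e e0; near=> k; apply/ltW; have [_] := fP k.
  move/lt_trans; apply; near: k; exact: near_infty_natSinv_lt (PosNum e0).
have [||t mt tP] := weighted_complete (f := f).
- by move=> k; exact: mC.
- move=> e e0.
  have d0 : 0 < e / 2 / (C + 1) by rewrite !divr_gt0// ltr_wpDl.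
  have /cvgrPdist_le/(_ _ d0)[K _ KP] := jf; exists K => k l Kk Kl.
  apply: le_trans (CP _ _ (fO k) (fO l)) _; rewrite lee_fin.
  apply: (@le_trans _ _ ((C + 1) * (e / 2 / (C + 1) + e / 2 / (C + 1)))).
    apply: ler_pM => //; first by rewrite lerDl.
    rewrite -(subrKA v); apply: le_trans (ler_normD _ _) _.
    by rewrite (distrC (j (f k))); apply: lerD; exact: KP.
  by rewrite -mulrDl -splitr mulrC divfK// gt_eqF// ltr_wpDl.
exists t; split => // g gO; apply/lee_addgt0Pr => e e0.
have e20 : 0 < e / 2 by rewrite divr_gt0.
have [N NP] := tP _ e20.
have d0 : 0 < e / 2 / (C + 1) by rewrite divr_gt0// ltr_wpDl.
have /cvgrPdist_le/(_ _ d0)[K _ KP] := jf.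
pose k := maxn N K.
apply: le_trans (pnorm_wgtB (mC gO) mt (mC (fO k))) _.
apply: le_trans (leeD (CP _ _ gO (fO k)) (NP k (leq_maxl _ _))) _.
rewrite -!EFinD lee_fin [e in leRHS]splitr addrA lerD2r.
have := KP k (leq_maxr _ _) => /= vk.
apply: (@le_trans _ _ (C * (`|j g - v| + `|v - j (f k)|))).
  by apply: ler_wpM2l => //; rewrite -[j g - _](subrKA v) ler_normD.
rewrite mulrDr lerD2l; apply: (@le_trans _ _ ((C + 1) * (e / 2 / (C + 1)))).
  by apply: ler_pM => //; rewrite lerDl.
by rewrite mulrC divfK// gt_eqF// ltr_wpDl.
Unshelve. all: by end_near.
Qed.


Let wLnorm_sub0 f : wLnorm Omega r alpha f = pnorm mu Omega r (w \* (f \- (fun=> 0%R)))%R.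
Proof.
rewrite wLnormE ?gt_eqF// (_ : (w \* (f \- (fun=> 0%R)))%R = (w \* f)%R)//.
by apply/funext => x; rewrite /= subr0.
Qed.

Let wLnorm_imbedding_le C v t : (forall f, C0infty Omega f ->
   (pnorm mu Omega r (w \* (f \- t))%R <= (C * `|j f - v|)%:E)%E) ->
  (wLnorm Omega r alpha t <= (C * `|v|)%:E)%E.
Proof.
move=> /(_ _ (C0infty0 Omega)); rewrite j0 sub0r normrN; apply: le_trans.
by rewrite wLnorm_sub0 pnorm_wgtC.
Qed.

(** Each [v k] is replaced by a test function [f k] at distance less than [1 / (k + 1)];
    [weighted_compact] is applied to these, and the error between [T (v k)] and [f k] tends to 0. *)
Lemma extension_is_compact C (T : D -> 'rV[R]_n -> R) : 0 <= C ->
  (forall v, measurable_fun Omega (T v) /\ forall f, C0infty Omega f ->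
   (pnorm mu Omega r (w \* (f \- T v))%R <= (C * `|j f - v|)%:E)%E) ->
  is_compact_map Omega r alpha T.
Proof.
move=> C0 TP v v_bounded.
have [B B0 BP] := ex_strict_bound_gt0 v_bounded.
have vB k : `|v k| < B by apply: BP; exists k.
have /choice[f fP] (k : nat) : exists f, C0infty Omega f /\ `|v k - j f| < k.+1%:R^-1.
  by have [|f fO fv] := @jdense (v k) k.+1%:R^-1; [rewrite invr_gt0|exists f].
have fO k : C0infty Omega (f k) by have [] := fP k.
have jfB k : `|j (f k)| <= B + 1.
  rewrite -[j _](subKr (v k)); apply: le_trans (ler_normB _ _) _.
  apply: lerD; first exact: ltW.
  by have [_ /ltW h] := fP k; apply: le_trans h _; rewrite invf_le1// ler1n.
have [L L0 LP] := Omega_le.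
have BB0 : 0 <= 2 * (B + 1) by rewrite mulr_ge0// addr_ge0// ltW.
have fN k l : energy_bounded p a L (f k \- f l) (2 * (B + 1)).
  apply: energy_le_le (energy_C0infty LP (C0inftyB (fO k) (fO l))).
  by rewrite jB// mulr_natl mulr2n (le_trans (ler_normB _ _))// lerD.
have [sigma s_incr sP] := weighted_compact p1 p_ltn r_ge1 r_lt a_lt L0 alpha_lt BB0 fN.
have mf k : measurable_fun Omega (f (sigma k)) by exact: mC.
have sPO k l : (k <= l)%N ->
    (pnorm mu Omega r (w \* (f (sigma k) \- f (sigma l)))%R <= (k.+1%:R^-1)%:E)%E.
  move=> /sP; apply: le_trans; apply: subset_pnorm => //; first exact: ltW.
  apply: measurable_funM; first exact: measurable_wgt.
  have [/(_ 0) [] cf _ _ _] := C0inftyB (fO (sigma k)) (fO (sigma l)).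
  exact: continuous_measurable_rV.
have [||t mt tP] := weighted_complete (f := fun k => f (sigma k)) => //.
  move=> e e0; have [N _ NP] := near_infty_natSinv_lt (PosNum e0).
  exists N => k l Nk Nl; have [kl|lk] := leqP k l.
    by apply: le_trans (sPO _ _ kl) _; rewrite lee_fin; exact/ltW/NP.
  rewrite pnorm_wgtC; apply: le_trans (sPO _ _ (ltnW lk)) _.
  by rewrite lee_fin; exact/ltW/NP.
have mT u : measurable_fun Omega (T u) by have [] := TP u.
have dist e : 0 < e -> exists N, forall k, (N <= k)%N ->
    (wLnorm Omega r alpha (T (v (sigma k)) \- t)%R <= e%:E)%E.
  move=> e0; have e20 : 0 < e / 2 by rewrite divr_gt0.
  have [N NP] := tP _ e20.
  have d0 : 0 < e / 2 / (C + 1) by rewrite divr_gt0// ltr_wpDl.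
  have [K _ KP] := near_infty_natSinv_lt (PosNum d0).
  exists (maxn N K) => k; rewrite geq_max => /andP[Nk Kk].
  rewrite wLnormE ?gt_eqF//; apply: le_trans (pnorm_wgtB (mT _) mt (mf k)) _.
  rewrite [e in leRHS]splitr EFinD; apply: leeD; last exact: NP.
  rewrite pnorm_wgtC; have [_ /(_ _ (fO (sigma k)))] := TP (v (sigma k)).
  move/le_trans; apply; rewrite lee_fin.
  apply: (@le_trans _ _ ((C + 1) * (e / 2 / (C + 1)))).
    apply: ler_pM => //; first by rewrite lerDl.
    rewrite distrC; have [_ /ltW h] := fP (sigma k); apply: le_trans h _.
    apply/ltW/KP; apply: leq_trans Kk _.
    (* A strictly increasing [sigma] satisfies [k <= sigma k]. *)
    elim: k {Nk} => [//|k IH]; exact: leq_ltn_trans IH (s_incr _ _ (ltnSn k)).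
  by rewrite mulrC divfK// gt_eqF// ltr_wpDl.
exists sigma, t; split => //.
- split => //; have [N /(_ N (leqnn N))] := dist 1 ltr01.
  rewrite wLnormE ?gt_eqF// pnorm_wgtC => tN.
  have m0 : measurable_fun Omega (fun=> 0 : R) by exact: measurable_cst.
  rewrite wLnorm_sub0; apply: le_lt_trans (pnorm_wgtB mt m0 (mT (v (sigma N)))) _.
  rewrite -wLnorm_sub0 lte_add_pinfty//; first exact: le_lt_trans tN (ltry _).
  have [_ /wLnorm_imbedding_le h] := TP (v (sigma N)); exact: le_lt_trans h (ltry _).
- have fin k e : (wLnorm Omega r alpha (T (v (sigma k)) \- t)%R <= e%:E)%E ->
      wLnorm Omega r alpha (T (v (sigma k)) \- t)%R \is a fin_num.
    move=> h; rewrite ge0_fin_numE ?poweR_ge0//; exact: le_lt_trans h (ltry _).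
  apply/fine_cvgP; split.
    by have [N NP] := dist 1 ltr01; exists N => // k /NP; exact: fin.
  apply/cvgrPdist_le => e /dist[N NP]; exists N => // k /NP kN /=.
  rewrite sub0r normrN ger0_norm; last by rewrite fine_ge0// poweR_ge0.
  by rewrite -lee_fin fineK// (fin k e).
Qed.

Lemma extension_is_imbedding C (T : D -> 'rV[R]_n -> R) : 0 <= C ->
  (forall v, measurable_fun Omega (T v) /\ forall f, C0infty Omega f ->
   (pnorm mu Omega r (w \* (f \- T v))%R <= (C * `|j f - v|)%:E)%E) ->
  is_imbedding Omega r alpha j T.
Proof.
move=> C0 TP.
have mT u : measurable_fun Omega (T u) by have [] := TP u.
have TP' u f : C0infty Omega f -> (pnorm mu Omega r (w \* (f \- T u))%R <= (C * `|j f - u|)%:E)%E.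
  by have [_] := TP u; exact.
have Tle v : (wLnorm Omega r alpha (T v) <= (C * `|v|)%:E)%E.
  by have [_] := TP v; exact: wLnorm_imbedding_le.
have T_lin c v u : ae_eq mu Omega (T (c *: v + u)) (fun x => c * T v x + T u x).
  have mcT : measurable_fun Omega (fun x => c * T v x + T u x).
    by apply: measurable_funD => //; exact: measurable_funM.
  apply: pnorm_wgt_ae => //; apply/lee_addgt0Pr => e e0; rewrite add0e.
  (* If [v] and [u] are approximated within [e / K], the errors of both sides add up to
     [(K - 1) * (e / K)]; the final 1 keeps [K] positive when [C = 0]. *)
  pose K := C * (2 * `|c| + 2) + 1.
  have K0 : 0 < K by rewrite ltr_wpDl// mulr_ge0// addr_ge0// mulr_ge0.
  have d0 : 0 < e / K by rewrite divr_gt0.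
  have [f fO fv] := jdense v d0; have [g gO gu] := jdense u d0.
  have hO := C0infty_lin c fO gO.
  have dc : `|c| * `|j f - v| <= `|c| * (e / K) by rewrite ler_wpM2l// distrC ltW.
  apply: le_trans (pnorm_wgtB (mT _) mcT (mC hO)) _.
  have h1 : (pnorm mu Omega r (w \* (T (c *: v + u) \- (fun x => c * f x + g x)))%R <=
      (C * (`|c| * (e / K) + e / K))%:E)%E.
    rewrite pnorm_wgtC; apply: le_trans (TP' _ _ hO) _; rewrite lee_fin ler_wpM2l//.
    have [jl _ _] := Dj; rewrite jl// opprD addrACA -scalerBr.
    apply: le_trans (ler_normD _ _) _; rewrite normrZ lerD//.
    by rewrite distrC ltW.
  have h2 : (pnorm mu Omega r (w \* ((fun x => c * f x + g x) \- (fun x => c * T v x + T u x)))%R <=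
      (C * (`|c| * (e / K) + e / K))%:E)%E.
    have -> : (w \* ((fun x => c * f x + g x) \- (fun x => c * T v x + T u x)))%R =
        ((fun x => c * (w \* (f \- T v))%R x) \+ (w \* (g \- T u)))%R.
      by apply/funext => x /=; ring.
    have mf1 : measurable_fun Omega (w \* (f \- T v))%R.
      by apply: mw; apply: measurable_funB => //; exact: mC.
    have mg1 : measurable_fun Omega (w \* (g \- T u))%R.
      by apply: mw; apply: measurable_funB => //; exact: mC.
    have mcf1 : measurable_fun Omega (fun x => c * (w \* (f \- T v))%R x).
      exact: measurable_funM.
    apply: le_trans (pnorm_triangle mu mO r_ge1 mcf1 mg1) _.
    rewrite pnormZ// mulrDr EFinD; apply: leeD.
      rewrite mulrCA EFinM; apply: lee_wpmul2l; first by rewrite lee_fin.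
      by apply: le_trans (TP' _ _ fO) _; rewrite lee_fin ler_wpM2l// distrC ltW.
    by apply: le_trans (TP' _ _ gO) _; rewrite lee_fin ler_wpM2l// distrC ltW.
  apply: le_trans (leeD h1 h2) _; rewrite -EFinD lee_fin.
  have -> : C * (`|c| * (e / K) + e / K) + C * (`|c| * (e / K) + e / K) =
      (K - 1) * (e / K) by rewrite /K; ring.
  by rewrite mulrBl mul1r [K * _]mulrC divfK ?gt_eqF// gerBl ltW.
split => //.
- by move=> v; split => //; exact: le_lt_trans (Tle v) (ltry _).
- move=> f fO; apply: pnorm_wgt_ae => //; first exact: mC.
  by rewrite pnorm_wgtC; apply: le_trans (TP' _ _ fO) _; rewrite subrr normr0 mulr0.
(* Test functions [f k] that approximate [z] in [D] tend to [T z = 0] in the weighted L^r, and their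
   gradients are Cauchy. By closability the gradients tend to 0, that is, the norms of [j (f k)] do,
   so [z = 0]. *)
- move=> v u vu; apply/eqP; rewrite -subr_eq0; set z := v - u.
  have Tz0 : \forall x \ae mu, Omega x -> T z x = 0.
    have := T_lin 1 z u; rewrite scale1r subrK => h.
    apply: filterS2 vu h => x vux hx Ox; move: (hx Ox); rewrite mul1r (vux Ox).
    by move/eqP; rewrite -subr_eq subrr => /eqP.
  have /choice[f fP] (k : nat) : exists f, C0infty Omega f /\ `|z - j f| < k.+1%:R^-1.
    by have [|f fO fz] := @jdense z k.+1%:R^-1; [rewrite invr_gt0|exists f].
  have fO k : C0infty Omega (f k) by have [] := fP k.
  have jf e : 0 < e -> exists N, forall k, (N <= k)%N -> `|z - j (f k)| <= e.
    move=> e0; have [N _ NP] := near_infty_natSinv_lt (PosNum e0).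
    exists N => k Nk; have [_ /ltW h] := fP k; apply: le_trans h _; exact/ltW/NP.
  have Tz_norm : pnorm mu Omega r (w \* (T z \- (fun=> 0%R)))%R = 0%E.
    rewrite -(@pnorm_cst0 _ _ _ mu Omega r r0); apply: pnorm_ae_eq => //.
      by apply: mw; apply: measurable_funB.
    by apply: filterS Tz0 => x + Ox => /(_ Ox) /= ->; rewrite subr0 mulr0.
  have f_null e : 0 < e -> exists N, forall k, (N <= k)%N ->
      (pnorm mu setT r (w \* f k)%R <= e%:E)%E.
    move=> e0; have d0 : 0 < e / (C + 1) by rewrite divr_gt0// ltr_wpDl.
    have [N NP] := jf _ d0; exists N => k /NP kN.
    rewrite pnorm_out ?gt_eqF//; last by move=> x xO /=; rewrite (C0infty_out (fO k) xO) mulr0.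
    rewrite -wLnormE ?gt_eqF// wLnorm_sub0.
    have m0 : measurable_fun Omega (fun=> 0 : R) by exact: measurable_cst.
    apply: le_trans (pnorm_wgtB (mC (fO k)) m0 (mT z)) _.
    rewrite Tz_norm adde0; apply: le_trans (TP' _ _ (fO k)) _; rewrite lee_fin.
    apply: (@le_trans _ _ ((C + 1) * (e / (C + 1)))).
      by apply: ler_pM => //; [rewrite lerDl|rewrite distrC].
    by rewrite mulrC divfK// gt_eqF// ltr_wpDl.
  have f_cauchy e : 0 < e -> exists N, forall k l, (N <= k)%N -> (N <= l)%N ->
      (pnorm mu setT p (radial_weight (n := n) p (a * p) \* egrad (f k \- f l))%R <= e%:E)%E.
    move=> e0; have e20 : 0 < e / 2 by rewrite divr_gt0.
    have [N NP] := jf _ e20; exists N => k l /NP kN /NP lN.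
    rewrite Dnorm_setT; last exact: C0inftyB.
    rewrite lee_fin jB// -(subrKA z) (splitr e).
    by apply: le_trans (ler_normD _ _) _; rewrite distrC lerD.
  have f1 k : Ck 1 (f k) by have [] := fO k.
  have grad_null := gradient_closable n0 p1 r_ge1 f1 f_null f_cauchy.
  rewrite -normr_le0; apply/ler_addgt0Pr => e e0; rewrite add0r.
  have e20 : 0 < e / 2 by rewrite divr_gt0.
  have [N NP] := jf _ e20; have [K KP] := grad_null _ e20.
  have kN := NP _ (leq_maxl N K); have := KP _ (leq_maxr N K).
  rewrite Dnorm_setT// lee_fin => kK.
  rewrite -[z](subrK (j (f (maxn N K)))) (splitr e).
  by apply: le_trans (ler_normD _ _) _; exact: lerD.
- by exists C.
Qed.

End imbedding.

Unset Implicit Arguments.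
Set Strict Implicit.
Set Printing Implicit Defensive.

Theorem theorem2p1 (R : realType) (n : nat) (Omega : set 'rV[R]_n)
    (p a r alpha : R) (D : completeNormedModType R)
    (j : ('rV[R]_n -> R) -> D)
    (Omega_open : open Omega) (Omega_connected : connected Omega)
    (Omega_bounded : bounded_set Omega) (Omega_C1 : C1_boundary Omega)
    (Omega0 : Omega 0)
    (p_gt1 : 1 < p) (p_ltn : p < n%:R) (a_lt : a < (n%:R - p) / p)
    (r_ge1 : 1 <= r) (r_lt : r < n%:R * p / (n%:R - p))
    (alpha_lt : alpha < (1 + a) * r + n%:R * (1 - r / p))
    (Dj : is_D1p_completion Omega a p j) :
  exists T : D -> 'rV[R]_n -> R,
    is_imbedding Omega r alpha j T /\ is_compact_map Omega r alpha T.
Proof.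
have [C C0 CP] := embedding_C0infty Omega_open Omega_bounded p_gt1 p_ltn a_lt
  r_ge1 r_lt alpha_lt Dj.
have /choice[T TP] := extension_exists Omega_open Omega_bounded p_gt1 p_ltn r_ge1 Dj CP C0.
exists T; split.
  exact: (extension_is_imbedding Omega_open p_gt1 p_ltn r_ge1 Dj C0 TP).
exact: (extension_is_compact Omega_open Omega_bounded p_gt1 p_ltn a_lt r_ge1
  r_lt alpha_lt Dj C0 TP).
Qed.
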